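(* Let $A$ be a primitive set with $f(A)>f(\mathcal P(A))+\epsilon_0$. Then $f(A_3)<f(\mathcal P(A_3))$, where $A_3=\{a\in A: a\text{ odd}\}$.
   Context: A set $A$ of integers greater than $1$ is primitive if no element of $A$ divides any other. For a set $B$ of integers $>1$, $f(B)=\sum_{b\in B}1/(b\log b)$, and $\mathcal P(B)$ is the set of primes dividing some element of $B$ (so $f(\mathcal P(B))=\sum_{p\in\mathcal P(B)}1/(p\log p)$). $\gamma$ is Euler's constant. A prime $q$ is a Mertens prime if $e^\gamma\prod_{r<q}(1-1/r)\le1/\log q$ (product over primes $r<q$). The constant $\epsilon_0$ is defined by $\epsilon_0=\sum_{p}\big(\frac{e^\gamma}{p}\prod_{r<p}(1-\frac1r)-\frac{1}{p\log p}\big)$, the sum over odd primes $p$ that are not Mertens primes. *)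

(* Defs.v *)
From mathcomp Require Import all_boot all_order all_algebra.
From mathcomp Require Import all_classical all_reals all_analysis.

Set Implicit Arguments.
Unset Strict Implicit.
Unset Printing Implicit Defensive.

Import Order.TTheory GRing.Theory Num.Theory numFieldNormedType.Exports.

Local Open Scope classical_set_scope.
Local Open Scope ring_scope.

Definition primitive (A : set nat) : Prop :=
  (forall a, A a -> (1 < a)%N) /\
  (forall a b, A a -> A b -> (a %| b)%N -> a = b).

(* The terms are nonnegative, so the sum over a possibly infinite set is taken
   in [0, +oo], independently of any enumeration. *)
Definition erdos_sum (R : realType) (B : set nat) : \bar R :=
  \esum_(b in B) ((b%:R * ln b%:R)^-1)%:E.

Definition prime_support (B : set nat) : set nat :=
  [set p | prime p /\ exists2 b, B b & (p %| b)%N].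

Definition euler_gamma (R : realType) : R :=
  limn (fun n : nat => series harmonic n - ln n%:R).

(* exp(gamma) * \prod_(r < q, r prime) (1 - 1/r) *)
Definition mertens_product (R : realType) (q : nat) : R :=
  expR (euler_gamma R) * \prod_(0 <= r < q | prime r) (1 - r%:R^-1).

Definition mertens_prime (R : realType) (q : nat) : Prop :=
  prime q /\ mertens_product R q <= (ln q%:R)^-1.

(* Each term is positive, precisely because p is a prime that is not Mertens. *)
Definition epsilon0 (R : realType) : \bar R :=
  \esum_(p in [set p : nat | [/\ prime p, odd p & ~ mertens_prime R p]])
    (mertens_product R p / p%:R - (p%:R * ln p%:R)^-1)%:E.

Definition odd_part (A : set nat) : set nat := [set a | A a /\ odd a].

(* Main.v *)
Require Import Defs.
From Stdlib Require Import NArith.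
From mathcomp Require Import all_boot all_order all_algebra.
From mathcomp Require Import ring lra zify.
From mathcomp Require Import all_classical all_reals all_analysis.

Set Implicit Arguments.
Unset Strict Implicit.
Unset Printing Implicit Defensive.

Import Order.TTheory GRing.Theory Num.Theory numFieldNormedType.Exports.

(* Write [M q = e^gamma \prod_(r < q) (1 - 1/r)] and [P b] for the largest prime factor of [b].
   Peeling off primes one at a time shows [\sum_b b^-1 \prod_(q <= r < P b) (1 - 1/r) <= 1] for a
   primitive set of [b]'s without prime factors below [q]. Since [M p ln (3 p) >= 1] for odd primes
   [p] and an odd composite [a] is at least [3 (P a)], the composites of least prime factor [q] in an
   odd primitive set contribute at most [M q / q] to [f]. Hence [f B <= f (P(B)) + eps0] for [B]
   primitive and odd, and [f B <= M 5 = e^gamma / 3 < f {2}] if [B] consists of composites prime to [6].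

   Suppose [f A_3 >= f (P(A_3))]. As [eps0 + M 3 / 3 < f {3}], a multiple of [3] in [A_3] is [3].
   Let [B_k] be the set of odd [b] with [2^k b] in [A], and [D_k] the set of multiples in [A_3] of
   elements of [B_k]. If [2^k] is not in [A], then [B_k] together with [A_3 \ D_k] is primitive and
   [f D_k <= f {2}], so [f B_k <= c := f (odd primes of P(A)) + eps0 + f {2} - f A_3]. Summing
   [f (2^k B_k) <= 2^-k f B_k] over [k] bounds the even part of [A] by [c], a contradiction.

   For the estimates on [M]: [theta n <= n ln 4] and Legendre's formula give
   [\sum_(p <= n) ln p / (p - 1) = ln n + O(1)] explicitly, partial summation turns this into
   bounds for [ln \prod_(p <= n) (1 - 1/p)] up to an additive constant, and the constant is found
   by comparing the Euler product of [zeta (1 + d)] with [1 + 1/d] as [d] tends to [0]. This settles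
   [q > 40000]; smaller primes are sieved and checked in fixed-point arithmetic. *)

Local Open Scope classical_set_scope.
Local Open Scope ring_scope.

(** * Logarithms and Euler's constant *)

(** Two numerical inequalities are tight and fix the constants. The slack is the factor [3] in
    [ln (3 p)], so the window containing [\sum_(p <= n) ln p / (p - 1) - ln n] must be shorter than
    [ln 3 = 1.0986...]; the elementary argument gives [2 (ln 2)^2 = 0.961...] plus lower-order
    terms, at most [207/200] from [40000] on. Second, [f {3} - M 3 / 3] is only about [0.0066], and
    [eps0] must fit below it. The scan shows that no odd prime below its limit [X] contributes to
    [eps0]; the rest is at most about [(23/40) M(X)^2].

    The assumption [f A_3 >= f (P(A_3))] serves only to exclude composite multiples of [3]. With
    them, the bound for [f D_k] would be [M 3 = 0.89...], which exceeds [f {2} = 0.72...]; without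
    them it is [M 5 = 0.59...]. In the end [f A_3] cancels: it occurs with a minus sign in the bound
    for the even part, and the [f {2}] there completes the odd primes of [P(A)] to [P(A)]. *)

Section RealTools.
Variable R : realType.
Implicit Types (f g df : R -> R) (a b x y t w : R) (m n k : nat).

Lemma ndecr_of_derive f df a b :
  (forall x, a <= x <= b -> is_derive x 1 f (df x)) ->
  (forall x, a <= x <= b -> 0 <= df x) -> a <= b -> f a <= f b.
Proof.
move=> fd df0 ab.
apply: (@ger0_derive1_ndecr _ f a b) => //.
- move=> x /[!in_itv]/= /andP[ax xb].
  by have [] := fd x; rewrite ?(ltW ax) ?(ltW xb).
- move=> x /[!in_itv]/= /andP[ax xb].
  have xab : a <= x <= b by rewrite (ltW ax) (ltW xb).
  by rewrite derive1E; have := fd x xab => /@derive_val ->; apply: df0.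
- apply: continuous_in_subspaceT => x; rewrite inE /= in_itv /= => xab.
  apply: differentiable_continuous; apply/derivable1_diffP.
  by have [] := fd x xab.
Qed.


Lemma ln_ratio_le a b : 0 < a -> a <= b -> ln b - ln a <= (b - a) / a.
Proof.
move=> a0 ab; have b0 : 0 < b by lra.
rewrite -ln_div ?posrE//.
have -> : b / a = 1 + (b - a) / a by field; rewrite !gt_eqF //; lra.
apply: le_ln1Dx; apply: lt_le_trans (_ : 0 <= _); first by lra.
by apply: divr_ge0; lra.
Qed.

Lemma ln_ratio_ge a b : 0 < a -> a <= b -> (b - a) / b <= ln b - ln a.
Proof.
move=> a0 ab; have b0 : 0 < b by lra.
have -> : ln b - ln a = - ln (a / b) by rewrite ln_div ?posrE//; lra.
have -> : a / b = 1 + (a - b) / b by field; rewrite !gt_eqF //; lra.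
have := @le_ln1Dx R ((a - b) / b).
have h : (a - b) / b = a / b - 1 by field; rewrite !gt_eqF //; lra.
have : 0 < a / b by apply: divr_gt0.
have -> : (b - a) / b = - ((a - b) / b) by field; rewrite !gt_eqF //; lra.
rewrite h => h0 /(_ _); set u := ln _; lra.
Qed.

End RealTools.

Section RealDerive.
Variable R : realType.
Implicit Types (f g : R -> R) (a b x t w : R) (n : nat).

Let derB f g x a b : is_derive x (1 : R) f a -> is_derive x (1 : R) g b ->
  is_derive x (1 : R) (fun z => f z - g z) (a - b).
Proof. exact: is_deriveB. Qed.

Let derD f g x a b : is_derive x (1 : R) f a -> is_derive x (1 : R) g b ->
  is_derive x (1 : R) (fun z => f z + g z) (a + b).
Proof. exact: is_deriveD. Qed.

Let derZ f x a (k : R) : is_derive x (1 : R) f a ->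
  is_derive x (1 : R) (fun z => k * f z) (k * a).
Proof. exact: is_deriveZ. Qed.

Let derid x : is_derive x (1 : R) (fun z => z) 1.
Proof. exact: is_derive_id. Qed.

Let dercst x (k : R) : is_derive x (1 : R) (fun=> k) 0.
Proof. exact: is_derive_cst. Qed.

Let derV f x a : f x != 0 -> is_derive x (1 : R) f a ->
  is_derive x (1 : R) (fun z => (f z)^-1) (- f x ^- 2 * a).
Proof. exact: is_deriveV. Qed.

Let der_eq f x a b : is_derive x (1 : R) f a -> a = b -> is_derive x (1 : R) f b.
Proof. by move=> ? <-. Qed.

Let derX x n : is_derive x (1 : R) (fun z => z ^+ n.+1) (n.+1%:R * x ^+ n).
Proof.
have := @is_deriveX R R id n.+1 x 1 1 (is_derive_id _ _).
have -> : (id : R -> R) ^+ n.+1 = (fun z => z ^+ n.+1) by apply/funext => z; rewrite fctE.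
by rewrite /GRing.scale/= mulr1.
Qed.

(** [1/x] is convex, so the trapezoid rule on [[1, t]] overestimates its integral; the difference
    has derivative [(1 - 1/x)^2 / 2]. *)
Lemma ln_trapezoid t : 1 <= t -> ln t <= (t - t^-1) / 2.
Proof.
move=> t1.
pose f (x : R) := (x - x^-1) / 2 - ln x.
pose df (x : R) := (1 + x ^- 2) / 2 - x^-1.
have H : f 1 <= f t.
  apply: (@ndecr_of_derive R f df) => // x /andP[x1 xt]; last first.
    have x0 : 0 < x by lra.
    have -> : df x = (1 - x^-1) ^+ 2 / 2 by rewrite /df; field; rewrite !gt_eqF //; lra.
    by apply: divr_ge0 => //; apply: sqr_ge0.
  have x0 : 0 < x by lra.
  have xn0 : x != 0 by rewrite gt_eqF.
  have fE : f = (fun z => 2^-1 * (z - z^-1) - ln z).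
    by apply/funext => z; rewrite /f mulrC.
  rewrite fE; apply: (der_eq (derB (derZ _ (derB (derid x)
    (derV (f := fun z => z) xn0 (derid x)))) (is_derive1_ln x0))).
  by rewrite /df; field.
by move: H; rewrite /f ln1 invr1 subrr mul0r subr0 subr_ge0.
Qed.

(** The midpoint rule underestimates the integral of the convex function [1/x] over [[1, t]]. *)
Lemma ln_midpoint t : 1 <= t -> 2 * (t - 1) / (t + 1) <= ln t.
Proof.
move=> t1.
pose f (x : R) := ln x + 4 * (x + 1)^-1.
pose df (x : R) := x^-1 - 4 * (x + 1) ^- 2.
have H : f 1 <= f t.
  apply: (@ndecr_of_derive R f df) => // x /andP[x1 xt]; last first.
    have x0 : 0 < x by lra.
    have -> : df x = (x - 1) ^+ 2 * (x * (x + 1) ^+ 2)^-1.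
      by rewrite /df; field; rewrite !gt_eqF //; lra.
    by apply: mulr_ge0; rewrite ?sqr_ge0// invr_ge0 mulr_ge0 ?sqr_ge0// ltW.
  have x0 : 0 < x by lra.
  have xn : x + 1 != 0 by rewrite gt_eqF; lra.
  apply: (der_eq (derD (is_derive1_ln x0)
    (derZ _ (derV (f := fun z => z + 1) xn (derD (derid x) (dercst x 1)))))).
  by rewrite /df; field; rewrite !gt_eqF //; lra.
have -> : 2 * (t - 1) / (t + 1) = 2 - 4 * (t + 1)^-1 by field; rewrite !gt_eqF //; lra.
have e : 4 * (1 + 1)^-1 = 2 :> R by field.
by move: H; rewrite /f ln1 e; lra.
Qed.

(** The remainder has derivative [x^n / (1 - x)], which on [[0, w]] lies between [0] and its value
    at [w]. Fixed [w] serve to evaluate logarithms; [w = e^-d] supplies the divergent main term in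
    the comparison with zeta. *)
Lemma ln1B_series_bounds w n : 0 <= w < 1 ->
  \sum_(0 <= j < n) w ^+ j.+1 / j.+1%:R <= - ln (1 - w)
  <= \sum_(0 <= j < n) w ^+ j.+1 / j.+1%:R + w ^+ n.+1 / (1 - w).
Proof.
move=> /andP[w0 w1].
pose f (x : R) := - ln (1 - x) - \sum_(0 <= j < n) x ^+ j.+1 / j.+1%:R.
pose df (x : R) := x ^+ n / (1 - x).
have geom x : x < 1 -> df x = (1 - x)^-1 - \sum_(0 <= j < n) x ^+ j.
  move=> x1; rewrite /df; have xn : 1 - x != 0 by rewrite gt_eqF; lra.
  elim: n {f df} => [|m IH]; first by rewrite big_geq // subr0 expr0 mul1r.
  rewrite big_nat_recr//= opprD addrA -IH exprS; by field.
have fd x : 0 <= x <= w -> is_derive x 1 f (df x).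
  move=> /andP[x0 xw]; have x1 : x < 1 by lra.
  have h0 : 0 < 1 - x by lra.
  have hs : is_derive x 1 (fun z : R => \sum_(0 <= j < n) z ^+ j.+1 / j.+1%:R)
      (\sum_(0 <= j < n) x ^+ j).
    elim: n {f df geom} => [|m IH].
      rewrite big_geq//; under eq_fun do rewrite big_geq//.
      exact: is_derive_cst.
    rewrite big_nat_recr//=.
    have -> : (fun z : R => \sum_(0 <= j < m.+1) z ^+ j.+1 / j.+1%:R) =
        (fun z => \sum_(0 <= j < m) z ^+ j.+1 / j.+1%:R + m.+1%:R^-1 * z ^+ m.+1).
      by apply/funext => z; rewrite big_nat_recr//= [X in _ + X]mulrC.
    apply: derD => //; apply: (der_eq (derZ _ (derX x m))).
      by rewrite mulKf // pnatr_eq0.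
  rewrite geom // /f; apply: derB => //.
  have -> : (fun z : R => - ln (1 - z)) = (fun z => (- 1) * (@ln R \o (fun z => 1 - z)) z).
    by apply/funext => z /=; rewrite mulN1r.
  apply: (der_eq (derZ (-1) (is_derive1_comp (g := fun z => 1 - z)
    (is_derive1_ln h0) (derB (dercst x 1) (derid x))))).
  by rewrite sub0r mulrN1 mulN1r opprK.
have df0 x : 0 <= x <= w -> 0 <= df x.
  by move=> /andP[x0 xw]; apply: divr_ge0; [apply: exprn_ge0|lra].
have f0 : f 0 = 0.
  rewrite /f subr0 ln1 oppr0 sub0r big1 ?oppr0// => i _.
  by rewrite expr0n mul0r.
apply/andP; split.
  have := ndecr_of_derive fd df0 w0; rewrite f0 /f; lra.
pose g (x : R) := x * (w ^+ n / (1 - w)) - f x.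
pose dg (x : R) := w ^+ n / (1 - w) - df x.
have : g 0 <= g w.
  apply: (@ndecr_of_derive R g dg 0 w) => [x xw|x xw|]; last exact: w0.
  - have -> : g = (fun z => (w ^+ n / (1 - w)) * z - f z).
      by apply/funext => z; rewrite /g mulrC.
    apply: (der_eq (derB (derZ _ (derid x)) (fd x xw))).
    by rewrite mulr1.
  - rewrite /dg subr_ge0 /df; move: xw => /andP[x0 xw].
  apply: ler_pM; rewrite ?exprn_ge0 ?invr_ge0//; first lra.
    by rewrite lerXn2r ?nnegrE //; lra.
  by rewrite lef_pV2 ?posrE; lra.
rewrite /g f0 mul0r subr0 exprS mulrA /f; lra.
Qed.


End RealDerive.

Section EulerGamma.
Variable R : realType.
Implicit Types (m n k : nat).

Let ga : R := limn (fun n : nat => series harmonic n - ln n%:R).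

Lemma series_harmonicS n : series harmonic n.+1 = series harmonic n + n.+1%:R^-1 :> R.
Proof. by rewrite /series/= big_nat_recr. Qed.

(** The shift by one skips index [0], where [ln 0 = 0] would break monotonicity. *)
Let u n : R := series harmonic n.+1 - ln n.+1%:R.

Let u_decr m n : (m <= n)%N -> u n <= u m.
Proof.
move=> /subnK <-; elim: (n - m)%N => [|k IH]; first by rewrite add0n.
apply: le_trans IH; rewrite addSn /u series_harmonicS.
have := @ln_ratio_ge R (k + m).+1%:R (k + m).+2%:R.
rewrite ltr0n ler_nat leqnSn => /(_ isT isT).
have -> : (k + m).+2%:R - (k + m).+1%:R = 1 :> R by rewrite -natr1; ring.
by rewrite mul1r; move: (_^-1) => i ?; lra.
Qed.

Let u_ge0 n : 0 <= u n.
Proof.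
suff: ln n.+2%:R <= series harmonic n.+1 :> R.
  have : ln n.+1%:R <= ln n.+2%:R :> R by rewrite ler_ln ?posrE ?ltr0n// ler_nat.
  rewrite /u; lra.
elim: n => [|n IH].
  rewrite /series/= big_nat1 invr1.
  by have := @le_ln1Dx R 1; rewrite -natr1; apply; lra.
rewrite series_harmonicS; have := @ln_ratio_le R n.+2%:R n.+3%:R.
rewrite ltr0n ler_nat leqnSn => /(_ isT isT).
have -> : n.+3%:R - n.+2%:R = 1 :> R by rewrite -[n.+3%:R]natr1; ring.
by rewrite mul1r; move: (_^-1) => i ?; lra.
Qed.

Let u_cvg : cvgn u.
Proof.
apply: nonincreasing_is_cvgn; first by move=> m n; exact: u_decr.
by exists 0 => _ [n _ <-]; exact: u_ge0.
Qed.

Let gaE : ga = limn u.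
Proof.
rewrite /ga; apply: cvg_lim => //.
by rewrite -(cvg_shiftS (fun n : nat => series harmonic n - ln n%:R)); exact: u_cvg.
Qed.

(** By the midpoint rule [H_m - ln (m + 1/2)] is nonincreasing, and it still tends to gamma. The
    half shift leaves an error of order [1/n^2], so that [n = 32] is precise enough later. *)
Lemma euler_gamma_le n : (0 < n)%N -> ga <= series harmonic n - ln (n%:R + 2^-1).
Proof.
case: n => // n _.
pose c m : R := series harmonic m.+1 - ln (m.+1%:R + 2^-1).
have c_decr m : c m.+1 <= c m.
  rewrite /c series_harmonicS.
  have p1 : 0 < m.+1%:R + 2^-1 :> R by rewrite addr_gt0 ?ltr0n ?invr_gt0.
  have e : m.+2%:R = m.+1%:R + 1 :> R by rewrite natr1.
  have := @ln_midpoint R ((m.+2%:R + 2^-1) / (m.+1%:R + 2^-1)).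
  rewrite {1}ler_pdivlMr // mul1r lerD2r ler_nat leqnSn => /(_ isT).
  rewrite ln_div ?posrE //.
  have -> : 2 * ((m.+2%:R + 2^-1) / (m.+1%:R + 2^-1) - 1)
      / ((m.+2%:R + 2^-1) / (m.+1%:R + 2^-1) + 1) = m.+2%:R^-1 :> R.
    by rewrite e; field; rewrite !gt_eqF //; lra.
  by move: (m.+2%:R^-1) => i ?; lra.
have cle k : c (k + n)%N <= c n.
  by elim: k => // k IH; apply: le_trans IH; rewrite addSn.
apply/ler_addgt0Pr => e e0.
(* Since [ln (x + 1/2) - ln x <= 1 / (2 x)], far enough out [c] is within [e] of [u]. *)
have [k kP] : exists k : nat, e^-1 < k%:R 
    by exists (Num.bound e^-1); apply: archi_boundP; rewrite invr_ge0 ltW.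
have := nonincreasing_cvgn_ge u_decr u_cvg (k + n)%N; rewrite -gaE => h.
apply: le_trans h _; apply: le_trans (_ : c (k + n)%N + e <= _); last first.
  by rewrite lerD2r; exact: cle.
rewrite /c /u; have p1 : 0 < (k + n).+1%:R :> R by rewrite ltr0n.
have := @ln_ratio_le R (k + n).+1%:R ((k + n).+1%:R + 2^-1) p1.
rewrite lerDl invr_ge0 ler0n => /(_ isT).
have : 2^-1 / (k + n).+1%:R <= e :> R.
  rewrite ler_pdivrMr //.
  have h1 : 1 <= e * k%:R by rewrite mulrC -ler_pdivrMr // mul1r ltW.
  have h2 : e * k%:R <= e * (k + n).+1%:R 
    by apply: ler_wpM2l; [exact: ltW|rewrite ler_nat; lia].
  lra.
by rewrite addrAC subrr add0r; move: (2^-1 / _) => d ? ?; lra.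
Qed.

(** By the trapezoid rule [H_m - ln m - 1 / (2 m)] is nondecreasing, with limit gamma. *)
Lemma euler_gamma_ge n : (0 < n)%N -> series harmonic n - ln n%:R - (2 * n%:R)^-1 <= ga.
Proof.
case: n => // n _.
pose c m : R := u m - (2 * m.+1%:R)^-1.
have c_incr m : c m <= c m.+1.
  rewrite /c /u (series_harmonicS m.+1).
  have p1 : 0 < m.+1%:R :> R by rewrite ltr0n.
  have e : m.+2%:R = m.+1%:R + 1 :> R by rewrite natr1.
  have := @ln_trapezoid R (m.+2%:R / m.+1%:R).
  rewrite ler_pdivlMr // mul1r ler_nat leqnSn => /(_ isT).
  rewrite ln_div ?posrE ?ltr0n //.
  have -> : (m.+2%:R / m.+1%:R - (m.+2%:R / m.+1%:R)^-1) / 2 =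
     m.+2%:R^-1 - (2 * m.+2%:R)^-1 + (2 * m.+1%:R)^-1 :> R.
    by rewrite e; field; rewrite !gt_eqF //; lra.
  rewrite !invfM.
  by move: (m.+1%:R^-1) (m.+2%:R^-1) => i j ?; lra.
have cle k : c n <= c (k + n)%N.
  by elim: k => // k IH; apply: le_trans IH _; rewrite addSn.
rewrite gaE; apply: limr_ge; first exact: u_cvg.
near=> m.
have -> : m = (m - n + n)%N by rewrite subnK//; near: m; exact: nbhs_infty_ge.
apply: le_trans (cle (m - n)%N) _.
by rewrite /c gerBl invr_ge0 mulr_ge0 // ler0n.
Unshelve. all: by end_near.
Qed.

End EulerGamma.

(** * Chebyshev's bound for primorials and sums over primes *)

(** ['C(2m+1, m)] and ['C(2m+1, m+1)] are equal, and both occur in the binomial expansion of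
    [2^(2m+1)]. *)
Lemma bin_half_le m : ('C(m.*2.+1, m) <= 4 ^ m)%N.
Proof.
have h : (2 * 'C(m.*2.+1, m) <= 2 ^ m.*2.+1)%N.
  have -> : (2 ^ m.*2.+1 = \sum_(i < m.*2.+2) 'C(m.*2.+1, i))%N.
    by rewrite -[2%N]/(1 + 1)%N expnDn; apply: eq_bigr => i _; rewrite !exp1n !muln1.
  have mo : (m < m.*2.+2)%N by lia.
  have m1o : (m.+1 < m.*2.+2)%N by lia.
  rewrite (bigD1 (Ordinal mo))//= (bigD1 (Ordinal m1o))/=; last by rewrite -val_eqE/=; lia.
  have -> : 'C(m.*2.+1, m.+1) = 'C(m.*2.+1, m).
    by rewrite -(@bin_sub m.*2.+1 m); [congr ('C(_, _)); lia|lia].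
  lia.
move: h; rewrite expnS leq_pmul2l // -mul2n expnM; exact.
Qed.

Lemma prod_primes_dvd a b N :
  (forall p, prime p -> (a <= p < b)%N -> (p %| N)%N) ->
  (\prod_(a <= p < b | prime p) p %| N)%N.
Proof.
have [ab|ba _] := leqP a b; last by rewrite big_geq ?dvd1n// ltnW.
elim: b ab => [|b IH] ab H; first by rewrite big_geq ?dvd1n.
have [abE|] := eqVneq a b.+1; first by rewrite big_geq ?dvd1n// abE.
move=> anb; have {}ab : (a <= b)%N by lia.
rewrite big_mkcond big_nat_recr//= -big_mkcond.
have IHb : (\prod_(a <= p < b | prime p) p %| N)%N.
  by apply: IH => // p pp /andP[ap pb]; apply: H => //; lia.
case: ifPn => [pb|_]; last by rewrite muln1.
rewrite Gauss_dvd; first by rewrite IHb H// ab leqnn.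
rewrite coprime_sym prime_coprime// Euclid_dvd_prod// big_has_cond.
apply/hasPn => p; rewrite mem_index_iota => /andP[ap pltb].
apply/negP => /andP[pp]; rewrite dvdn_prime2// => /eqP bp; lia.
Qed.

(** Erdos's induction: for [n = 2m + 1] the primes from [m + 2] on divide ['C(2m+1, m)]; an even
    [n > 2] adds no prime. *)
Lemma primorial_le n : (\prod_(0 <= p < n.+1 | prime p) p <= 4 ^ n)%N.
Proof.
elim/ltn_ind: n => -[|[|[|n]]] IH; try by rewrite unlock.
(* The number treated is [n.+3], whose parity is opposite to that of [n]. *)
have [ev|od] := boolP (odd n); last first.
  have [m nE] : exists m, n.+3 = m.*2.+1 by exists n./2.+1; lia.
  rewrite nE (@big_cat_nat _ _ _ m.+2)//=; last by lia.
  have h1 : (\prod_(0 <= p < m.+2 | prime p) p <= 4 ^ m.+1)%N by apply: IH; lia.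
  have h2 : (\prod_(m.+2 <= p < m.*2.+2 | prime p) p <= 4 ^ m)%N.
    apply: leq_trans (bin_half_le m); apply: dvdn_leq; first by rewrite bin_gt0; lia.
    apply: prod_primes_dvd => p pp /andP[mp p2m].
    have : (p %| 'C(m.*2.+1, m) * (m`! * (m.*2.+1 - m)`!))%N.
      rewrite bin_fact; last by lia.
      by apply: dvdn_fact; rewrite prime_gt0//=; lia.
    rewrite !Euclid_dvdM// => /orP[//|/orP[]].
      by rewrite fact_prod Euclid_dvd_prod// big_has => /hasP[i];
        rewrite mem_index_iota => /andP[i0 im] /dvdn_leq; lia.
    by rewrite fact_prod Euclid_dvd_prod// big_has => /hasP[i];
        rewrite mem_index_iota => /andP[i0 im] /dvdn_leq; lia.
  have -> : (4 ^ m.*2.+1 = 4 ^ m.+1 * 4 ^ m)%N by rewrite -expnD; congr (_ ^ _)%N; lia.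
  exact: leq_mul.
have np : ~~ prime n.+3.
  by apply/negP => /even_prime [|]; [lia|rewrite /= ev].
rewrite big_mkcond big_nat_recr//= -big_mkcond (negbTE np) muln1.
apply: leq_trans (IH n.+2 _) _ => //; by rewrite leq_exp2l.
Qed.

(** Of two consecutive numbers above [2] at most one is prime, so the count grows by at most one in
    two steps. *)
Lemma primepi_half n : (8 <= n)%N -> (2 * \sum_(0 <= p < n.+1 | prime p) 1 <= n)%N.
Proof.
elim/ltn_ind: n => n IH n8.
have [n10|n10] := ltnP n 10.
  by have [->|->] : n = 8%N \/ n = 9%N; [lia|rewrite unlock|rewrite unlock].
case: n n8 n10 IH => [|[|n]]// _ n10 /(_ n (ltnW (leqnn _))) IH.
have {}IH : (2 * \sum_(0 <= p < n.+1 | prime p) 1 <= n)%N by apply: IH; lia.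
rewrite big_mkcond (@big_nat_recr _ _ _ n.+2)//= (@big_nat_recr _ _ _ n.+1)//= -big_mkcond/=.
move: IH; move: (\sum_(0 <= p < n.+1 | prime p) 1)%N => s IH.
suff : ~~ (prime n.+1 && prime n.+2) by do 2 case: prime; move=> //= _; lia.
apply/negP => /andP[p1 p2]; have [|o1] := even_prime p1; first by lia.
have [|o2] := even_prime p2; first by lia.
by move: o1 o2 => /=; case: odd.
Qed.

Section PrimeSums.
Variable R : realType.
Implicit Types (m n k p r : nat).

Definition psum (F : nat -> R) n : R := \sum_(0 <= p < n.+1 | prime p) F p.

Lemma psumS F n : psum F n.+1 = psum F n + (if prime n.+1 then F n.+1 else 0).
Proof. by rewrite /psum big_mkcond big_nat_recr//= -big_mkcond. Qed.

Lemma psum0 F : psum F 0 = 0.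
Proof. by rewrite /psum unlock. Qed.

Lemma psum1 F : psum F 1 = 0.
Proof. by rewrite psumS psum0 addr0. Qed.

Lemma ler_psum F G n : (forall p, prime p -> (p <= n)%N -> F p <= G p) ->
  psum F n <= psum G n.
Proof.
move=> H; rewrite /psum big_nat_cond [leRHS]big_nat_cond.
by apply: ler_sum => p /andP[/andP[_ pn] pp]; apply: H.
Qed.

Lemma psum_ge0 F n : (forall p, prime p -> 0 <= F p) -> 0 <= psum F n.
Proof. by move=> H; apply: sumr_ge0 => p; exact: H. Qed.

Lemma psumD F G n : psum (fun p => F p + G p) n = psum F n + psum G n.
Proof. by rewrite /psum big_split. Qed.

Lemma psumZ c F n : psum (fun p => c * F p) n = c * psum F n.
Proof. by rewrite /psum -mulr_sumr. Qed.

Lemma ln_nat_ge0 n : 0 <= ln n%:R :> R.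
Proof. by case: n => [|n]; [rewrite ln0|rewrite ln_ge0// ler1n]. Qed.

Lemma ln_nat_gt0 n : (1 < n)%N -> 0 < ln n%:R :> R.
Proof. by move=> n1; rewrite ln_gt0// ltr1n. Qed.

Lemma ler_ln_nat m n : (0 < m)%N -> (m <= n)%N -> ln m%:R <= ln n%:R :> R.
Proof. by move=> m0 mn; rewrite ler_ln ?posrE ?ltr0n ?ler_nat//; lia. Qed.

Lemma ln_prod_nat n (P : pred nat) (F : nat -> nat) :
  (forall i, P i -> (0 < F i)%N) ->
  ln (\prod_(0 <= i < n | P i) F i)%:R = \sum_(0 <= i < n | P i) ln (F i)%:R :> R.
Proof.
move=> F0; rewrite natr_prod.
have : 0 < \prod_(0 <= i < n | P i) (F i)%:R :> R.
  by apply: prodr_gt0 => i /F0; rewrite ltr0n.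
elim: n => [|n IH]; first by rewrite !big_geq// ln1.
rewrite big_mkcond big_nat_recr//= -big_mkcond [RHS]big_mkcond big_nat_recr//= -[in RHS]big_mkcond.
have h : 0 < \prod_(0 <= i < n | P i) (F i)%:R :> R.
  by apply: prodr_gt0 => i /F0; rewrite ltr0n.
case: ifPn => Pn _; last by rewrite mulr1 addr0 IH.
by rewrite lnM ?posrE ?ltr0n ?F0// IH.
Qed.

Definition theta : nat -> R := psum (fun p => ln p%:R).

Lemma theta_le n : theta n <= ln 4 * n%:R.
Proof.
rewrite /theta /psum -ln_prod_nat; last by move=> p; exact: prime_gt0.
have -> : ln 4 * n%:R = ln (4 ^ n)%:R :> R.
  by rewrite mulr_natr natrX lnXn ?ltr0n.
apply: ler_ln_nat (primorial_le n); rewrite prodn_cond_gt0// => p; exact: prime_gt0.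
Qed.

Lemma theta_ge0 n : 0 <= theta n.
Proof. by apply: psum_ge0 => p _; exact: ln_nat_ge0. Qed.

Lemma ln_fact n : ln n`!%:R = psum (fun p => (logn p n`!)%:R * ln p%:R) n :> R.
Proof.
have f0 := fact_gt0 n.
have nf : (n < n`!.+1)%N by rewrite ltnS; case: n {f0} => // n; rewrite factS leq_pmulr// fact_gt0.
rewrite -{1}(partnT f0) (widen_partn _ (leqnn _)) ln_prod_nat; last first.
  by move=> [|p] _; [rewrite lognE|rewrite expn_gt0].
rewrite (@big_cat_nat _ _ _ n.+1)//= [X in _ + X]big_nat_cond [X in _ + X]big1 ?addr0.
  rewrite [RHS]big_mkcond /= ; apply: eq_bigr => p _.
  case: ifPn => [pp|np]; last by rewrite lognE (negbTE np) ln1.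
  by rewrite natrX lnXn ?mulr_natl// ltr0n prime_gt0.
move=> p /andP[/andP[np _] _].
have [pp|np'] := boolP (prime p); last by rewrite lognE (negbTE np') ln1.
rewrite logn_fact// big_nat_cond big1 ?ln1// => k /andP[/andP[k0 _] _].
apply: divn_small; apply: (leq_trans np).
by rewrite -{1}[p]expn1 leq_exp2l // prime_gt1.
Qed.

Lemma ln_fact_ge n : (0 < n)%N -> n%:R * ln n%:R - n%:R <= ln n`!%:R :> R.
Proof.
elim: n => // -[_ _|n IH _]; first by rewrite (_ : 1`! = 1)%N// !ln1 mulr0; lra.
rewrite factS natrM lnM ?posrE ?ltr0n ?fact_gt0//.
have := IH isT; have := @ln_ratio_le R n.+1%:R n.+2%:R.
rewrite ltr0n ler_nat leqnSn => /(_ isT isT).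
rewrite ler_pdivlMr ?ltr0n//.
have -> : n.+2%:R = n.+1%:R + 1 :> R by rewrite natr1.
set x := n.+1%:R; set l := ln x; set l' := ln (x + 1) => h1 h2; nra.
Qed.

Lemma ln_fact_le n : (0 < n)%N -> ln n`!%:R <= n%:R * ln n%:R - n%:R + 1 + ln n%:R :> R.
Proof.
elim: n => // -[_ _|n IH _]; first by rewrite (_ : 1`! = 1)%N// !ln1 mulr0; lra.
rewrite factS natrM lnM ?posrE ?ltr0n ?fact_gt0//.
have := IH isT; have := @ln_ratio_ge R n.+1%:R n.+2%:R.
rewrite ltr0n ler_nat leqnSn => /(_ isT isT).
rewrite ler_pdivrMr ?ltr0n//.
have -> : n.+2%:R = n.+1%:R + 1 :> R by rewrite natr1.
set x := n.+1%:R; set l := ln x; set l' := ln (x + 1) => h1 h2; nra.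
Qed.

Lemma geometric_le p m : (1 < p)%N ->
  \sum_(1 <= k < m.+1) (p%:R ^- k) = (1 - p%:R ^- m) / (p%:R - 1) :> R.
Proof.
move=> p1; have p0 : p%:R - 1 != 0 :> R by rewrite subr_eq0 pnatr_eq1; lia.
have pn0 : p%:R != 0 :> R by rewrite pnatr_eq0; lia.
elim: m => [|m IH]; first by rewrite big_geq// expr0 invr1 subrr mul0r.
rewrite big_nat_recr//= IH exprS; field.
by rewrite p0 pn0 expf_neq0.
Qed.

Lemma logn_fact_le n p : prime p -> (logn p n`!)%:R <= n%:R / (p%:R - 1) :> R.
Proof.
move=> pp; have p1 := prime_gt1 pp; rewrite logn_fact// natr_sum.
apply: le_trans (_ : \sum_(1 <= k < n.+1) (n%:R * p%:R ^- k) <= _).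
  apply: ler_sum => k _; rewrite ler_pdivlMr ?exprn_gt0 ?ltr0n ?(ltnW p1)//.
  by rewrite -natrX -natrM ler_nat leq_trunc_div.
rewrite -mulr_sumr geometric_le//; apply: ler_wpM2l => //.
rewrite ler_pdivrMr ?subr_gt0 ?ltr1n// mulVf.
  by rewrite gerBl invr_ge0 exprn_ge0.
by rewrite subr_eq0 pnatr_eq1; lia.
Qed.

Lemma divn_real_gt n d : (0 < d)%N -> (n%:R + 1) / d%:R - 1 <= (n %/ d)%:R :> R.
Proof.
move=> d0; rewrite lerBlDr ler_pdivrMr ?ltr0n// !natr1 -natrM ler_nat.
by have := divn_eq n d; have := ltn_pmod n d0; nia.
Qed.

(** In Legendre's formula only the powers [p^k] with [k <= t = trunc_log p n] matter, and each floor
    is at least [(n + 1) / p^k - 1]. As [n + 1 <= p^(t+1)], cutting the geometric series at [t]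
    keeps the total loss below [t + 1]. *)
Lemma logn_fact_ge_trunc n p : prime p -> (0 < n)%N ->
  n%:R / (p%:R - 1) - (trunc_log p n)%:R - 1 <= (logn p n`!)%:R :> R.
Proof.
move=> pp n0; have p1 := prime_gt1 pp; rewrite logn_fact// natr_sum.
set t := trunc_log p n; have [tn nt] := andP (trunc_log_bounds p1 n0).
have tlen : (t <= n)%N by apply: leq_trans tn; apply: ltnW; apply: ltn_expl.
rewrite (@big_cat_nat _ _ _ t.+1)//=.
apply: le_trans (_ : \sum_(1 <= k < t.+1) ((n%:R + 1) * p%:R ^- k - 1) <= _); last first.
  apply: ler_wpDr; first by apply: sumr_ge0.
  apply: ler_sum => k _; have := @divn_real_gt n (p ^ k); rewrite natrX; apply.
  by rewrite expn_gt0 prime_gt0.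
rewrite sumrB -mulr_sumr geometric_le// sumr_const_nat subSS subn0.
have P0 : 0 < p%:R - 1 :> R by rewrite subr_gt0 ltr1n.
have h : (n%:R + 1) * p%:R ^- t <= p%:R :> R.
  rewrite ler_pdivrMr ?exprn_gt0 ?ltr0n ?prime_gt0// -exprS -natrX natr1 ler_nat//.
rewrite -subr_ge0.
have -> : (n%:R + 1) * ((1 - p%:R ^- t) / (p%:R - 1)) - t%:R
  - (n%:R / (p%:R - 1) - t%:R - 1) =
  (p%:R - (n%:R + 1) * p%:R ^- t) / (p%:R - 1) :> R.
  by field; rewrite ?gt_eqF// ?exprn_gt0 ?ltr0n ?prime_gt0.
by apply: divr_ge0; [rewrite subr_ge0|exact: ltW].
Qed.

(** Only the first term of Legendre's formula is kept; this serves the primes above the cutoff in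
    [mertens_sum_le_split]. *)
Lemma logn_fact_ge_div n p : prime p -> (n %/ p)%:R <= (logn p n`!)%:R :> R.
Proof.
move=> pp; rewrite ler_nat logn_fact//; case: n => [|n]; first by rewrite div0n.
by rewrite big_ltn// expn1 leq_addr.
Qed.

End PrimeSums.

(** * Mertens' first theorem *)

Section PartialSummation.
Variable R : realType.
Implicit Types (m n k p r : nat) (A w : nat -> R).

Lemma abel_sum A w m n : (m < n)%N ->
  \sum_(m <= k < n) (A k.+1 - A k) * w k.+1 =
  A n * w n - A m * w m.+1 + \sum_(m.+1 <= k < n) A k * (w k - w k.+1).
Proof.
elim: n => // n IH; rewrite ltnS leq_eqVlt => /predU1P[->|mn].
  by rewrite big_nat1 big_geq// addr0 mulrBl.
by rewrite big_nat_recr ?(ltnW mn)//= IH// [in RHS]big_nat_recr//=; ring.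
Qed.

(** After summation by parts, [A n] and the [A k] carry nonnegative weights of total [w m.+1],
    against [- A m * w m.+1]. For [m = n] the sum is empty, but nothing is known about the sign of
    [w m.+1], hence the second disjunct. *)
Lemma sum_diff_bounds A w m n lo hi : (m <= n)%N ->
  (forall k, (m <= k <= n)%N -> lo <= A k <= hi) ->
  (forall k, (m < k <= n)%N -> 0 <= w k) ->
  (forall k, (m < k < n)%N -> w k.+1 <= w k) ->
  `|\sum_(m <= k < n) (A k.+1 - A k) * w k.+1| <= (hi - lo) * w m.+1 \/ m = n.
Proof.
rewrite leq_eqVlt => /predU1P[->|mn] HA w0 wd; [by right|left].
rewrite abel_sum//.
have wn0 : 0 <= w n by apply: w0; lia.
have wtel : \sum_(m.+1 <= k < n) (w k - w k.+1) = w m.+1 - w n.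
  by rewrite (telescope_sumr_eq (fun k => - w k)) //; [ring|move=> k _; ring].
have hs : lo * (w m.+1 - w n) <= \sum_(m.+1 <= k < n) A k * (w k - w k.+1) <= hi * (w m.+1 - w n).
  rewrite -wtel !mulr_sumr big_nat_cond [leRHS in (_ <= leRHS) && _]big_nat_cond.
  rewrite [X in _ && (X <= _)]big_nat_cond [X in _ && (_ <= X)]big_nat_cond.
  apply/andP; split; apply: ler_sum => k /andP[/andP[mk kn] _].
    apply: ler_wpM2r; first by rewrite subr_ge0 wd// mk kn.
    by have /andP[] := HA k ltac:(lia).
  apply: ler_wpM2r; first by rewrite subr_ge0 wd// mk kn.
  by have /andP[] := HA k ltac:(lia).
have /andP[l1 l2] := HA n ltac:(lia).
have /andP[l3 l4] := HA m ltac:(lia).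
have w1 : 0 <= w m.+1 by apply: w0; lia.
have e1 : 0 <= (A n - lo) * w n by rewrite mulr_ge0 ?subr_ge0.
have e2 : 0 <= (hi - A n) * w n by rewrite mulr_ge0 ?subr_ge0.
have e3 : 0 <= (A m - lo) * w m.+1 by rewrite mulr_ge0 ?subr_ge0.
have e4 : 0 <= (hi - A m) * w m.+1 by rewrite mulr_ge0 ?subr_ge0.
move: hs => /andP[]; set s := \sum_(_ <= k < _) _ => s1 s2.
by rewrite ler_norml; apply/andP; split; lra.
Qed.

End PartialSummation.

Section Mertens1.
Variable R : realType.
Implicit Types (m n k p r : nat).
Local Notation theta := (@theta R).

Lemma psum_range (F : nat -> R) m n : (m <= n)%N ->
  psum F n - psum F m = \sum_(m <= k < n) (psum F k.+1 - psum F k).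
Proof. by move=> mn; rewrite telescope_sumr. Qed.

Lemma sum_inv_le_ln m n : (0 < m)%N -> (m <= n)%N ->
  \sum_(m <= k < n) k.+1%:R^-1 <= ln n%:R - ln m%:R :> R.
Proof.
move=> m0 mn; rewrite -(telescope_sumr (fun k => ln k%:R : R))// big_nat_cond [leRHS]big_nat_cond.
apply: ler_sum => k /andP[/andP[mk _] _].
have := @ln_ratio_ge R k%:R k.+1%:R; rewrite ltr0n ler_nat leqnSn (leq_trans m0 mk).
by move=> /(_ isT isT); rewrite -natr1 addrAC subrr add0r mul1r.
Qed.

(* The fractional part of [n / p] is at most [1], and at most [n / p - 1], which is better for [p > n / 2]. *)
Lemma sum_frac_le n : (1 < n)%N ->
  psum (fun p => ln p%:R * (n%:R / p%:R - (n %/ p)%:R)) n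
    <= ln 4 * (n%:R * ln 2 + 2) :> R.
Proof.
move=> n1; set h := n./2; have h0 : (0 < h)%N by rewrite /h; lia.
have hn : (h < n)%N by rewrite /h; lia.
pose w k : R := n%:R / k%:R - 1.
have n0 : 0 < n%:R :> R by rewrite ltr0n; lia.
pose F (p : nat) : R := if (p <= h)%N then ln p%:R else ln p%:R * w p.
apply: le_trans (_ : psum F n <= _).
  apply: ler_psum => p pp pn; rewrite /F; have p0 := prime_gt0 pp.
  have l0 := ln_nat_ge0 R p.
  have np : (1 <= n %/ p)%N by rewrite divn_gt0.
  case: ifPn => _; last first.
    by apply: ler_wpM2l => //; rewrite /w lerD2l lerN2 ler1n.
  rewrite -[leRHS]mulr1; apply: ler_wpM2l => //.
  rewrite lerBlDr ler_pdivrMr ?ltr0n// nat1r -natrM ler_nat.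
  by have := divn_eq n p; have := ltn_pmod n p0; nia.
have L4 : 0 < ln 4 :> R by rewrite ln_nat_gt0.
have Fh : psum F h = theta h.
  by rewrite /theta /psum big_nat_cond [RHS]big_nat_cond; apply: eq_bigr => p /andP[/andP[_ ph] _]; rewrite /F -ltnS ph.
have -> : psum F n = theta h + (psum F n - psum F h) by rewrite Fh; ring.
rewrite psum_range ?(ltnW hn)//.
have -> : \sum_(h <= k < n) (psum F k.+1 - psum F k) = \sum_(h <= k < n) (theta k.+1 - theta k) * w k.+1.
  rewrite big_nat_cond [RHS]big_nat_cond; apply: eq_bigr => k /andP[/andP[hk _] _].
  rewrite /theta !psumS; case: ifP => _; last by rewrite !addr0 !subrr mul0r.
  by rewrite /F ltnNge hk/= addrAC subrr add0r [in RHS]addrAC subrr add0r.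
rewrite abel_sum//.
have -> : w n = 0 by rewrite /w divff ?gt_eqF// subrr.
(* [theta k <= k ln 4] leaves [n ln 4 / (k + 1)], and the sum of [1 / (k + 1)] over [h < k < n] is
   at most [ln (n / (h + 1)) <= ln 2]. *)
have hs : \sum_(h.+1 <= k < n) theta k * (w k - w k.+1) <= ln 4 * n%:R * ln 2.
  apply: le_trans (_ : \sum_(h.+1 <= k < n) ln 4 * n%:R * k.+1%:R^-1 <= _).
    rewrite big_nat_cond [leRHS]big_nat_cond; apply: ler_sum => k /andP[/andP[hk _] _].
    have k0 : 0 < k%:R :> R by rewrite ltr0n; lia.
    have -> : w k - w k.+1 = n%:R / (k%:R * k.+1%:R).
      have k1 : k.+1%:R = k%:R + 1 :> R by rewrite natr1.
      by rewrite /w k1; field; apply/andP; split; rewrite gt_eqF//; lra.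
    rewrite invfM !mulrA; apply: ler_wpM2r; first by rewrite invr_ge0.
    rewrite mulrAC; apply: ler_wpM2r; first exact: ltW.
    by rewrite ler_pdivrMr//; exact: theta_le.
  rewrite -mulr_sumr; apply: ler_wpM2l; first by rewrite mulr_ge0 ?ltW.
  apply: le_trans (sum_inv_le_ln (ltn0Sn h) hn) _.
  rewrite -ln_div ?posrE ?ltr0n//; last by lia.
  rewrite ler_ln ?posrE ?divr_gt0 ?ltr0n//; last by lia.
  by rewrite ler_pdivrMr ?ltr0n// -natrM ler_nat /h; lia.
(* Since [h] is half of [n], [w h.+1] is close to [1], and the boundary terms cancel up to a
   constant. *)
have hw : theta h - theta h * w h.+1 <= ln 4 * 2.
  rewrite -{1}[theta h]mulr1 -mulrBr.
  have th := theta_le R h; have th0 := theta_ge0 R h.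
  have w1 : 0 <= 1 - w h.+1.
    have : n%:R <= 2 * h.+1%:R :> R by rewrite -natrM ler_nat /h; lia.
    by rewrite /w subr_ge0 lerBlDr ler_pdivrMr ?ltr0n//; lra.
  have w2 : h%:R * (1 - w h.+1) <= 2.
    have -> : 1 - w h.+1 = (2 * h.+1%:R - n%:R) / h.+1%:R.
      have x0 : 0 < h.+1%:R :> R by rewrite ltr0n.
      by rewrite /w; move: (h.+1%:R) x0 => x x0; field; rewrite gt_eqF.
    rewrite mulrA ler_pdivrMr ?ltr0n//.
    have a1 : 2 * h.+1%:R - n%:R <= 2 :> R.
      by rewrite lerBlDr -natrM -natrD ler_nat /h; lia.
    apply: le_trans (_ : h%:R * 2 <= _); first by apply: ler_wpM2l.
    by rewrite mulrC; apply: ler_wpM2l => //; rewrite ler_nat.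
  apply: le_trans (_ : ln 4 * h%:R * (1 - w h.+1) <= _); first exact: ler_wpM2r.
  by rewrite -mulrA; apply: ler_wpM2l => //; exact: ltW.
by rewrite mulr0 sub0r [leRHS]mulrDr mulrA; lra.
Qed.

(** Primes are replaced by all integers, and the sum is compared with the increments of
    [- (2 + ln k) / k]. The integral would give [1 + ln k]; the [2] absorbs
    [(k + 1) (ln (k + 1) - ln k) <= 2]. *)
Lemma psum_tail_ln_le m n : (0 < m)%N -> (m <= n)%N ->
  psum (fun p => ln p%:R / (p%:R * (p%:R - 1))) n
  - psum (fun p => ln p%:R / (p%:R * (p%:R - 1))) m <= (2 + ln m%:R) / m%:R :> R.
Proof.
move=> m0 mn; set F := fun p => _.
rewrite psum_range//.
pose v k : R := - ((2 + ln k%:R) / k%:R).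
have vn : v n <= 0 by rewrite /v oppr_le0 divr_ge0// addr_ge0// ln_nat_ge0.
apply: le_trans (_ : v n - v m <= _); last by rewrite /v opprK in vn *; lra.
rewrite -telescope_sumr// big_nat_cond [leRHS]big_nat_cond; apply: ler_sum => k /andP[/andP[mk _] _].
have k0 : 0 < k%:R :> R by rewrite ltr0n; lia.
have k1 : k.+1%:R = k%:R + 1 :> R by rewrite natr1.
have := @ln_ratio_le R k%:R k.+1%:R k0; rewrite ler_nat leqnSn => /(_ isT).
have l0 := ln_nat_ge0 R k.+1.
have kk : 0 < k%:R * k.+1%:R :> R by rewrite mulr_gt0// ltr0n.
rewrite k1 addrAC subrr add0r => hl.
have h : ln k.+1%:R / (k.+1%:R * (k.+1%:R - 1)) <= v k.+1 - v k.
  have -> : v k.+1 - v k = (2 + ln k.+1%:R - (k%:R + 1) * (ln k.+1%:R - ln k%:R)) / (k%:R * k.+1%:R).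
    rewrite /v k1; move: (ln _) (ln _) => a b; field.
    by apply/andP; split; rewrite gt_eqF//; lra.
  rewrite k1 addrK [_ * k%:R]mulrC; apply: ler_wpM2r; first by rewrite invr_ge0 -k1 ltW.
  have : (k%:R + 1) * (ln (k%:R + 1) - ln k%:R) <= 2 :> R.
    apply: le_trans (_ : (k%:R + 1) * (1 / k%:R) <= _).
      by apply: ler_wpM2l => //; lra.
    rewrite mulrA mulr1 ler_pdivrMr//.
    have : 1 <= k%:R :> R by rewrite ler1n; lia.
    by lra.
  by move: (ln _) (ln _) => a b; lra.
rewrite psumS; case: ifP => _; first by rewrite addrAC subrr add0r.
rewrite addr0 subrr; apply: le_trans h.
by apply: divr_ge0 => //; apply: mulr_ge0 => //; rewrite k1; lra.
Qed.

(** With the denominator [p - 1] instead of [p], a summand accounts for all powers of [p] in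
    Legendre's formula, so that [ln n! <= n S(n)] holds without error term. *)
Definition mertens_sum : nat -> R := psum (fun p => ln p%:R / (p%:R - 1)).
Local Notation S := mertens_sum.

Lemma mertens_sum_ge n : (0 < n)%N -> ln n%:R - 1 <= S n.
Proof.
move=> n0; have n0' : 0 < n%:R :> R by rewrite ltr0n.
rewrite -(ler_pM2l n0') mulrBr mulr1; apply: le_trans (ln_fact_ge R n0) _.
rewrite ln_fact /S /mertens_sum -psumZ; apply: ler_psum => p pp _.
have := @logn_fact_le R n p pp; have := ln_nat_ge0 R p.
have -> : n%:R * (ln p%:R / (p%:R - 1)) = (n%:R / (p%:R - 1)) * ln p%:R :> R by rewrite mulrCA mulrC.
by move=> *; apply: ler_wpM2r.
Qed.

(** For [p <= r] the exponent of [p] in [n!] falls short of [n / (p - 1)] by at most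
    [trunc_log p n + 1], which costs [ln n + ln p]. For [p > r] only the floor of [n / p] is kept,
    and [1 / (p - 1) = 1 / p + 1 / (p (p - 1))]. The cutoff will be the square root of [n]. *)
Lemma mertens_sum_le_split n r : (1 < n)%N -> (0 < r)%N -> (r <= n)%N ->
  n%:R * S n <= ln n`!%:R + (psum (fun=> 1) r * ln n%:R + theta r)
    + ln 4 * (n%:R * ln 2 + 2) + n%:R * ((2 + ln r%:R) / r%:R).
Proof.
move=> n1 r0 rn; have n0 : (0 < n)%N by lia.
apply: le_trans (_ : _ <= ln n`!%:R
  + (psum (fun p => if (p <= r)%N then ln n%:R + ln p%:R else 0) n
  + psum (fun p => ln p%:R * (n%:R / p%:R - (n %/ p)%:R)) n
  + n%:R * psum (fun p => if (p <= r)%N then 0 else ln p%:R / (p%:R * (p%:R - 1))) n)) _.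
  rewrite ln_fact /mertens_sum -!psumZ -!psumD; apply: ler_psum => p pp pn.
  have l0 := ln_nat_ge0 R p; have p0 := prime_gt0 pp; have p1 := prime_gt1 pp.
  have P0 : 0 < p%:R :> R by rewrite ltr0n.
  have P1 : 0 < p%:R - 1 :> R by rewrite subr_gt0 ltr1n.
  have fr : 0 <= n%:R / p%:R - (n %/ p)%:R :> R.
    by rewrite subr_ge0 ler_pdivlMr// -natrM ler_nat leq_trunc_div.
  case: ifPn => pr.
    rewrite mulr0 addr0 addrA; apply: ler_wpDr; first exact: mulr_ge0.
    have := @logn_fact_ge_trunc R n p pp n0.
    have : (trunc_log p n)%:R * ln p%:R <= ln n%:R :> R.
      rewrite mulr_natl -lnXn ?ltr0n// -natrX; apply: ler_ln_nat; first by rewrite expn_gt0 p0.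
      by have /andP[] := trunc_log_bounds p1 n0.
    have -> : n%:R * (ln p%:R / (p%:R - 1)) = (n%:R / (p%:R - 1)) * ln p%:R :> R by rewrite mulrCA mulrC.
    move: (n%:R / _) (trunc_log _ _)%:R (logn _ _)%:R (ln p%:R) (ln n%:R) l0 => a t v l l' l0 h1 h2.
    by nra.
  rewrite add0r.
  have -> : n%:R * (ln p%:R / (p%:R - 1)) = ln p%:R * (n%:R / p%:R) + n%:R * (ln p%:R / (p%:R * (p%:R - 1))) :> R.
    by field; rewrite !gt_eqF.
  have := @logn_fact_ge_div R n p pp; move: (n %/ p)%:R (logn _ _)%:R => a b ab.
  rewrite addrA lerD2r mulrBr [b * _]mulrC.
  have : ln p%:R * a <= ln p%:R * b by apply: ler_wpM2l.
  by lra.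
rewrite -2![leRHS]addrA lerD2l [leRHS]addrA; apply: lerD; first apply: lerD.
- rewrite /psum (@big_cat_nat _ _ _ r.+1)//= [X in _ + X]big_nat_cond [X in _ + X]big1.
    rewrite addr0 mulr_suml -big_split/= big_nat_cond [leRHS]big_nat_cond.
    by apply: ler_sum => p /andP[/andP[_ pr] _]; rewrite -ltnS pr mul1r.
  by move=> p /andP[/andP[rp _] _]; rewrite leqNgt rp.
- exact: sum_frac_le.
- apply: ler_wpM2l => //; apply: le_trans (psum_tail_ln_le r0 rn).
  rewrite {1 2}/psum (@big_cat_nat _ _ _ r.+1)//= big_nat_cond big1; last first.
    by move=> p /andP[/andP[_ pr] _]; rewrite -ltnS pr.
  rewrite add0r [X in _ <= X - _](@big_cat_nat _ _ _ r.+1)//= /psum addrAC subrr add0r.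
  rewrite big_nat_cond [leRHS]big_nat_cond.
  by apply: ler_sum => p /andP[/andP[rp _] _]; rewrite leqNgt rp.
Qed.

End Mertens1.

(** * The Euler product of zeta *)

Definition rough m n := (n == 1)%N || (m < pdiv n)%N.

Lemma roughP m n : (0 < n)%N ->
  reflect (forall p, prime p -> (p %| n)%N -> (m < p)%N) (rough m n).
Proof.
move=> n0; apply: (iffP orP) => [[/eqP ->|mn] p pp|H].
- by rewrite dvdn1 => /eqP p1; rewrite p1 in pp.
- by move=> pn; apply: leq_trans mn _; apply: pdiv_min_dvd => //; exact: prime_gt1.
- have [->|n1] := eqVneq n 1%N; [by left|right].
  by apply: H; [apply: pdiv_prime; lia|exact: pdiv_dvd].
Qed.

Lemma roughS_nprime m n : (0 < n)%N -> ~~ prime m.+1 -> rough m.+1 n = rough m n.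
Proof.
move=> n0 np; apply/roughP/roughP => // H p pp pn; have := H p pp pn; first by lia.
rewrite leq_eqVlt => /predU1P[e|//]; by rewrite e pp in np.
Qed.

Lemma roughS_dvd m n : (0 < n)%N -> prime m.+1 -> rough m n = rough m.+1 n || ((m.+1 %| n) && rough m (n %/ m.+1))%N.
Proof.
move=> n0 pp; apply/idP/orP => [/(roughP _ n0) H|[/(roughP _ n0) H|/andP[dv]]].
- have [dv|ndv] := boolP (m.+1 %| n)%N.
    right=> /=; apply/roughP; first by rewrite divn_gt0// dvdn_leq.
    move=> p pr pd; apply: H => //; apply: dvdn_trans pd _; exact: dvdn_div.
  left; apply/roughP => // p pr pd; have := H p pr pd.
  by rewrite leq_eqVlt => /predU1P[e|//]; rewrite e pd in ndv.
- by apply/roughP => // p pr pd; have := H p pr pd; lia.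
- have d0 : (0 < n %/ m.+1)%N by rewrite divn_gt0// dvdn_leq.
  move=> /(roughP _ d0) H; apply/roughP => // p pr pd.
  have [->//|pm] := eqVneq p m.+1.
  apply: H => //; move: pd; rewrite -{1}(divnK dv) Euclid_dvdM// => /orP[//|].
  by rewrite dvdn_prime2// (negbTE pm).
Qed.

Lemma roughS_disj m n : (0 < n)%N -> prime m.+1 -> rough m.+1 n -> ~~ (m.+1 %| n)%N.
Proof. by move=> n0 pp /(roughP _ n0) H; apply/negP => /(H _ pp); rewrite ltnn. Qed.

Section EulerProduct.
Variables (R : realType) (f : nat -> R).
Hypothesis f1 : f 1 = 1.
Hypothesis fM : forall m n, (0 < m)%N -> (0 < n)%N -> f (m * n) = f m * f n.
Hypothesis f0 : forall n, 0 <= f n.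
Hypothesis flt1 : forall p, prime p -> f p < 1.
Implicit Types (m n p N : nat).

(** Sums truncated at [N] over the numbers whose prime factors all exceed [m]: Euler factors are
    removed one by one without any infinite product. *)
Let Z m N : R := \sum_(1 <= n < N.+1 | rough m n) f n.

Let Z_ge0 m N : 0 <= Z m N. Proof. exact: sumr_ge0. Qed.

Let Z_le m N N' : (N <= N')%N -> Z m N <= Z m N'.
Proof.
move=> NN'; rewrite /Z (@big_cat_nat _ _ _ N.+1 1 N'.+1)//= lerDl.
exact: sumr_ge0.
Qed.

Let ZS_nprime m N : ~~ prime m.+1 -> Z m.+1 N = Z m N.
Proof.
move=> np; rewrite /Z big_nat_cond [RHS]big_nat_cond; apply: eq_bigl => n.
have [->//|n0] := posnP n.
by rewrite roughS_nprime.
Qed.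

(** An [m]-rough number is either [m.+1]-rough or [m.+1] times an [m]-rough number. *)
Let ZS_prime m N : prime m.+1 -> Z m N = Z m.+1 N + f m.+1 * Z m (N %/ m.+1).
Proof.
move=> pp; elim: N => [|N IH].
  by rewrite div0n /Z !big_geq// mulr0 addr0.
have ZN k M : Z k M.+1 = Z k M + (if rough k M.+1 then f M.+1 else 0).
  by rewrite /Z big_mkcond big_nat_recr//= -big_mkcond.
rewrite !ZN IH roughS_dvd//.
have [dv|ndv] := boolP (m.+1 %| N.+1)%N.
  have -> : rough m.+1 N.+1 = false by apply/negbTE/negP => /(roughS_disj (ltn0Sn N) pp); rewrite dv.
  rewrite /= addr0; have qE : (N.+1 %/ m.+1)%N = (N %/ m.+1).+1.
    have /dvdnP[[//|k] e] := dv; rewrite e mulnK//; congr _.+1.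
    have -> : N = (k * m.+1 + m)%N by move: e; rewrite mulSn; lia.
    by rewrite divnMDl// divn_small// addn0.
  rewrite qE ZN mulrDr addrA; congr (_ + _).
  case: ifP => _; last by rewrite mulr0.
  by rewrite -fM// -qE mulnC divnK.
rewrite orbF /=; have -> : (N.+1 %/ m.+1)%N = (N %/ m.+1)%N.
  have := divn_eq N.+1 m.+1; have := divn_eq N m.+1.
  have h1 := ltn_pmod N (ltn0Sn m); have h2 := ltn_pmod N.+1 (ltn0Sn m).
  have : (N.+1 %% m.+1 != 0)%N by [].
  nia.
by rewrite addrAC.
Qed.

Let P m : R := \prod_(0 <= p < m.+1 | prime p) (1 - f p).

Let P0 : P 0 = 1. Proof. by rewrite /P unlock. Qed.

Let PS m : P m.+1 = P m * (if prime m.+1 then 1 - f m.+1 else 1).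
Proof. by rewrite /P big_mkcond big_nat_recr//= -big_mkcond. Qed.

Let P_gt0 m : 0 < P m.
Proof. by apply: prodr_gt0 => p /flt1; rewrite subr_gt0. Qed.

Let Z0E N : Z 0 N = \sum_(1 <= n < N.+1) f n.
Proof.
rewrite /Z big_nat_cond [RHS]big_nat_cond; apply: eq_bigl => n.
have [->//|n0] := posnP n.
by have -> : rough 0 n by apply/roughP => // p /prime_gt0.
Qed.

Let Z_ge m N : P m * Z 0 N <= Z m N.
Proof.
elim: m => [|m IH]; first by rewrite P0 mul1r.
rewrite PS; case: ifPn => [pp|np]; last by rewrite mulr1 ZS_nprime.
apply: le_trans (_ : (1 - f m.+1) * Z m N <= _).
  by rewrite mulrAC [leLHS]mulrC; apply: ler_wpM2l => //; rewrite subr_ge0 ltW// flt1.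
rewrite mulrBl mul1r {1}(ZS_prime N pp) -addrA -lerBrDl subrr subr_le0.
by apply: ler_wpM2l => //; apply: Z_le; exact: leq_div.
Qed.

(** After the primes up to [N] are removed, [1] is the only summand left. *)
Lemma euler_product_le N : (0 < N)%N ->
  (\prod_(0 <= p < N.+1 | prime p) (1 - f p)) * \sum_(1 <= n < N.+1) f n <= 1.
Proof.
move=> N0; have := Z_ge N N; rewrite Z0E => /le_trans; apply.
rewrite /Z big_mkcond big_ltn// f1 big_nat_cond big1 ?addr0//= => n /andP[/andP[n1 nN] _].
case: ifPn => // /orP[/eqP n1'|h]; first by rewrite n1' in n1.
have : (pdiv n <= n)%N by apply: pdiv_leq; lia.
lia.
Qed.

Lemma euler_product_ge B N : (forall M, \sum_(1 <= n < M.+1) f n <= B) ->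
  1 <= B * \prod_(0 <= p < N.+1 | prime p) (1 - f p).
Proof.
move=> HB; suff H m M : Z m M <= B * P m.
  apply: le_trans (H N 1%N); rewrite /Z big_mkcond big_nat1 /rough/= f1; exact: lexx.
elim: m M => [|m IH] M; first by rewrite Z0E P0 mulr1.
rewrite PS; case: ifPn => [pp|np]; last by rewrite mulr1 ZS_nprime.
set a := f m.+1; have a1 : a < 1 := flt1 pp; have a0 : 0 <= a := f0 _.
(* The recursion is applied at [M p^j], ..., [M p] with [p = m.+1], and each [Z m.+1] is bounded
   below by [Z m.+1 M]: a geometric sum in [a] results, and [j] tends to infinity afterwards. The
   uniformity of [B] in the truncation makes this possible. *)
have step j : Z m.+1 M * (1 - a ^+ j) <= (1 - a) * (B * P m).
  apply: le_trans (_ : (1 - a) * Z m (M * m.+1 ^ j)%N <= _); last first.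
    by apply: ler_wpM2l => //; lra.
  elim: j => [|j IHj]; first by rewrite expr0 subrr mulr0 mulr_ge0//; lra.
  rewrite (ZS_prime _ pp) expnSr mulnA mulnK// -/a.
  have : Z m.+1 M <= Z m.+1 (M * m.+1 ^ j * m.+1)%N.
    by apply: Z_le; rewrite -mulnA leq_pmulr// muln_gt0 expn_gt0.
  have := ler_wpM2l a0 IHj; rewrite exprS.
  move: (Z m.+1 (M * m.+1 ^ j * m.+1)%N) (Z m.+1 M) (Z m _) (a ^+ j) => z' z y b h1 h2.
  have : 0 <= (1 - a) * (z' - z) by apply: mulr_ge0; lra.
  by lra.
rewrite mulrCA mulrC [leRHS]mulrC.
have cv : (Z m.+1 M * (1 - a ^+ j) @[j --> \oo] --> Z m.+1 M * (1 - 0)).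
  apply: cvgMr; apply: cvgB; first exact: cvg_cst.
  by apply: cvg_expr; rewrite ger0_norm.
have h : limn (fun j => Z m.+1 M * (1 - a ^+ j)) <= (1 - a) * (B * P m).
  by apply: limr_le; [exact: (cvgP _ cv)|exact: nearW].
have {}h : Z m.+1 M <= (1 - a) * (B * P m).
  by move: h; rewrite (cvg_lim _ cv)// subr0 mulr1.
by rewrite (_ : P m * (B * (1 - a)) = (1 - a) * (B * P m))//; ring.
Qed.

End EulerProduct.

(** * Mertens' second theorem and Abel summation *)

Section LogProduct.
Variable R : realType.
Implicit Types (m n k p r : nat).
Local Notation S := (@mertens_sum R).

Definition log_prod : nat -> R := psum (fun p => - ln (1 - p%:R^-1)).
Local Notation L := log_prod.

Lemma neg_ln_1Binv_bounds p : prime p ->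
  p%:R^-1 <= - @ln R (1 - p%:R^-1) <= (p%:R - 1)^-1.
Proof.
move=> pp; have p1 : 1 < p%:R :> R by rewrite ltr1n prime_gt1.
have p0 : 0 < p%:R :> R by lra.
have e : - ln (1 - p%:R^-1) = ln p%:R - ln (p%:R - 1) :> R.
  rewrite -ln_div ?posrE//; last by lra.
  have -> : p%:R / (p%:R - 1) = (1 - p%:R^-1)^-1 :> R.
    by field; apply/andP; split; rewrite gt_eqF//; lra.
  by rewrite lnV// posrE subr_gt0 invf_lt1.
have q0 : 0 < p%:R - 1 :> R by lra.
have qp : p%:R - 1 <= p%:R :> R by lra.
have := ln_ratio_ge q0 qp; have := ln_ratio_le q0 qp.
rewrite e opprB addrCA subrr addr0 !mul1r => -> ->; by [].
Qed.

Lemma sum_inv_pred_le m n : (0 < m)%N -> (m <= n)%N ->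
  psum (fun p => (p%:R * (p%:R - 1))^-1) n - psum (fun p => (p%:R * (p%:R - 1))^-1) m
   <= m%:R^-1 :> R.
Proof.
move=> m0 mn; rewrite psum_range//.
apply: le_trans (_ : \sum_(m <= k < n) (- k.+1%:R^-1 - - k%:R^-1) <= _).
  rewrite big_nat_cond [leRHS]big_nat_cond; apply: ler_sum => k /andP[/andP[mk _] _].
  have k0 : 0 < k%:R :> R by rewrite ltr0n; lia.
  have k1 : k.+1%:R = k%:R + 1 :> R by rewrite natr1.
  have e : - k.+1%:R^-1 - - k%:R^-1 = (k.+1%:R * (k.+1%:R - 1))^-1 :> R.
    by rewrite k1 addrK; field; apply/andP; split; rewrite gt_eqF//; lra.
  rewrite psumS; case: ifP => _; first by rewrite addrAC subrr add0r e.
  by rewrite addr0 subrr e invr_ge0 mulr_ge0// k1; lra.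
rewrite (telescope_sumr (fun k => - k%:R^-1))// opprK gerDr oppr_le0.
by rewrite invr_ge0.
Qed.

Variables (c : R) (X : nat).
Hypothesis X2 : (1 < X)%N.
Hypothesis S_le : forall n, (X <= n)%N -> S n <= ln n%:R - 1 + c.

Let w k : R := (ln k%:R)^-1.

(** [S - ln] stays in [[-1, c - 1]]; summation by parts sees only the length [c] of this
    interval. *)
Let E_sum m n : (X <= m)%N -> (m <= n)%N ->
  `|\sum_(m <= k < n) ((S k.+1 - ln k.+1%:R) - (S k - ln k%:R)) * w k.+1| <= c * w m.+1.
Proof.
move=> Xm mn.
have c0 : 0 <= c.
  have := S_le (leqnn X); have := @mertens_sum_ge R X ltac:(lia); lra.
have [] := @sum_diff_bounds R (fun k => S k - ln k%:R) w m n (-1) (c - 1) mn.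
- move=> k /andP[mk kn]; have := S_le (leq_trans Xm mk).
  have := @mertens_sum_ge R k ltac:(lia); move: (S k) (ln _) => a b h1 h2.
  by apply/andP; split; lra.
- by move=> k /andP[mk _]; rewrite /w invr_ge0 ln_nat_ge0.
- move=> k /andP[mk _]; rewrite /w lef_pV2 ?posrE ?ln_nat_gt0//; try lia.
  by apply: ler_ln_nat; lia.
- by have -> : c - 1 - -1 = c by ring.
- move=> ->; rewrite big_geq// normr0 mulr_ge0// /w invr_ge0; exact: ln_nat_ge0.
Qed.

Let S_weighted m n : \sum_(m <= k < n) (S k.+1 - S k) * w k.+1 =
  \sum_(m <= k < n) ((S k.+1 - ln k.+1%:R) - (S k - ln k%:R)) * w k.+1
  + \sum_(m <= k < n) (ln k.+1%:R - ln k%:R) * w k.+1.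
Proof. by rewrite -big_split/=; apply: eq_bigr => k _; ring. Qed.

(** [-ln (1 - 1/p)] is at most [1 / (p - 1)], which is the increment of [S] at [p] times [1 / ln p].
    Replacing [S] by [ln] costs [c / ln (m + 1)], and the main term is compared with [ln ln]. *)
Lemma log_prod_diff_le m n : (X <= m)%N -> (m <= n)%N ->
  L n - L m <= ln (ln n%:R) - ln (ln m%:R) + c / ln m.+1%:R.
Proof.
move=> Xm mn; rewrite psum_range//.
apply: le_trans (_ : \sum_(m <= k < n) (S k.+1 - S k) * w k.+1 <= _).
  rewrite big_nat_cond [leRHS]big_nat_cond; apply: ler_sum => k /andP[/andP[mk _] _].
  rewrite /L /mertens_sum !psumS; case: ifPn => pp; last by rewrite !addr0 !subrr mul0r.
  rewrite addrAC subrr add0r [in leRHS]addrAC subrr add0r.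
  have /andP[_ /le_trans] := neg_ln_1Binv_bounds pp; apply.
  rewrite /w mulrAC mulfV ?mul1r//.
  by rewrite gt_eqF// ln_nat_gt0//; lia.
rewrite S_weighted addrC; apply: lerD; last first.
  have := E_sum Xm mn; rewrite ler_norml => /andP[_]; exact.
rewrite -(telescope_sumr (fun k => ln (ln k%:R)))//.
rewrite big_nat_cond [leRHS]big_nat_cond; apply: ler_sum => k /andP[/andP[mk _] _].
by apply: ln_ratio_ge; [apply: ln_nat_gt0; lia|apply: ler_ln_nat; lia].
Qed.

(** Here [-ln (1 - 1/p) >= 1/p], and going from [1 / (p - 1)] to [1/p] costs at most [1/m] in
    total. *)
Lemma log_prod_diff_ge m n : (X <= m)%N -> (m <= n)%N ->
  ln (ln n.+1%:R) - ln (ln m.+1%:R) - c / ln m.+1%:R - m%:R^-1 <= L n - L m.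
Proof.
move=> Xm mn.
apply: le_trans (_ : \sum_(m <= k < n) (S k.+1 - S k) * w k.+1 - m%:R^-1 <= _); last first.
  have m0 : (0 < m)%N by lia.
  have := sum_inv_pred_le m0 mn; rewrite !psum_range//.
  set A := \sum_(m <= k < n) _; set B := \sum_(m <= k < n) _; set C := \sum_(m <= k < n) _.
  suff : B <= C + A by lra.
  rewrite /A /B /C -big_split/=.
  rewrite big_nat_cond [leRHS]big_nat_cond; apply: ler_sum => k /andP[/andP[mk _] _].
  rewrite /L /mertens_sum !psumS; case: ifPn => pp; last by rewrite !addr0 !subrr mul0r addr0.
  rewrite addrAC subrr add0r [X in _ <= X + _]addrAC subrr add0r [X in _ <= _ + X]addrAC subrr add0r.
  have /andP[h _] := neg_ln_1Binv_bounds pp; rewrite -lerBlDr; apply: le_trans h.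
  rewrite /w mulrAC mulfV ?mul1r//; last by rewrite gt_eqF// ln_nat_gt0//; lia.
  have k0 : 0 < k%:R :> R by rewrite ltr0n; lia.
  have -> : k.+1%:R = k%:R + 1 :> R by rewrite natr1.
  rewrite addrK le_eqVlt; apply/orP; left; apply/eqP.
  by field; apply/andP; split; rewrite gt_eqF//; lra.
rewrite lerD2r S_weighted [leRHS]addrC; apply: lerD; last first.
  have := E_sum Xm mn; rewrite ler_norml => /andP[]; rewrite /w; exact.
(* The shift by one is forced: as the increments of [ln] decrease, [(ln (k+1) - ln k) / ln (k+1)]
   dominates the step of [ln ln] from [k + 1] to [k + 2], not the one from [k] to [k + 1]. *)
rewrite -(telescope_sumr (fun k => ln (ln k.+1%:R)))//.
rewrite big_nat_cond [leRHS]big_nat_cond; apply: ler_sum => k /andP[/andP[mk _] _].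
have k0 : 0 < k%:R :> R by rewrite ltr0n; lia.
have l1 : 0 < ln k.+1%:R :> R by apply: ln_nat_gt0; lia.
apply: le_trans (ln_ratio_le l1 _) _; first by apply: ler_ln_nat.
apply: ler_wpM2r; first by rewrite invr_ge0 ltW.
have kk : k%:R <= k.+1%:R :> R by rewrite ler_nat.
have kk' : k.+1%:R <= k.+2%:R :> R by rewrite ler_nat.
apply: le_trans (_ : _ <= 1 / k.+1%:R) _.
  have := ln_ratio_le (ltr0Sn R k) kk'.
  by have -> : k.+2%:R - k.+1%:R = 1 :> R by rewrite -natr1 addrAC subrr add0r.
have := ln_ratio_ge k0 kk.
by have -> : k.+1%:R - k%:R = 1 :> R by rewrite -natr1 addrAC subrr add0r.
Qed.

End LogProduct.

Section Abelian.
Variable R : realType.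
Implicit Types (m n k p r : nat) (D : nat -> R) (w d : R).

(* A summation method of Abel type: an eventual bound on [D] passes to
   [\sum_m w ^ m (D (m + 1) - D m)] up to an error vanishing as [w -> 1]. *)
Lemma abelian_le D w m0 kap C T : 0 <= w <= 1 -> 0 <= C -> D 0 = 0 ->
  (forall m, D m <= kap + C) -> (forall m, (m0 <= m)%N -> D m <= kap) ->
  (0 < m0 < T)%N ->
  \sum_(0 <= m < T) w ^+ m * (D m.+1 - D m) <= kap + C * (1 - w ^+ m0).
Proof.
move=> /andP[w0 w1] C0 D0 Dle Dlt /andP[m00 mT].
pose w' k := w ^+ k.-1.
have -> : \sum_(0 <= m < T) w ^+ m * (D m.+1 - D m) = \sum_(0 <= m < T) (D m.+1 - D m) * w' m.+1.
  by apply: eq_bigr => m _; rewrite mulrC.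
rewrite abel_sum; last by lia.
rewrite D0 mul0r subr0.
have wd k : (0 < k)%N -> 0 <= w' k - w' k.+1.
  by case: k => // k _; rewrite /w' /= subr_ge0 exprS ler_piMl// exprn_ge0.
have tel a b : (a <= b)%N -> \sum_(a <= k < b) (w' k - w' k.+1) = w' a - w' b.
  by move=> ab; rewrite (telescope_sumr_eq (fun k => - w' k))//; [ring|move=> k _; ring].
(* The extra [C] is paid only for [k < m0], where the weights add up to [w' 1 - w' m0]. *)
have h1 : \sum_(1 <= k < T) D k * (w' k - w' k.+1) <=
   kap * (w' 1 - w' T) + C * (w' 1 - w' m0).
  rewrite -tel; last by lia.
  rewrite -(tel 1 m0)// mulr_sumr mulr_sumr (@big_cat_nat _ _ _ m0)//=; last by lia.
  rewrite [X in _ <= X + _](@big_cat_nat _ _ _ m0)//=; last by lia.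
  rewrite addrAC -big_split/=; apply: lerD.
    rewrite big_nat_cond [leRHS]big_nat_cond; apply: ler_sum => k /andP[/andP[k0 _] _].
    by rewrite -mulrDl; apply: ler_wpM2r; [exact: wd|exact: Dle].
  rewrite big_nat_cond [leRHS]big_nat_cond; apply: ler_sum => k /andP[/andP[k0 _] _].
  by apply: ler_wpM2r; [apply: wd; lia|exact: Dlt].
have h2 : D T * w' T <= kap * w' T.
  by apply: ler_wpM2r; [rewrite /w' exprn_ge0|apply: Dlt; lia].
have h3 : C * (w' 1 - w' m0) <= C * (1 - w ^+ m0).
  apply: ler_wpM2l => //; rewrite /w' expr0 lerD2l lerN2.
  by case: m0 m00 {Dlt mT h1} => // m _; rewrite exprS/= ler_piMl// exprn_ge0.
have w'1 : w' 1 = 1 by rewrite /w' expr0.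
rewrite w'1 in h1 h3; rewrite mulrBr mulr1 in h1; lra.
Qed.

Lemma expR_geom_small d (e : R) m : 0 < d -> 0 < e ->
  exists T : nat, (m < T)%N /\ expR (- d) ^+ T <= e.
Proof.
move=> d0 e0.
have de : 0 <= (d * e)^-1 by rewrite invr_ge0 mulr_ge0 ?ltW.
have hb := archi_boundP de; set T0 := Num.bound _ in hb.
exists (m + T0).+1; split; first by lia.
rewrite -expRM_natl mulrN expRN -div1r ler_pdivrMr ?expR_gt0//.
apply: le_trans (_ : e * (1 + (m + T0).+1%:R * d) <= _); last first.
  by apply: ler_wpM2l; [exact: ltW|exact: expR_ge1Dx].
have h1 : 1 <= (d * e) * T0%:R.
  by rewrite -ler_pdivrMl ?mulr_gt0// mulr1 ltW.
have h2 : (d * e) * T0%:R <= (d * e) * (m + T0).+1%:R.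
  by apply: ler_wpM2l; [rewrite mulr_ge0 ?ltW|rewrite ler_nat; lia].
lra.
Qed.

End Abelian.

(** * Euler's constant in Mertens' third theorem *)

Section EulerGammaBounds.
Variable R : realType.

Lemma harmonic_ge m : (0 < m)%N -> euler_gamma R + ln m%:R <= series harmonic m :> R.
Proof.
move=> m0; have := @euler_gamma_le R m m0; rewrite -/(euler_gamma R) => h.
have : ln m%:R <= ln (m%:R + 2^-1) :> R.
  have M0 : 0 < m%:R :> R by rewrite ltr0n.
  by rewrite ler_ln ?posrE//; lra.
by move: (ln _) (ln _) (series _ _) h => a b s *; lra.
Qed.

Lemma harmonic_pred_le m : (0 < m)%N -> series harmonic m.-1 <= euler_gamma R + ln m%:R :> R.
Proof.
case: m => // m _; have := @euler_gamma_ge R m.+1 isT; rewrite -/(euler_gamma R).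
rewrite series_harmonicS invfM /=; have : 0 <= m.+1%:R^-1 :> R by rewrite invr_ge0.
by move: (m.+1%:R^-1) (ln _) => a b *; lra.
Qed.

End EulerGammaBounds.

Section ZetaBounds.
Variables (R : realType) (d : R).
Hypothesis d0 : 0 < d.
Implicit Types (n p N M : nat).

(** [q n] is [n^-d], and [f n] is [n^-(1+d)], a completely multiplicative function. *)
Let q n : R := expR (- (d * ln n%:R)).
Let f n : R := q n / n%:R.

Let q0 n : 0 < q n. Proof. exact: expR_gt0. Qed.

Let q1 : q 1 = 1. Proof. by rewrite /q ln1 mulr0 oppr0 expR0. Qed.

Let q_le1 n : q n <= 1.
Proof. by rewrite /q expR_le1 oppr_le0; apply: mulr_ge0; [exact: ltW|exact: ln_nat_ge0]. Qed.

Let f1 : f 1 = 1. Proof. by rewrite /f q1 divr1. Qed.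

Let fM m n : (0 < m)%N -> (0 < n)%N -> f (m * n) = f m * f n.
Proof.
move=> m0 n0; rewrite /f /q natrM lnM ?posrE ?ltr0n// mulrDr opprD expRD invfM.
by rewrite mulrACA.
Qed.

Let f0 n : 0 <= f n. Proof. by rewrite /f divr_ge0// ltW. Qed.

Let flt1 p : prime p -> f p < 1.
Proof.
move=> pp; rewrite /f ltr_pdivrMr ?ltr0n ?prime_gt0// mul1r.
by apply: le_lt_trans (q_le1 p) _; rewrite ltr1n prime_gt1.
Qed.

(** Comparison with the integral of [d x^(-1-d)]. Summed up, it places the truncated zeta sum
    between [(1 - (N+1)^-d) / d] and [1 + 1/d]. *)
Let q_diff n : (0 < n)%N ->
  d * f n.+1 <= q n - q n.+1 /\ q n - q n.+1 <= d * f n.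
Proof.
move=> n0; have N0 : 0 < n%:R :> R by rewrite ltr0n.
have N1 : n%:R <= n.+1%:R :> R by rewrite ler_nat.
have e : n.+1%:R - n%:R = 1 :> R by rewrite -natr1 addrAC subrr add0r.
have h1 := ln_ratio_ge N0 N1; have h2 := ln_ratio_le N0 N1.
rewrite e !div1r in h1 h2.
split.
- have -> : q n = q n.+1 * expR (d * (ln n.+1%:R - ln n%:R)).
    by rewrite /q -expRD; congr expR; ring.
  have h3 := expR_ge1Dx (d * (ln n.+1%:R - ln n%:R) : R).
  have h4 : d * n.+1%:R^-1 <= d * (ln n.+1%:R - ln n%:R) by apply: ler_wpM2l => //; exact: ltW.
  rewrite /f mulrCA -[X in _ - X]mulr1 -mulrBr; apply: ler_wpM2l; first exact: ltW.
  by rewrite lerBrDr; apply: le_trans h3; rewrite addrC lerD2l.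
- have -> : q n.+1 = q n * expR (- (d * (ln n.+1%:R - ln n%:R))).
    by rewrite /q -expRD; congr expR; ring.
  have h3 := expR_ge1Dx (- (d * (ln n.+1%:R - ln n%:R)) : R).
  have h4 : d * (ln n.+1%:R - ln n%:R) <= d * n%:R^-1 by apply: ler_wpM2l => //; exact: ltW.
  rewrite /f mulrCA -[X in X - _]mulr1 -mulrBr; apply: ler_wpM2l; first exact: ltW.
  by rewrite lerBlDr -lerBlDl; apply: le_trans h3; rewrite lerD2l lerN2.
Qed.

Let zeta_le M : \sum_(1 <= n < M.+1) f n <= 1 + d^-1.
Proof.
have dd : 0 < d^-1 by rewrite invr_gt0.
case: M => [|M]; first by rewrite big_geq//; lra.
apply: le_trans (_ : 1 + (1 - q M.+1) / d <= _); last first.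
  by rewrite lerD2l ler_pdivrMr// mulVf ?gt_eqF// gerBl ltW.
elim: M => [|M IH]; first by rewrite big_nat1 f1 q1 subrr mul0r addr0.
rewrite big_nat_recr//=; have [h _] := q_diff (ltn0Sn M).
have : f M.+2 <= (q M.+1 - q M.+2) / d by rewrite ler_pdivlMr// mulrC.
rewrite !mulrBl in IH *; lra.
Qed.

Let zeta_ge N : (1 - q N.+1) / d <= \sum_(1 <= n < N.+1) f n.
Proof.
elim: N => [|N IH]; first by rewrite big_geq// q1 subrr mul0r.
rewrite big_nat_recr//=; have [_ h] := q_diff (ltn0Sn N).
have : (q N.+1 - q N.+2) / d <= f N.+1 by rewrite ler_pdivrMr// mulrC.
rewrite !mulrBl in IH *; lra.
Qed.

Let G N : R := psum (fun p => - ln (1 - f p)) N.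

Let G_E N : G N = - ln (\prod_(0 <= p < N.+1 | prime p) (1 - f p)).
Proof.
elim: N => [|N IH]; first by rewrite /G psum0 unlock ln1 oppr0.
rewrite /G psumS -/(G N) IH [in RHS]big_mkcond big_nat_recr//= -[in RHS]big_mkcond/=.
case: ifP => pp; last by rewrite mulr1 addr0.
rewrite lnM ?posrE ?opprD//; last by rewrite subr_gt0 flt1.
by apply: prodr_gt0 => p /flt1; rewrite subr_gt0.
Qed.

Let prod_gt0 N : 0 < \prod_(0 <= p < N.+1 | prime p) (1 - f p).
Proof. by apply: prodr_gt0 => p /flt1; rewrite subr_gt0. Qed.

Lemma log_zeta_le N : psum (fun p => - ln (1 - expR (- (d * ln p%:R)) / p%:R)) N <= ln (1 + d^-1).
Proof.
rewrite -/(G N) G_E; have h := euler_product_ge f1 fM f0 flt1 N zeta_le.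
have B0 : 0 < 1 + d^-1 by rewrite addr_gt0 ?invr_gt0.
have := ln_ge0 h; rewrite lnM ?posrE//; lra.
Qed.

Lemma log_zeta_ge N : (0 < N)%N ->
  ln ((1 - expR (- (d * ln N.+1%:R))) / d) <= psum (fun p => - ln (1 - expR (- (d * ln p%:R)) / p%:R)) N.
Proof.
move=> N0; rewrite -/(G N) G_E; have h := euler_product_le f1 fM f0 flt1 N0.
have N1 : q N.+1 < 1 by rewrite /q expR_lt1 oppr_lt0 mulr_gt0// ln_nat_gt0.
have S0 : 0 < (1 - q N.+1) / d by rewrite divr_gt0// subr_gt0.
have h' : (\prod_(0 <= p < N.+1 | prime p) (1 - f p)) * ((1 - q N.+1) / d) <= 1.
  by apply: le_trans h; apply: ler_wpM2l; [exact: ltW|exact: zeta_ge].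
have := ln_le0 h'; rewrite lnM ?posrE// -/(q _); lra.
Qed.

Lemma ln_tangent (u v : R) : 0 < u -> 0 < v -> ln u - ln v <= (u - v) / v.
Proof.
move=> u0 v0; rewrite -ln_div ?posrE//.
have -> : u / v = 1 + (u - v) / v by field; rewrite gt_eqF.
apply: le_ln1Dx; have : 0 < u / v by rewrite divr_gt0.
have -> : (u - v) / v = u / v - 1 by field; rewrite gt_eqF.
lra.
Qed.

(** [x -> -ln (1 - x)] is convex and vanishes at [0], so for [t = p^-d <= 1] its value at [t x] is
    at most [t] times its value at [x]. *)
Lemma log_zeta_term_le p : prime p ->
  - ln (1 - expR (- (d * ln p%:R)) / p%:R) <= expR (- (d * ln p%:R)) * - ln (1 - p%:R^-1).
Proof.
move=> pp; rewrite -/(q p); have := q0 p; have := q_le1 p; move: (q p) => t t1 t0.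
have x0 : 0 < p%:R^-1 :> R by rewrite invr_gt0 ltr0n prime_gt0.
have x1 : p%:R^-1 < 1 :> R by rewrite invf_lt1 ?ltr0n ?prime_gt0// ltr1n prime_gt1.
move: (p%:R^-1) x0 x1 => x x0 x1.
have tx : t * x <= x by rewrite ler_piMl// ltW.
have v0 : 0 < 1 - t * x by lra.
have h1 := ln_tangent ltr01 v0.
have h2 : ln (1 - x) - ln (1 - t * x) <= (1 - x - (1 - t * x)) / (1 - t * x).
  by apply: ln_tangent => //; lra.
rewrite ln1 in h1.
(* Two tangent inequalities at [1 - t x] are averaged with the weights [1 - t] and [t]; their
   right-hand sides cancel. *)
have e : (1 - t) * ((1 - (1 - t * x)) / (1 - t * x)) + t * ((1 - x - (1 - t * x)) / (1 - t * x)) = 0.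
  by field; rewrite gt_eqF.
have h1' : (1 - t) * (0 - ln (1 - t * x)) <= (1 - t) * ((1 - (1 - t * x)) / (1 - t * x)).
  by apply: ler_wpM2l => //; lra.
have h2' := ler_wpM2l (ltW t0) h2.
lra.
Qed.

(** The loss by convexity is at most [(1 - t) (1/(p - 1) - 1/p)] with [1 - t <= d ln p]. Such terms
    are summable over [p], so the total loss is [O(d)]. *)
Lemma log_zeta_term_ge p : prime p ->
  expR (- (d * ln p%:R)) * - ln (1 - p%:R^-1) - d * (ln p%:R / (p%:R * (p%:R - 1)))
  <= - ln (1 - expR (- (d * ln p%:R)) / p%:R).
Proof.
move=> pp; have p0 : 0 < p%:R :> R by rewrite ltr0n prime_gt0.
have p1 : 1 < p%:R :> R by rewrite ltr1n prime_gt1.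
have /andP[ha _] := @neg_ln_1Binv_bounds R p pp.
have ht : 1 - q p <= d * ln p%:R.
  by have := expR_ge1Dx (- (d * ln p%:R) : R); rewrite /q; lra.
rewrite -/(q p); have := q0 p; have := q_le1 p; move: (q p) ht => t ht t1 t0.
have x0 : 0 < p%:R^-1 :> R by rewrite invr_gt0.
have x1 : p%:R^-1 < 1 :> R by rewrite invf_lt1.
have tx : t * p%:R^-1 <= p%:R^-1 by rewrite ler_piMl// ltW.
have v0 : 0 < 1 - t * p%:R^-1 by lra.
have u0 : 0 < 1 - p%:R^-1 :> R by lra.
have h1 := ln_tangent v0 u0.
have e1 : (1 - t / p%:R - (1 - p%:R^-1)) / (1 - p%:R^-1) = (1 - t) / (p%:R - 1).
  by field; apply/andP; split; rewrite gt_eqF//; lra.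
have e2 : (1 - t) * (p%:R^-1 - (p%:R - 1)^-1) = - ((1 - t) * (p%:R * (p%:R - 1))^-1).
  by field; apply/andP; split; rewrite gt_eqF//; lra.
rewrite e1 in h1.
have h2 : (1 - t) * (p%:R^-1) <= (1 - t) * - ln (1 - p%:R^-1) by apply: ler_wpM2l => //; lra.
have i0 : 0 <= (p%:R * (p%:R - 1))^-1 :> R by rewrite invr_ge0 mulr_ge0 ?ltW//; lra.
have h3 : (1 - t) * (p%:R * (p%:R - 1))^-1 <= d * ln p%:R * (p%:R * (p%:R - 1))^-1.
  exact: ler_wpM2r.
rewrite mulrBr in e2; rewrite mulrA.
set A := ln (1 - t / p%:R) in h1 *; set B := ln (1 - p%:R^-1) in h1 h2 *.
set i := (p%:R * (p%:R - 1))^-1 in h3 e2 *; set j := (p%:R - 1)^-1 in h1 e2.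
lra.
Qed.

End ZetaBounds.

Section MertensConstant.
Variable R : realType.
Implicit Types (m n p T : nat) (d t u : R).
Local Notation L := (@log_prod R).
Local Notation gam := (euler_gamma R).
Local Notation H m := (series harmonic m : R).

(** With the primes cut at [y m = floor (e^m)], [ln ln (y m)] is about [ln m] and can be compared
    with the harmonic number [H m], while [p^-d] is about [w^m], [w = e^-d], between [y m] and
    [y m.+1]. The increments of [H] summed against the powers of [w] give [-ln (1 - w)]; this is how
    gamma enters. *)
Let y m : nat := Num.truncn (expR m%:R : R).

Let y_itv m : (y m)%:R <= expR (m%:R : R) /\ expR (m%:R : R) < (y m).+1%:R.
Proof. by have /andP[] := Num.Theory.truncn_itv (expR_ge0 (m%:R : R)). Qed.

Let y0 : y 0 = 1%N.
Proof.
have [h1 h2] := y_itv 0; move: h1 h2; rewrite expR0 (ler_nat R _ 1) (ltr_nat R 1); lia.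
Qed.

Let y_ge m : (m < (y m).+1)%N.
Proof.
rewrite -(ltr_nat R); have [_ h] := y_itv m; apply: le_lt_trans h.
by have := expR_ge1Dx (m%:R : R); lra.
Qed.

Let y_gt0 m : (0 < y m)%N.
Proof. by case: m => [|m]; [rewrite y0|have := y_ge m.+1; lia]. Qed.

Let y_homo m : (y m <= y m.+1)%N.
Proof.
rewrite -ltnS -(ltr_nat R); have [h _] := y_itv m; have [_ h'] := y_itv m.+1.
apply: le_lt_trans h (le_lt_trans _ h'); by rewrite ler_expR ler_nat.
Qed.

Let ln_y_le m : ln (y m)%:R <= m%:R :> R.
Proof. by rewrite -[leRHS]expRK ler_ln ?posrE ?ltr0n ?y_gt0 ?expR_gt0//; have [] := y_itv m. Qed.

Let ln_y_gt m : m%:R <= ln (y m).+1%:R :> R.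
Proof. by rewrite -[leLHS]expRK ler_ln ?posrE ?ltr0n ?expR_gt0// ltW//; have [] := y_itv m. Qed.

Lemma psum_diff_mono (F G : nat -> R) m n : (m <= n)%N ->
  (forall p, prime p -> (m < p <= n)%N -> F p <= G p) ->
  psum F n - psum F m <= psum G n - psum G m.
Proof.
move=> mn FG; rewrite !psum_range// big_nat_cond [leRHS]big_nat_cond.
apply: ler_sum => k /andP[/andP[mk kn] _]; rewrite !psumS.
by case: ifP => pp; rewrite ?addr0 ?subrr//; have := FG _ pp; rewrite ltnS mk kn => /(_ isT); lra.
Qed.

Let a p : R := - ln (1 - p%:R^-1).
Let q d p : R := expR (- (d * ln p%:R)).

Let a0 p : prime p -> 0 <= a p.
Proof.
move=> pp; have /andP[h _] := @neg_ln_1Binv_bounds R p pp; apply: le_trans h.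
by rewrite invr_ge0.
Qed.

Let L0 : L (y 0) = 0. Proof. by rewrite y0 /L psum1. Qed.

Let wsum_le d T : 0 < d ->
  psum (fun p => q d p * a p) (y T) <= \sum_(0 <= m < T) expR (- d) ^+ m * (L (y m.+1) - L (y m)).
Proof.
move=> d0; have -> : psum (fun p => q d p * a p) (y T) =
    \sum_(0 <= m < T) (psum (fun p => q d p * a p) (y m.+1) - psum (fun p => q d p * a p) (y m)).
  by rewrite (telescope_sumr (fun m => psum (fun p => q d p * a p) (y m)))// y0 psum1 subr0.
apply: ler_sum => m _; rewrite /L mulrBr -!psumZ; apply: psum_diff_mono => // p pp /andP[yp _].
apply: ler_wpM2r; first exact: a0.
rewrite -expRM_natl /q ler_expR mulrN lerN2 mulrC; apply: ler_wpM2l; first exact: ltW.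
by apply: le_trans (ln_y_gt m) _; apply: ler_ln_nat.
Qed.

(** On a block only [ln p <= m + 1] is known, whence the extra factor [e^-d], which tends to [1]. *)
Let wsum_ge d T : 0 < d ->
  expR (- d) * \sum_(0 <= m < T) expR (- d) ^+ m * (L (y m.+1) - L (y m)) <= psum (fun p => q d p * a p) (y T).
Proof.
move=> d0; have -> : psum (fun p => q d p * a p) (y T) =
    \sum_(0 <= m < T) (psum (fun p => q d p * a p) (y m.+1) - psum (fun p => q d p * a p) (y m)).
  by rewrite (telescope_sumr (fun m => psum (fun p => q d p * a p) (y m)))// y0 psum1 subr0.
rewrite mulr_sumr.
apply: ler_sum => m _; rewrite mulrA -exprS /L mulrBr -!psumZ; apply: psum_diff_mono => // p pp /andP[yp py].
apply: ler_wpM2r; first exact: a0.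
rewrite -expRM_natl /q ler_expR mulrN lerN2 [leRHS]mulrC; apply: ler_wpM2l; first exact: ltW.
by apply: le_trans (ln_y_le m.+1); apply: ler_ln_nat => //; exact: prime_gt0.
Qed.

Lemma le0_of_le_small (x K : R) : 0 <= K ->
  (forall t, 0 < t <= 2^-1 -> x <= K * t) -> x <= 0.
Proof.
move=> K0 H; rewrite leNgt; apply/negP => x0.
have xK : 0 < x + K by lra.
have := H (x / (2 * (x + K))).
have -> : 0 < x / (2 * (x + K)) by rewrite divr_gt0// mulr_gt0.
rewrite /= ler_pdivrMr ?mulr_gt0//.
have -> : x <= 2^-1 * (2 * (x + K)) by rewrite mulrA mulVf// mul1r; lra.
move=> /(_ isT); rewrite mulrA ler_pdivlMr ?mulr_gt0//; nra.
Qed.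

(** With [d = t^2], the bound [-ln d <= 2 / t] gives [d (-ln d) <= 2 t], so that all errors become
    multiples of [t]. *)
Let small_facts t : 0 < t <= 2^-1 -> let d := t ^+ 2 in let w := expR (- d) in
  [/\ 0 < d, d <= 4^-1, - ln d <= 2 / t & 0 <= - ln d] /\
  [/\ 0 < w, w < 1, 1 - w <= d, d * w <= 1 - w & w^-1 <= 1 + 2 * d].
Proof.
move=> /andP[t0 t1] d w.
have d0 : 0 < d by rewrite exprn_gt0.
have d4 : d <= 4^-1 by rewrite /d; nra.
have ld : ln d = 2 * ln t by rewrite /d lnXn// mulr_natl.
have lt1 : - ln t <= t^-1 - 1.
  have := ln_tangent (ltr01 : 0 < 1 :> R) t0; rewrite ln1 mulrBl mul1r divff ?gt_eqF//; lra.
have ln0 : ln d <= 0 by apply: ln_le0; lra.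
have w0 : 0 < w by exact: expR_gt0.
have w1 : 1 - d <= w by have := expR_ge1Dx (- d : R); rewrite /w.
have ew : w * expR d = 1 by rewrite /w -expRD addNr expR0.
have dw : w * (1 + d) <= 1.
  apply: le_trans (_ : w * expR d <= _); last by rewrite ew.
  by apply: ler_wpM2l; [exact: ltW|exact: expR_ge1Dx].
have wlt1 : w < 1 by have : 0 < w * d by [rewrite mulr_gt0]; lra.
split; split => //; try lra.
have : w * w^-1 = 1 by rewrite mulfV// gt_eqF.
by rewrite -div1r ler_pdivrMr//; nra.
Qed.

(** By the lower bound for zeta, the increments of [L] summed against [w^m] are at least [-ln d] up
    to [O(t)]. They split into those of [H], which give at most [-ln d] up to [O(t)], and those of
    [D = L - H], where eventually [D <= u - gamma]. The divergent terms cancel. *)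
Lemma euler_gamma_le_of_log_prod u x0 :
  (forall n, (x0 <= n)%N -> L n <= ln (ln n%:R) + u) -> gam <= u.
Proof.
move=> hL.
pose D m : R := L (y m) - H m.
pose m0 := x0.+2.
have Dlt m : (m0 <= m)%N -> D m <= u - gam.
  move=> hm; have ym := y_ge m.
  have := hL (y m) ltac:(lia); have := @harmonic_ge R m ltac:(lia).
  have : ln (ln (y m)%:R) <= ln m%:R :> R.
    have l1 : 0 < ln (y m)%:R :> R by apply: ln_nat_gt0; lia.
    by rewrite ler_ln ?posrE ?ltr0n ?l1 ?ln_y_le//; lia.
  by move=> i1 i2 i3; rewrite /D; lra.
(* [C] absorbs the finitely many [m < m0]; it will come with the factor [1 - w^m0], which is
   [O(d)]. *)
pose C : R := \sum_(0 <= m < m0) `|D m - (u - gam)|.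
have C0 : 0 <= C by apply: sumr_ge0.
have Dle m : D m <= (u - gam) + C.
  have [mm|/Dlt] := ltnP m m0; last by lra.
  rewrite -lerBlDl; apply: le_trans (ler_norm _) _.
  by rewrite /C (bigD1_seq m) ?iota_uniq ?mem_index_iota//= lerDl sumr_ge0.
have D0 : D 0 = 0 by rewrite /D L0 /series/= big_geq// subr0.
rewrite -subr_le0; apply: (@le0_of_le_small _ (6 + C * m0%:R)).
  by rewrite addr_ge0// mulr_ge0.
move=> t t01; have [[d0 d4 ld ld0] [w0 w1 wd dw iw]] := small_facts t01.
have /andP[t0 t1] := t01; set d := t ^+ 2 in d0 d4 ld ld0 w0 w1 wd dw iw *.
set w := expR (- d) in w0 w1 wd dw iw *.
have et : 0 < 1 - expR (- t) by rewrite subr_gt0 expR_lt1; lra.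
(* [T] depends on [t]: the zeta bound truncated at [y T] loses at most a factor [e^-t]. *)
have [T [mT wT]] := expR_geom_small m0 d0 et.
have h1 := log_zeta_ge d0 (y_gt0 T).
have h2 : psum (fun p => - ln (1 - expR (- (d * ln p%:R)) / p%:R)) (y T) <= psum (fun p => q d p * a p) (y T).
  by apply: ler_psum => p pp _; exact: log_zeta_term_le.
have h3 := wsum_le T d0.
have h4 : \sum_(0 <= m < T) w ^+ m * (L (y m.+1) - L (y m)) =
  \sum_(0 <= m < T) w ^+ m * (D m.+1 - D m) + w^-1 * \sum_(0 <= m < T) w ^+ m.+1 / m.+1%:R.
  rewrite mulr_sumr -big_split/=; apply: eq_bigr => m _.
  rewrite /D series_harmonicS exprS -!mulrA mulKf ?gt_eqF//; ring.
have h5 : \sum_(0 <= m < T) w ^+ m * (D m.+1 - D m) <= (u - gam) + C * (1 - w ^+ m0).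
  by apply: abelian_le => //; rewrite ?ltW//= mT.
have /andP[h6 _] := @ln1B_series_bounds R w T ltac:(by rewrite w1 ltW).
have h7 : C * (1 - w ^+ m0) <= C * (d * m0%:R).
  apply: ler_wpM2l => //; rewrite -expRM_natl mulrN mulrC.
  by have := expR_ge1Dx (- (d * m0%:R) : R); lra.
have h8 : - ln (1 - w) <= - ln d + d.
  have : ln (d * w) <= ln (1 - w) by rewrite ler_ln ?posrE ?mulr_gt0// subr_gt0.
  rewrite lnM ?posrE// /w expRK; lra.
have h9 : - ln d - t <= ln ((1 - expR (- (d * ln (y T).+1%:R))) / d).
  have e1 : expR (- (d * ln (y T).+1%:R)) <= w ^+ T.
    rewrite -expRM_natl ler_expR mulrN lerN2 mulrC; apply: ler_wpM2l; first exact: ltW.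
    exact: ln_y_gt.
  have e2 : expR (- t) <= 1 - expR (- (d * ln (y T).+1%:R)) by lra.
  have e3 : 0 < 1 - expR (- (d * ln (y T).+1%:R)) by apply: lt_le_trans e2; exact: expR_gt0.
  rewrite ln_div ?posrE//.
  have : ln (expR (- t)) <= ln (1 - expR (- (d * ln (y T).+1%:R))) by rewrite ler_ln ?posrE ?expR_gt0.
  by rewrite expRK; lra.
have h10 : w^-1 * \sum_(0 <= m < T) w ^+ m.+1 / m.+1%:R <= - ln d + 4 * t + 2 * d.
  apply: le_trans (_ : (1 + 2 * d) * (- ln d + d) <= _).
    apply: ler_pM => //; first by rewrite invr_ge0 ltW.
      by apply: sumr_ge0 => m _; rewrite divr_ge0// exprn_ge0// ltW.
    by apply: le_trans h8.
  have : d * (- ln d) <= d * (2 / t) by apply: ler_wpM2l => //; exact: ltW.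
  have -> : d * (2 / t) = 2 * t by rewrite /d; field; rewrite gt_eqF.
  have : d * d <= d * 4^-1 by apply: ler_wpM2l => //; exact: ltW.
  move: (ln d) => l; lra.
have dt : d <= 2^-1 * t by rewrite /d expr2; apply: ler_wpM2r => //; exact: ltW.
have : C * (d * m0%:R) <= C * (t * m0%:R).
  by apply: ler_wpM2l => //; apply: ler_wpM2r => //; lra.
rewrite h4 in h3; move: h1 h2 h3 h5 h6 h7 h9 h10.
move: (psum _ _) (psum _ _) (\sum_(0 <= m < T) _) (w^-1 * _) (ln (_ / d)) => A1 A2 A3 A4 A5 *.
have -> : (6 + C * m0%:R) * t = 6 * t + C * (t * m0%:R) by ring.
lra.
Qed.

(** Mirror image of the preceding lemma, with the upper bound for zeta. [H m.-1] takes the place of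
    [H m], because it is at most [gamma + ln m] without error term. *)
Lemma le_euler_gamma_of_log_prod u x0 :
  (forall n, (x0 <= n)%N -> ln (ln n.+1%:R) + u <= L n) -> u <= gam.
Proof.
move=> hL.
pose D m : R := - (L (y m) - H m.-1).
pose m0 := x0.+2.
have Dlt m : (m0 <= m)%N -> D m <= gam - u.
  move=> hm; have ym := y_ge m.
  have := hL (y m) ltac:(lia); have := @harmonic_pred_le R m ltac:(lia).
  have : ln m%:R <= ln (ln (y m).+1%:R) :> R.
    have l1 : 0 < ln (y m).+1%:R :> R by apply: ln_nat_gt0; lia.
    by rewrite ler_ln ?posrE ?ltr0n ?l1 ?ln_y_gt//; lia.
  rewrite /D; move: (L _) (ln (ln _)) (ln _) (series _ _) => *; lra.
pose C : R := \sum_(0 <= m < m0) `|D m - (gam - u)|.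
have C0 : 0 <= C by apply: sumr_ge0.
have Dle m : D m <= (gam - u) + C.
  have [mm|/Dlt] := ltnP m m0; last by lra.
  rewrite -lerBlDl; apply: le_trans (ler_norm _) _.
  by rewrite /C (bigD1_seq m) ?iota_uniq ?mem_index_iota//= lerDl sumr_ge0.
have D0 : D 0 = 0 by rewrite /D L0 /series/= big_geq// subr0 oppr0.
(* The factor [2] pays for a division by [w >= 1/2]. *)
rewrite -subr_le0; apply: (@le0_of_le_small _ (2 * (6 + C * m0%:R))).
  by rewrite mulr_ge0// addr_ge0// mulr_ge0.
move=> t t01; have [[d0 d4 ld ld0] [w0 w1 wd dw iw]] := small_facts t01.
have /andP[t0 t1] := t01; set d := t ^+ 2 in d0 d4 ld ld0 w0 w1 wd dw iw *.
set w := expR (- d) in w0 w1 wd dw iw *.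
have Kt : 0 <= C * m0%:R * t by rewrite !mulr_ge0// ltW.
have [g0|g0] := leP (u - gam) 0; first by lra.
have et : 0 < t * (1 - w) by rewrite mulr_gt0// subr_gt0.
(* This [T] makes the remainder [w^(T+1) / (1 - w)] of the logarithm series at most [t]. *)
have [[|T] [mT wT]] := expR_geom_small m0 d0 et; first by [].
have h1 := log_zeta_le d0 (y T.+1).
have h2 : psum (fun p => q d p * a p) (y T.+1) - 2 * d <= psum (fun p => - ln (1 - expR (- (d * ln p%:R)) / p%:R)) (y T.+1).
  apply: le_trans (_ : psum (fun p => q d p * a p - d * (ln p%:R / (p%:R * (p%:R - 1)))) (y T.+1) <= _); last first.
    by apply: ler_psum => p pp _; exact: log_zeta_term_ge.
  rewrite (_ : psum (fun p => q d p * a p - d * (ln p%:R / (p%:R * (p%:R - 1)))) (y T.+1) =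
    psum (fun p => q d p * a p) (y T.+1) - d * psum (fun p => ln p%:R / (p%:R * (p%:R - 1))) (y T.+1)); last first.
    by rewrite -psumZ /psum -sumrB.
  rewrite lerD2l lerN2 mulrC; apply: ler_wpM2r; first exact: ltW.
  have := @psum_tail_ln_le R 1 (y T.+1) isT (y_gt0 _); rewrite psum1 subr0 ln1 addr0 divr1; exact.
have h3 := wsum_ge T.+1 d0.
have h4 : \sum_(0 <= m < T.+1) w ^+ m * (L (y m.+1) - L (y m)) =
  \sum_(0 <= m < T) w ^+ m.+1 / m.+1%:R - \sum_(0 <= m < T.+1) w ^+ m * (D m.+1 - D m).
  have -> : \sum_(0 <= m < T) w ^+ m.+1 / m.+1%:R = \sum_(0 <= m < T.+1) w ^+ m * (H m - H m.-1).
    rewrite big_nat_recl//= subrr mulr0 add0r; apply: eq_bigr => m _.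
    by rewrite series_harmonicS addrAC subrr add0r.
  rewrite -sumrB; apply: eq_bigr => m _; rewrite /D /=; ring.
have h5 : \sum_(0 <= m < T.+1) w ^+ m * (D m.+1 - D m) <= (gam - u) + C * (1 - w ^+ m0).
  by apply: abelian_le => //; rewrite ?ltW//= mT.
have /andP[_ h6] := @ln1B_series_bounds R w T ltac:(by rewrite w1 ltW).
have h6' : w ^+ T.+1 / (1 - w) <= t by rewrite ler_pdivrMr// subr_gt0.
have h7 : C * (1 - w ^+ m0) <= C * (d * m0%:R).
  apply: ler_wpM2l => //; rewrite -expRM_natl mulrN mulrC.
  by have := expR_ge1Dx (- (d * m0%:R) : R); lra.
have h8 : - ln d <= - ln (1 - w).
  by rewrite lerN2 ler_ln ?posrE// subr_gt0.
have h9 : ln (1 + d^-1) <= d - ln d.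
  have -> : 1 + d^-1 = (1 + d) / d by field; rewrite gt_eqF.
  rewrite ln_div ?posrE//; last by lra.
  by rewrite lerD2r; apply: le_ln1Dx; lra.
have h10 : w * (- ln d - t + (u - gam) - C * (d * m0%:R)) <= w * \sum_(0 <= m < T.+1) w ^+ m * (L (y m.+1) - L (y m)).
  apply: ler_wpM2l; first exact: ltW.
  rewrite h4; move: h5 h6 h6' h7 h8; move: (\sum_(0 <= m < T) _) (\sum_(0 <= m < T.+1) _) => A1 A2.
  move: (ln d) (ln (1 - w)) (C * (d * _)) (C * (1 - _)) (w ^+ T.+1 / _) => *; lra.
have dt : d <= 2^-1 * t by rewrite /d expr2; apply: ler_wpM2r => //; exact: ltW.
have h11 : C * (d * m0%:R) <= C * (t * m0%:R).
  by apply: ler_wpM2l => //; apply: ler_wpM2r => //; lra.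
have h12 : (1 - w) * (- ln d) <= 2 * t.
  apply: le_trans (_ : d * (2 / t) <= _); first by apply: ler_pM => //; lra.
  by rewrite /d le_eqVlt; apply/orP; left; apply/eqP; field; rewrite gt_eqF.
have h13 : w * (- ln d - t + (u - gam) - C * (d * m0%:R)) <= 3 * d - ln d.
  apply: le_trans h10 _; apply: le_trans h3 _; have := le_trans h2 (le_trans h1 h9); lra.
have w2 : 2^-1 <= w by lra.
have h14 : w * t <= t by rewrite ler_piMl// ltW.
have h15 : w * (C * (d * m0%:R)) <= C * (t * m0%:R).
  apply: le_trans h11; apply: ler_piMl; last exact: ltW.
  by apply: mulr_ge0 => //; apply: mulr_ge0 => //; exact: ltW.
have h16 : 2^-1 * (u - gam) <= w * (u - gam) by apply: ler_wpM2r => //; exact: ltW.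
have e : C * (t * m0%:R) = C * m0%:R * t by ring.
rewrite e in h15; move: (m0%:R) Kt h12 h13 h14 h15 h16 => M Kt; move: (ln d) => l.
move=> *; lra.
Qed.

End MertensConstant.

(** * Explicit bounds for the Mertens product *)

(** The origin of [207/200]: the fractional parts contribute [2 (ln 2)^2], at most
    [961/1000 + 2/10^4], and all remaining terms together at most [735/10^4] when the square root
    [r] is at least [200]. *)
Lemma mertens_sum_arith (R : realFieldType) (N r l PI ln_n ln_r s th lf l2 : R) :
  200 <= r -> r * r <= N -> PI <= r / 2 -> 0 <= ln_n -> ln_n <= 2 * l -> ln_r <= l ->
  l <= 1723 / 400 + (r + 1) / 201 -> 0 <= l2 -> l2 <= 6932 / 10 ^+ 4 -> th <= 2 * l2 * r ->
  lf <= N * ln_n - N + 1 + ln_n ->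
  N * s <= lf + (PI * ln_n + th) + 2 * l2 * (N * l2 + 2) + N * ((2 + ln_r) / r) ->
  N * s <= N * (ln_n - 1 + 207 / 200).
Proof.
move=> hr hN hPI ln0 hln hlnr hl l20 l2u hth hlf hs.
have r0 : 0 < r by clear -hr; lra.
have N0 : 0 <= N by apply: le_trans hN; apply: mulr_ge0; exact: ltW.
have l0 : 0 <= l by clear -ln0 hln; lra.
have q2 : N * ((2 + ln_r) / r) <= N * ((2 + l) / r).
  apply: ler_wpM2l => //; apply: ler_wpM2r; first by rewrite invr_ge0 ltW.
  by rewrite lerD2l.
have q3 : PI * ln_n <= r * l.
  apply: le_trans (_ : r / 2 * ln_n <= _); first exact: ler_wpM2r.
  have -> : r * l = r / 2 * (2 * l) by field.
  by apply: ler_wpM2l => //; clear -r0; lra.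
have h : l2 * l2 <= 961 / 2000 + 1 / 10 ^+ 4.
  apply: le_trans (_ : (6932 / 10 ^+ 4) * (6932 / 10 ^+ 4) <= _); first exact: ler_pM.
  clear; lra.
have q4 : 2 * l2 * (N * l2 + 2) <= (961 / 1000 + 2 / 10 ^+ 4) * N + 278 / 100.
  have := ler_wpM2l N0 h; clear -l2u; lra.
have q5 : 2 * l2 * r <= 1387 / 1000 * r.
  by apply: ler_wpM2r; [exact: ltW|clear -l2u; lra].
set z := (2 + l) / r in q2 *.
have zr : z * r = 2 + l by rewrite /z divfK// gt_eqF.
have z1 : z <= 735 / 10 ^+ 4.
  by rewrite /z ler_pdivrMr//; clear -hl hr; lra.
have q7 : (735 / 10 ^+ 4 - z) * (r * r) <= (735 / 10 ^+ 4 - z) * N.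
  by apply: ler_wpM2l; [clear -z1; lra|exact: hN].
have q8 : z * (r * r) = (2 + l) * r by rewrite mulrA zr.
have q9 : 1 + 2 * l + (r * l + 1387 / 1000 * r) + 278 / 100 + (2 + l) * r <= 735 / 10 ^+ 4 * (r * r).
  have a1 : r * l <= r * (1723 / 400 + (r + 1) / 201) by apply: ler_wpM2l => //; exact: ltW.
  have a2 : 200 * r <= r * r by apply: ler_wpM2r => //; exact: ltW.
  clear -a1 a2 hl hr; lra.
rewrite mulrBl q8 mulrBl in q7.
rewrite mulrDr mulrBr mulr1.
clear -hlf hs hln q2 q3 q4 q5 q7 q9 hth N0.
move: (N * ln_n) (N * s) (PI * ln_n) (2 * l2 * r) (2 * l2 * _) (N * ((2 + ln_r) / r)) hlf hs q2 q3 q4 q5 q7 q9 hth => *.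
lra.
Qed.

Section LnNumerics.
Variable R : realType.

Lemma ln2_bounds : (693 + 147 / 10 ^+ 3) / 10 ^+ 3 <= @ln R 2 <= (693 + 148 / 10 ^+ 3) / 10 ^+ 3.
Proof.
have e1 : 1 - 2^-1 = 2^-1 :> R by lra.
have := @ln1B_series_bounds R 2^-1 24 ltac:(apply/andP; split; lra).
rewrite e1 lnV ?posrE// opprK invrK !big_nat_recr//= big_geq// => /andP[h1 h2].
by apply/andP; split; lra.
Qed.

Lemma ln3_bounds : 109 / 100 <= @ln R 3 <= 11 / 10.
Proof.
have e1 : 1 - 3^-1 = 2 / 3 :> R by lra.
have := @ln1B_series_bounds R 3^-1 10 ltac:(apply/andP; split; lra).
have /andP[l2 u2] := ln2_bounds.
rewrite e1 ln_div ?posrE// opprB invf_div !big_nat_recr//= big_geq// => /andP[h1 h2].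
by apply/andP; split; lra.
Qed.

Lemma ln_pow2 n : ln (2 ^+ n) = n%:R * ln 2 :> R.
Proof. by rewrite lnXn// mulr_natl. Qed.

Lemma ln4E : ln 4 = 2 * ln 2 :> R.
Proof. by rewrite -ln_pow2; congr ln; rewrite expr2; lra. Qed.

(** Apart from a power of [2], the factors of this decomposition are close to [1], where the
    trapezoid bound is sharp. *)
Lemma ln201_le : ln 201 <= (2123 / 400) :> R.
Proof.
have -> : 201 = 2 ^+ 7 * (5 / 4 * (201 / 160)) :> R by lra.
have lnMp (x y : R) : 0 < x -> 0 < y -> ln (x * y) = ln x + ln y by move=> *; rewrite lnM ?posrE.
rewrite (lnMp (2 ^+ 7)); [|exact: exprn_gt0|lra].
rewrite (lnMp (5 / 4)); [|lra|lra].
have /andP[l2 u2] := ln2_bounds.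
have h1 := @ln_trapezoid R (5 / 4) ltac:(lra).
have h2 := @ln_trapezoid R (201 / 160) ltac:(lra).
rewrite ln_pow2; lra.
Qed.

Lemma ln40000_ge (x : R) : (200 * 200) <= x -> (1059 / 100) <= ln x.
Proof.
move=> hx; apply: le_trans (_ : ln (2 ^+ 15 * (625 / 512)) <= _); last first.
  have e : 2 ^+ 15 * (625 / 512) = 200 * 200 :> R by field.
  by rewrite e ler_ln ?posrE; [exact: hx|exact: mulr_gt0|apply: lt_le_trans hx; exact: mulr_gt0].
have lnMp (y z : R) : 0 < y -> 0 < z -> ln (y * z) = ln y + ln z by move=> *; rewrite lnM ?posrE.
rewrite (lnMp (2 ^+ 15)); [|exact: exprn_gt0|lra].
have /andP[l2 u2] := ln2_bounds.
have h1 := @ln_midpoint R (625 / 512) ltac:(lra).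
have e : 2 * (625 / 512 - 1) / (625 / 512 + 1) = 226 / 1137 :> R by field.
rewrite e in h1; rewrite ln_pow2; lra.
Qed.

End LnNumerics.

Section MertensExplicit.
Variable R : realType.
Implicit Types n p q : nat.
Local Notation S := (@mertens_sum R).
Local Notation L := (@log_prod R).
Local Notation gam := (euler_gamma R).
Local Notation M := (@mertens_product R).

Lemma sqrt_nat_ex n : exists r, (r * r <= n < r.+1 * r.+1)%N.
Proof.
elim: n => [|n [r /andP[h1 h2]]]; first by exists 0%N.
have [h|h] := leqP (r.+1 * r.+1) n.+1; last by exists r; lia.
by exists r.+1; nia.
Qed.

Lemma mertens_sum_le n : (200 * 200 <= n)%N -> S n <= ln n%:R - 1 + (207 / 200).
Proof.
move=> n4; have [r /andP[rn nr]] := sqrt_nat_ex n.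
have r200 : (200 <= r)%N by nia.
have n1 : (1 < n)%N by lia.
have rlen : (r <= n)%N by nia.
have r0 : (0 < r)%N by lia.
have := @mertens_sum_le_split R n r n1 r0 rlen.
have := @ln_fact_le R n (ltnW n1).
have := theta_le R r.
have Rr : 200 <= r%:R :> R by rewrite (ler_nat R 200).
have Rn : r%:R * r%:R <= n%:R :> R by rewrite -natrM ler_nat.
have hpi : psum (fun=> 1) r <= r%:R / 2 :> R.
  rewrite ler_pdivlMr// /psum.
  have -> : \sum_(0 <= p < r.+1 | prime p) 1 = (\sum_(0 <= p < r.+1 | prime p) 1)%N%:R :> R.
    by rewrite natr_sum.
  by rewrite -natrM ler_nat mulnC primepi_half//; clear -r200; lia.
have l0 := ln_nat_ge0 R n.
have lr : ln (r%:R + 1) <= 1723 / 400 + (r%:R + 1) / 201 :> R.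
  have := @ln_ratio_le R 201 (r%:R + 1) ltac:(clear -Rr; lra) ltac:(clear -Rr; lra).
  have := ln201_le R; clear; lra.
have lr1 : ln r%:R <= ln (r%:R + 1) :> R by rewrite natr1; apply: ler_ln_nat.
have lnr : ln n%:R <= 2 * ln (r%:R + 1) :> R.
  rewrite natr1 mulr_natl -lnXn ?ltr0n// -natrX; apply: ler_ln_nat; first by clear -n1; lia.
  by apply: ltnW; rewrite expnS expn1.
have n0 : 0 < n%:R :> R by rewrite ltr0n; clear -n1; lia.
have /andP[l2 u2] := ln2_bounds R.
rewrite ln4E => hth hf hs; rewrite -(ler_pM2l n0).
apply: (mertens_sum_arith Rr Rn hpi l0 lnr lr1 lr _ _ hth hf hs).
  by apply: ln_ge0; clear; lra.
by clear -u2; lra.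
Qed.

Lemma mertens_productE q : M q.+1 = expR (gam - L q).
Proof.
rewrite /mertens_product expRD; congr (_ * _).
elim: q => [|q IH]; first by rewrite /log_prod psum0 oppr0 expR0 unlock.
rewrite big_mkcond big_nat_recr//= -big_mkcond IH /log_prod psumS.
case: ifP => pp; last by rewrite mulr1 addr0.
rewrite opprD opprK expRD lnK// posrE subr_gt0 invf_lt1 ?ltr0n//.
by rewrite ltr1n prime_gt1.
Qed.

Lemma mertens_productS q : M q.+1 = M q * (if prime q then 1 - q%:R^-1 else 1).
Proof.
by rewrite /mertens_product -mulrA [in LHS]big_mkcond big_nat_recr//= -big_mkcond.
Qed.

Lemma mertens_product_gt0 q : 0 < M q.
Proof.
case: q => [|q]; last by rewrite mertens_productE expR_gt0.
by rewrite /mertens_product big_geq// mulr1 expR_gt0.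
Qed.

Lemma ln_small_ratio n : (200 * 200 <= n)%N -> (n%:R - 1)^-1 <= 1 / 1000 / ln n%:R :> R.
Proof.
move=> n4; have N4 : 200 * 200 <= n%:R :> R by rewrite -natrM ler_nat.
have l0 : 0 < ln n%:R :> R by have := ln40000_ge N4; clear; lra.
have n0 : 0 < n%:R - 1 :> R by clear -N4; lra.
have h : ln n%:R - ln (200 * 200) <= (n%:R - 200 * 200) / (200 * 200) :> R.
  by apply: ln_ratio_le => //; exact: mulr_gt0.
have h2 : ln (200 * 200) <= 2 * (2123 / 400) :> R.
  have := ln201_le R; have : ln 200 <= ln 201 :> R by apply: ler_ln_nat.
  by rewrite lnM ?posrE//; clear; lra.
rewrite ler_pdivlMr// mulrC ler_pdivrMr//; clear -h h2 N4; lra.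
Qed.

(** [A] and [B] stand for [ln ln (3 q)] and [ln ln q], [l] for [ln q]. [1036/1000] is [207/200] plus
    [1/1000] for the term [i]. With [ln 3 >= 1.09] the inequality needs [l] above about [10.46],
    which [40000] provides. *)
Lemma mertens_lower_arith (l l3 A B h i : R) : 1059 / 100 <= l -> 109 / 100 <= l3 -> l3 <= 11 / 10 ->
  i <= 1 / 1000 / l -> - B - 207 / 200 / l - i <= h ->
  2 * ((l3 + l) / l - 1) / ((l3 + l) / l + 1) <= A - B -> 0 <= h + A.
Proof.
move=> hl h3 h3' hi hh.
have l0 : 0 < l by clear -hl; lra.
have -> : 2 * ((l3 + l) / l - 1) / ((l3 + l) / l + 1) = 2 * l3 / (2 * l + l3).
  by field; apply/andP; split; rewrite gt_eqF//; clear -hl h3; lra.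
have : 1036 / 1000 / l <= 2 * l3 / (2 * l + l3).
  rewrite ler_pdivrMr// mulrAC ler_pdivlMr; last by clear -hl h3; lra.
  have : 0 <= (l - 1059 / 100) * (l3 - 109 / 100) by apply: mulr_ge0; rewrite subr_ge0.
  by clear -hl h3 h3'; lra.
move: hi hh; rewrite -!mulrA; move: (l^-1) (2 * (l3 * _)) => j z; clear; lra.
Qed.

(** The lower bound for [L n - L q] holds for every [n >= q], so [le_euler_gamma_of_log_prod] turns
    it into a lower bound for [gamma - L q]; the gain from [ln ln q] to [ln ln (3 q)] outweighs its
    error. *)
Lemma mertens_product_ln3_large q : (200 * 200 < q)%N -> 1 <= M q * ln (3 * q%:R).
Proof.
case: q => // q; rewrite ltnS => q4.
have q4' : (200 * 200 <= q.+1)%N by exact: leqW.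
have Q4 : 200 * 200 <= q.+1%:R :> R by rewrite -natrM ler_nat.
have H n : (q <= n)%N -> ln (ln n.+1%:R) + (L q - ln (ln q.+1%:R) - 207 / 200 / ln q.+1%:R - q%:R^-1) <= L n.
  move=> qn; have := @log_prod_diff_ge R (207 / 200) (200 * 200) isT mertens_sum_le q n q4 qn.
  by move: (ln (ln _)) (ln (ln _)) (207 / 200 / _) (q%:R^-1) => *; lra.
have {H}h := le_euler_gamma_of_log_prod H.
have lq := ln40000_ge Q4; have l0 : 0 < ln q.+1%:R :> R by clear -lq; lra.
have /andP[a3 b3] := ln3_bounds R; have l30 : 0 < ln 3 :> R by clear -a3; lra.
have lp : 0 < ln 3 + ln q.+1%:R :> R by exact: addr_gt0.
rewrite mertens_productE.
have -> : ln (3 * q.+1%:R) = ln 3 + ln q.+1%:R :> R by rewrite lnM ?posrE ?ltr0n.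
have -> : ln 3 + ln q.+1%:R = expR (ln (ln 3 + ln q.+1%:R)) :> R by rewrite lnK.
rewrite -expRD -[leLHS]expR0 ler_expR.
have sm := ln_small_ratio q4'; have eq : q.+1%:R - 1 = q%:R :> R by rewrite -natr1 addrK.
rewrite eq in sm.
have h' : - ln (ln q.+1%:R) - 207 / 200 / ln q.+1%:R - q%:R^-1 <= gam - L q.
  by move: h; move: (ln (ln _)) (207 / 200 / _) (q%:R^-1); clear => *; lra.
apply: (mertens_lower_arith lq a3 b3 sm h').
rewrite -ln_div ?posrE//; apply: ln_midpoint.
by rewrite ler_pdivlMr// mul1r lerDr ltW.
Qed.

(** The excess [m - 1/l] is at most [1.036 m / l], the lower bound for [m] gives [1/l <= 1.104 m],
    and [1.036 * 1.104 < 23/20]. *)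
Lemma mertens_upper_arith (m l l3 i : R) : 1059 / 100 <= l -> l3 <= 11 / 10 -> 0 < m ->
  0 <= i -> i <= 1 / 1000 / l -> 1 <= m * (l3 + l) ->
  m * (1 - i) * (1 - 207 / 200 / l) <= l^-1 -> m - l^-1 <= 23 / 20 * m ^+ 2.
Proof.
move=> hl h3' m0 i0 hi hm hM.
have l0 : 0 < l by clear -hl; lra.
have k1 : m * (1 - 1036 / 1000 / l) <= l^-1.
  apply: le_trans hM; rewrite -[leRHS]mulrA; apply: ler_wpM2l; first exact: ltW.
  have : 0 <= i * (207 / 200 / l) 
    by apply: mulr_ge0; [exact: i0|apply: divr_ge0; [clear; lra|exact: ltW]].
  move: hi; rewrite -!mulrA; move: (l^-1) => j; clear; lra.
have k2 : l^-1 <= 1104 / 1000 * m.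
  rewrite -div1r ler_pdivrMr//; apply: le_trans hm _.
  rewrite [1104 / 1000 * m]mulrC -mulrA; apply: ler_wpM2l; first exact: ltW.
  clear -hl h3'; lra.
have k3 : m * (1036 / 1000 / l) <= m * (1036 / 1000 * (1104 / 1000 * m)).
  apply: ler_wpM2l; first exact: ltW.
  by apply: ler_wpM2l; [clear; lra|exact: k2].
have : 0 <= m * m by apply: mulr_ge0; exact: ltW.
move: k1 k3; rewrite expr2; move: (l^-1) => j; clear; lra.
Qed.

(** A bound by the square of [M q] is sought because, divided by [q] and summed over primes, it
    telescopes; this controls the tail of [epsilon0]. *)
Lemma mertens_product_upper q : prime q -> (200 * 200 < q)%N ->
  M q - (ln q%:R)^-1 <= 23 / 20 * M q ^+ 2.
Proof.
move=> pq q4; have q4' := ltnW q4.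
have q1 : (1 < q)%N by exact: prime_gt1.
have Q4 : 200 * 200 <= q%:R :> R by rewrite -natrM ler_nat.
have lq := ln40000_ge Q4; have l0 : 0 < ln q%:R :> R by exact: ln_nat_gt0.
have H n : (q <= n)%N -> L n <= ln (ln n%:R) + (L q - ln (ln q%:R) + 207 / 200 / ln q%:R).
  move=> qn; have := @log_prod_diff_le R (207 / 200) (200 * 200) isT mertens_sum_le q n q4' qn.
  have : 207 / 200 / ln q.+1%:R <= 207 / 200 / ln q%:R :> R.
    apply: ler_wpM2l; first by clear; lra.
    rewrite lef_pV2 ?posrE ?ln_nat_gt0 ?(leqW q1)//.
    by apply: ler_ln_nat => //; exact: ltnW.
  by move: (207 / 200 / _) (207 / 200 / _) (ln (ln _)) (ln (ln _)); clear => *; lra.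
have {H}h := euler_gamma_le_of_log_prod H.
have /andP[_ b3] := ln3_bounds R.
apply: (mertens_upper_arith (i := q%:R^-1) lq b3 (mertens_product_gt0 q)).
- by rewrite invr_ge0.
- apply: le_trans (ln_small_ratio q4').
  by rewrite lef_pV2 ?posrE ?subr_gt0 ?ltr1n ?ltr0n ?(ltnW q1)// gerBl.
- have := mertens_product_ln3_large q4.
  by rewrite (_ : ln (3 * q%:R) = ln 3 + ln q%:R)// lnM ?posrE ?ltr0n ?(ltnW q1).
have -> : M q * (1 - q%:R^-1) = expR (gam - L q) by rewrite -mertens_productE mertens_productS pq.
have e1 : 1 - 207 / 200 / ln q%:R <= expR (- (207 / 200 / ln q%:R)) :> R by exact: expR_ge1Dx.
apply: le_trans (ler_wpM2l (expR_ge0 _) e1) _.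
have e2 : (ln q%:R)^-1 = expR (- ln (ln q%:R)) :> R by rewrite expRN lnK.
by rewrite -expRD [leRHS]e2 ler_expR; move: (207 / 200 / _) h; clear => *; lra.
Qed.

(* [\sum_q M(q)^2 / q] telescopes since [M(q + 1) = M(q) (1 - 1/q)]. *)
Lemma mertens_product_sq_sum X n : (1 < X)%N -> (X <= n)%N ->
  \sum_(X <= q < n | prime q) M q ^+ 2 / q%:R <= M X ^+ 2 / (2 - X%:R^-1).
Proof.
move=> X1 Xn; have X0 : 0 < X%:R :> R by rewrite ltr0n; lia.
have i1 : X%:R^-1 <= 1 :> R by rewrite invf_le1// ler1n; lia.
have p2 : 0 < 2 - X%:R^-1 :> R by lra.
rewrite ler_pdivlMr// mulr_suml.
(* At a prime [q], [M(q)^2 - M(q+1)^2] equals [(M(q)^2 / q) (2 - 1/q)]. *)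
apply: le_trans (_ : \sum_(X <= q < n) (- M q.+1 ^+ 2 - - M q ^+ 2) <= _); last first.
  by rewrite (telescope_sumr (fun q => - M q ^+ 2))// opprK gerDr oppr_le0 sqr_ge0.
rewrite big_mkcond big_nat_cond [leRHS]big_nat_cond; apply: ler_sum => q /andP[/andP[Xq _] _].
rewrite mertens_productS; case: ifP => pq; last by rewrite mulr1 subrr.
have q0 : 0 < q%:R :> R by rewrite ltr0n; lia.
have iq : q%:R^-1 <= X%:R^-1 :> R by rewrite lef_pV2 ?posrE ?ler_nat.
have m2 : 0 <= M q ^+ 2 / q%:R by rewrite divr_ge0 ?sqr_ge0// ltW.
have := ler_wpM2l m2 (_ : 2 - X%:R^-1 <= 2 - q%:R^-1); move=> /(_ ltac:(lra)).
move: m2; move: (M q) (q%:R^-1) => m i m2 h.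
by apply: le_trans h _; rewrite exprMn; move: (m ^+ 2) => z; rewrite expr2; lra.
Qed.

End MertensExplicit.

(** * A certified sieve up to 40003 *)

(** [c] counts the entries left before the next one to strike. A step of [p] in the index is a step
    of [2 p] in the odd numbers, so only odd multiples of [p] are met. *)
Fixpoint strike (p c : nat) (l : seq bool) : seq bool :=
  match l with
  | [::] => [::]
  | b :: l' => if c is c'.+1 then b :: strike p c' l' else false :: strike p p.-1 l'
  end.

(* Index [i] stands for the odd number [2 i + 1]; multiples of [p] are struck from [p ^ 2] on. *)
Definition sieve (ps : seq nat) (l : seq bool) : seq bool :=
  foldl (fun l p => strike p (p * p)./2 l) l ps.

Lemma nth_strike p c l i : (0 < p)%N ->
  nth false (strike p c l) i = nth false l i && ~~ ((c <= i)%N && (p %| i - c)%N).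
Proof.
move=> p0; elim: l c i => [|b l IH] c i; first by rewrite /= nth_nil.
case: c => [|c]; case: i => [|i] //=.
- by rewrite dvdn0 andbF.
- rewrite IH subn0; congr (_ && ~~ _).
  have [h|h] := leqP p.-1 i => /=.
    rewrite -(dvdn_addl _ (dvdnn p)); congr (_ %| _)%N; lia.
  by apply/esym/negbTE; rewrite gtnNdvd//; lia.
- by rewrite andbT.
- by rewrite IH ltnS subSS.
Qed.

Lemma nth_sieve ps l i : all (fun p => odd p) ps ->
  nth false (sieve ps l) i =
  nth false l i && all (fun p => ~~ ((p * p <= i.*2.+1)%N && (p %| i.*2.+1)%N)) ps.
Proof.
elim: ps l => [|p ps IH] l /=; first by rewrite andbT.
move=> /andP[op ops]; rewrite IH// nth_strike; last by case: p op.
rewrite -andbA; congr (_ && _); congr (~~ _ && _).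
have pe : (p * p = (p * p)./2.*2.+1)%N.
  by rewrite -[LHS]odd_double_half oddM op.
have [h|h] := leqP (p * p)./2 i; last first.
  by apply/esym/negbTE; rewrite negb_and -ltnNge; apply/orP; left; lia.
have -> : (p * p <= i.*2.+1)%N by lia.
rewrite /=; have -> : i.*2.+1 = (2 * (i - (p * p)./2) + p * p)%N by lia.
rewrite dvdn_addl; last exact: dvdn_mulr.
by rewrite Gauss_dvdr// coprimen2.
Qed.

Definition odd_primes_below_211 : seq nat := [seq p <- iota 3 208 | prime p].

(** A composite odd number below [211^2] has a least prime factor below [211] whose square does not
    exceed it. Index [0] stands for [1], which is never struck, and is excluded. *)
Lemma sieve_prime K i : (0 < i < K)%N -> (i.*2.+1 < 211 * 211)%N ->
  nth false (sieve odd_primes_below_211 (nseq K true)) i = prime i.*2.+1.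
Proof.
move=> /andP[i0 iK] iX; rewrite nth_sieve; last first.
  apply/allP => p; rewrite mem_filter mem_iota => /andP[pp /andP[p3 _]].
  by have [|//] := even_prime pp; lia.
rewrite nth_nseq iK andTb; apply/allP/idP => [H|pp p].
- apply: ltn_pdiv2_prime => //; rewrite ltnNge; apply/negP => h.
  have pp : prime (pdiv i.*2.+1) by apply: pdiv_prime; lia.
  have pd := pdiv_dvd i.*2.+1.
  have := H (pdiv i.*2.+1); rewrite pd -mulnn in h *; rewrite h => /(_ _)/negP; apply => //.
  rewrite mem_filter pp mem_iota andTb.
  have : pdiv i.*2.+1 != 2%N by apply/eqP => e; move: pd; rewrite e dvdn2 /= odd_double.
  have := prime_gt1 pp; nia.
- rewrite mem_filter mem_iota => /andP[p1 /andP[p3 _]].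
  apply/negP => /andP[h]; rewrite dvdn_prime2// => /eqP e; rewrite -e in h; nia.
Qed.

Section Scan.
Variables s t : N.
Local Open Scope N_scope.

(* Fixed-point bounds: [vl <= s V(n) <= vh] for [V(n) = \prod_(r < n) (1 - 1/r)], and
   [t ln n <= lh]; the list tells which of [n], [n + 2], ... are prime. *)
Fixpoint scan (l : seq bool) (n vl vh lh : N) : option (N * N) :=
  match l with
  | [::] => Some (vl, vh)
  | b :: l' =>
    let n' := n + 2 in
    (* [(2 n + 2) / (n (n + 2))] is the trapezoid bound for [ln ((n + 2) / n)], here rounded up. *)
    let lh' := lh + (t * (2 * n + 2) / (n * n') + 1) in
    if b then
      (* The tests are [e^gamma V(n) ln n <= 1] and [1 <= e^gamma V(n) ln (3 n)], with
         [1.78 <= e^gamma <= 1.7812]. In the second, [ln n] may be replaced by [ln 2] times the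
         integer part of the binary logarithm. *)
      if (vh * lh * (178 * 100 + 12) <=? s * t * (100 * 100)) &&
         (s * t * 100 <=? vl * 178 * (N.log2 n * (t * (693 * 1000 + 147) / (1000 * 1000)) + t * 109 / 100))
      then scan l' n' (vl - (vl / n + 1)) (vh - vh / n) lh' else None
    else scan l' n' vl vh lh'
  end.

(** The first [31] entries are the odd numbers from [3] to [63]. At [65] the bound for the logarithm
    restarts from [6 ln 2 + ln (65/64)], which discards the trapezoid errors of the small numbers,
    where they are largest. *)
Definition scan_range (K : nat) : option (N * N) :=
  let l := behead (sieve odd_primes_below_211 (nseq K true)) in
  if scan (take 31 l) 3 (s / 2) (s / 2 + 1) (t * 11 / 10 + 1) is Some (vl, vh)
  then scan (drop 31 l) 65 vl vh (t * (4174 * 1000 + 394) / (1000 * 1000) + 1)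
  else None.

End Scan.

(** Besides success of all tests, [V <= 0.056] at the end is demanded; the bound for [epsilon0]
    needs it. *)
Definition scan_ok (s t : N) K : bool :=
  if scan_range s t K is Some (_, vh) then (vh * 1000 <=? s * 56)%num else false.

(** The existential keeps the scales [2^40], [2^30] and the limit [2 K + 1 = 40003] opaque in later
    proofs. *)
Lemma scan_check : exists s t K, [/\ s <> 0%num, t <> 0%num, (200 * 200 < K.*2.+1 <= 211 * 211)%N &
  scan_ok s t K].
Proof.
exists (2 ^ 40)%num, (2 ^ 30)%num, (N.to_nat 20001); split.
- by apply: N.pow_nonzero.
- by apply: N.pow_nonzero.
- by lia.
- by vm_compute.
Qed.

(** * Binary naturals as real numbers *)

Section Embedding.
Variable R : realType.
Implicit Types x y n : N.

Definition rN x : R := (N.to_nat x)%:R.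

Lemma rND x y : rN (x + y) = rN x + rN y.
Proof. by rewrite /rN N2Nat.inj_add natrD. Qed.

Lemma rNM x y : rN (x * y) = rN x * rN y.
Proof. by rewrite /rN N2Nat.inj_mul natrM. Qed.

Lemma rN_ge0 x : 0 <= rN x. Proof. exact: ler0n. Qed.

Lemma rN_le x y : (x <=? y)%num -> rN x <= rN y.
Proof. by move=> /N.leb_le h; rewrite ler_nat; lia. Qed.

Lemma rN_gt0 x : x <> 0%num -> 0 < rN x.
Proof. by move=> h; rewrite ltr0n; lia. Qed.

Lemma rN_div_le x y : y <> 0%num -> rN (x / y) <= rN x / rN y.
Proof.
move=> y0; rewrite ler_pdivlMr ?rN_gt0// mulrC -rNM; apply: rN_le.
by apply/N.leb_le; exact: N.Div0.mul_div_le.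
Qed.

Lemma rN_div_ge x y : y <> 0%num -> rN x / rN y <= rN (x / y) + 1.
Proof.
move=> y0; rewrite ler_pdivrMr ?rN_gt0// mulrC.
have -> : rN (x / y) + 1 = rN (N.succ (x / y)) by rewrite /rN N2Nat.inj_succ natr1.
rewrite -rNM; apply: rN_le; apply/N.leb_le; apply: N.lt_le_incl; exact: N.mul_succ_div_gt.
Qed.

Lemma rN_sub_ge x y : rN x - rN y <= rN (x - y).
Proof.
rewrite lerBlDr -rND; apply: rN_le; apply/N.leb_le; lia.
Qed.

Lemma rN_sub_le x y (z : R) : 0 <= z -> rN x - rN y <= z -> rN (x - y) <= z.
Proof.
move=> z0 h; have [yx|xy] := leqP (N.to_nat y) (N.to_nat x).
  by rewrite /rN N2Nat.inj_sub natrB.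
by rewrite /rN N2Nat.inj_sub (_ : (_ - _)%coq_nat = 0%N)//; lia.
Qed.

Lemma rN_pow2 k : rN (2 ^ k) = 2 ^+ N.to_nat k.
Proof.
elim/N.peano_ind: k => [|k IH]; first by rewrite N.pow_0_r /= expr0.
by rewrite N.pow_succ_r' rNM IH N2Nat.inj_succ exprS.
Qed.

Lemma rN_log2 n : n <> 0%num -> rN (N.log2 n) * ln 2 <= ln (rN n).
Proof.
move=> n0; have /N.log2_spec[h _] : (0 < n)%num by lia.
rewrite /rN mulr_natl -lnXn// -rN_pow2 ler_ln ?posrE ?rN_gt0//.
  by apply: rN_le; apply/N.leb_le.
exact: N.pow_nonzero.
Qed.

End Embedding.

(** * Numerical bounds for [e^gamma] *)

Section GammaNumerics.
Variable R : realType.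
Local Notation gam := (euler_gamma R).

Lemma harmonic32_bounds : 4058 / 10 ^+ 3 + 494 / 10 ^+ 6 <= series (@harmonic R) 32 <= 4058 / 10 ^+ 3 + 496 / 10 ^+ 6.
Proof.
have -> : series harmonic 32 = \sum_(0 <= k < 32) k.+1%:R^-1 :> R by [].
rewrite !big_nat_recr//= big_geq//; apply/andP; split; lra.
Qed.

(** At [n = 32] the lower bound for gamma contains [ln 32 = 5 ln 2], and [1.78 = 2 (1 - 0.11)]. For
    the upper bound [1.7812 * 32.5 = 64 (1 - 6.111/64)], so again only [ln 2] and a logarithm series
    are needed. *)
Lemma exp_gamma_bounds : 178 / 100 <= expR gam <= (178 * 100 + 12) / (100 * 100).
Proof.
have /andP[l2 u2] := ln2_bounds R; have /andP[h32 H32] := harmonic32_bounds.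
apply/andP; split.
- have p : 0 < 178 / 100 :> R by lra.
  rewrite -[leLHS]lnK ?posrE// ler_expR; apply: le_trans (@euler_gamma_ge R 32 isT).
  have e : 178 / 100 = 2 * (1 - 11 / 100) :> R by lra.
  rewrite e lnM ?posrE//; last by clear; lra.
  have := @ln1B_series_bounds R (11 / 100) 3 ltac:(clear; apply/andP; split; lra).
  rewrite !big_nat_recr//= big_geq// => /andP[h1 _].
  have e5 : ln 32 = 5 * ln 2 :> R by rewrite -ln_pow2; congr ln; clear; lra.
  rewrite e5; clear -l2 u2 h32 h1; lra.
- have p : 0 < (178 * 100 + 12) / (100 * 100) :> R by clear; lra.
  rewrite -[leRHS]lnK ?posrE// ler_expR; apply: le_trans (@euler_gamma_le R 32 isT) _.
  have p2 : 0 < 32 + 2^-1 :> R by clear; lra.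
  have p3 : 0 < 1 - (6 + 111 / 10 ^+ 3) / 64 :> R by clear; lra.
  suff : series harmonic 32 <= ln ((178 * 100 + 12) / (100 * 100) * (32 + 2^-1)) :> R.
    by rewrite lnM ?posrE// -lerBlDr.
  have -> : (178 * 100 + 12) / (100 * 100) * (32 + 2^-1) = 2 ^+ 6 * (1 - (6 + 111 / 10 ^+ 3) / 64) :> R.
    by field.
  rewrite lnM ?posrE ?exprn_gt0// ln_pow2.
  have := @ln1B_series_bounds R ((6 + 111 / 10 ^+ 3) / 64) 6 ltac:(clear; apply/andP; split; lra).
  rewrite !big_nat_recr//= big_geq// => /andP[_ h1].
  have p4 : (1 - (6 + 111 / 10 ^+ 3) / 64)^-1 <= 12 / 10 :> R.
    by rewrite invf_ple ?posrE//; clear; lra.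
  have h2 : ((6 + 111 / 10 ^+ 3) / 64) ^+ 7 / (1 - (6 + 111 / 10 ^+ 3) / 64) <= ((6 + 111 / 10 ^+ 3) / 64) ^+ 7 * (12 / 10) :> R.
    by apply: ler_wpM2l p4; apply: exprn_ge0; clear; lra.
  move: h1 h2; set z := _ / (1 - _); clear -l2 u2 H32; move=> h1 h2; lra.
Qed.

End GammaNumerics.

(** * Correctness of the scan *)

Section ScanSound.
Variable R : realType.
Implicit Types (n vl vh lh : N) (l : seq bool) (p : nat).
Local Notation M := (@mertens_product R).
Local Notation rN := (@rN R).

Definition unsieved (m : nat) : R := \prod_(0 <= r < m | prime r) (1 - r%:R^-1).
Local Notation V := unsieved.

Lemma unsievedS m : V m.+1 = V m * (if prime m then 1 - m%:R^-1 else 1).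
Proof. by rewrite /unsieved big_mkcond big_nat_recr//= -big_mkcond. Qed.

Lemma unsieved_ge0 m : 0 <= V m.
Proof.
by apply: prodr_ge0 => p pp; rewrite subr_ge0 invf_le1 ?ltr0n ?ler1n prime_gt0.
Qed.

Lemma mertens_product_unsieved m : M m = expR (euler_gamma R) * V m. Proof. by []. Qed.

(** For a prime [p], the first half makes [p] Mertens, the second is the inequality behind the bound
    for each least prime factor. *)
Definition mertens_good p := M p * ln p%:R <= 1 /\ 1 <= M p * ln (3 * p%:R).
Local Notation good := mertens_good.

Lemma check_good (s t : N) n vl vh lh : s <> 0%num -> t <> 0%num -> (2 < N.to_nat n)%N ->
  rN vl <= rN s * V (N.to_nat n) -> rN s * V (N.to_nat n) <= rN vh -> rN t * ln (rN n) <= rN lh ->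
  (vh * lh * (178 * 100 + 12) <=? s * t * (100 * 100))%num ->
  (s * t * 100 <=? vl * 178 * (N.log2 n * (t * (693 * 1000 + 147) / (1000 * 1000)) + t * 109 / 100))%num ->
  good (N.to_nat n).
Proof.
move=> s0 t0 n2 hl hh hlh c1 c2.
have S0 : 0 < rN s by exact: rN_gt0. have T0 : 0 < rN t by exact: rN_gt0.
have n0 : n <> 0%num by move=> e; rewrite e in n2.
have N1 : 1 <= rN n by rewrite ler1n; clear -n2; lia.
have /andP[g1 g2] := exp_gamma_bounds R.
have L0 : 0 <= ln (rN n) by exact: ln_ge0.
set v := V (N.to_nat n) in hl hh *; have v0 : 0 <= v by exact: unsieved_ge0.
rewrite /good mertens_product_unsieved -/v -/(rN n); split.
- have := rN_le R c1; rewrite !rNM rND rNM => {}c1.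
  have e178 : rN 178 = 178 :> R by [].
  have e100 : rN 100 = 100 :> R by [].
  have e12 : rN 12 = 12 :> R by [].
  rewrite e178 e100 e12 in c1.
  have h1 : (rN s * v) * (rN t * ln (rN n)) <= rN vh * rN lh.
    by apply: ler_pM => //; apply: mulr_ge0 => //; exact: ltW.
  have h2 : (rN s * rN t) * (v * ln (rN n) * (178 * 100 + 12)) <= (rN s * rN t) * (100 * 100).
    apply: le_trans c1; rewrite [leLHS](_ : _ = (rN s * v) * (rN t * ln (rN n)) * (178 * 100 + 12)); last by ring.
    by apply: ler_wpM2r => //; clear; lra.
  rewrite ler_pM2l in h2; last exact: mulr_gt0.
  apply: le_trans (_ : (178 * 100 + 12) / (100 * 100) * (v * ln (rN n)) <= _).
    by rewrite -mulrA; apply: ler_wpM2r g2; exact: mulr_ge0.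
  rewrite mulrAC ler_pdivrMr; last by clear; lra.
  by rewrite mul1r mulrC.
- have := rN_le R c2; rewrite !rNM rND rNM => {}c2.
  have e178 : rN 178 = 178 :> R by [].
  have e100 : rN 100 = 100 :> R by [].
  rewrite e178 e100 in c2.
  have l3E : ln (3 * rN n) = ln 3 + ln (rN n) by rewrite lnM ?posrE//; clear -N1; lra.
  have a1 : rN (t * (693 * 1000 + 147) / (1000 * 1000))%num <= rN t * ln 2.
    apply: le_trans (rN_div_le _ _ _) _ => //.
    rewrite !rNM rND rNM.
    have e10 : rN 10 = 10 :> R by [].
    have e3 : rN 1000 = 10 ^+ 3 :> R by rewrite -[1000%num]/(10 * 10 * 10)%num !rNM e10; ring.
    have e693 : rN 693 = 693 :> R by [].
    have e147 : rN 147 = 147 :> R by [].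
    rewrite e3 e693 e147 -mulrA; apply: ler_wpM2l; first exact: ltW.
    have /andP[l2 _] := ln2_bounds R; apply: le_trans l2; clear; lra.
  have a2 : rN (t * 109 / 100)%num <= rN t * ln 3.
    apply: le_trans (rN_div_le _ _ _) _ => //.
    have e109 : rN 109 = 109 :> R by [].
    rewrite rNM e100 e109 -mulrA; apply: ler_wpM2l; first exact: ltW.
    by have /andP[] := ln3_bounds R.
  have a3 : rN (N.log2 n) * rN (t * (693 * 1000 + 147) / (1000 * 1000))%num + rN (t * 109 / 100)%num
     <= rN t * ln (3 * rN n).
    rewrite l3E mulrDr addrC; apply: lerD => //.
    apply: le_trans (ler_wpM2l (rN_ge0 R _) a1) _.
    rewrite mulrCA; apply: ler_wpM2l; first exact: ltW.
    exact: rN_log2.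
  have b0 : 0 <= ln (3 * rN n) by apply: ln_ge0; clear -N1; lra.
  have h2 : (rN s * rN t) * 100 <= (rN s * rN t) * (v * 178 * ln (3 * rN n)).
    apply: le_trans c2 _.
    rewrite [leRHS](_ : _ = (rN s * v * 178) * (rN t * ln (3 * rN n))); last by ring.
    apply: ler_pM => //.
    + by apply: mulr_ge0 => //; exact: rN_ge0.
    + by apply: addr_ge0; [apply: mulr_ge0|]; exact: rN_ge0.
    + by apply: ler_wpM2r.
  rewrite ler_pM2l in h2; last exact: mulr_gt0.
  apply: le_trans (_ : 178 / 100 * (v * ln (3 * rN n)) <= _).
    move: h2; clear; lra.
  by rewrite -[leRHS]mulrA; apply: ler_wpM2r g1; exact: mulr_ge0.
Qed.

Lemma scan_sound (s t : N) l n vl vh lh r : s <> 0%num -> t <> 0%num -> (2 < N.to_nat n)%N -> odd (N.to_nat n) ->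
  (forall i, (i < size l)%N -> nth false l i = prime (N.to_nat n + i.*2)) ->
  rN vl <= rN s * V (N.to_nat n) -> rN s * V (N.to_nat n) <= rN vh -> rN t * ln (rN n) <= rN lh ->
  scan s t l n vl vh lh = Some r ->
  (forall p, prime p -> (N.to_nat n <= p < N.to_nat n + (size l).*2)%N -> good p) /\
  (rN r.1 <= rN s * V (N.to_nat n + (size l).*2) <= rN r.2).
Proof.
move=> s0 t0; have S0 : 0 < rN s by exact: rN_gt0. have T0 : 0 < rN t by exact: rN_gt0.
elim: l n vl vh lh => [|b l IH] n vl vh lh n2 on Hl hl hh hlh.
  by move=> [<-]; rewrite addn0 hl hh; split=> // p _ /andP[a b]; exfalso; clear -a b; lia.
have n0 : n <> 0%num by move=> e; rewrite e in n2.
have N0 : 0 < rN n by exact: rN_gt0.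
have n2E : N.to_nat (n + 2)%num = (N.to_nat n).+2 by clear; lia.
(* [n + 1] is even and exceeds [2], so a step of the scan passes at most one prime. *)
have VE : V (N.to_nat n).+2 = V (N.to_nat n) * (if prime (N.to_nat n) then 1 - (rN n)^-1 else 1).
  rewrite !unsievedS [prime _.+1](_ : _ = false) ?mulr1//.
  by apply/negbTE/negP => /even_prime [|/=]; [clear -n2; lia|rewrite on].
have lhE : rN t * ln (rN (n + 2)%num) <= rN (lh + (t * (2 * n + 2) / (n * (n + 2)) + 1))%num.
  rewrite !rND.
  have e2 : rN 2 = 2 :> R by []. have e1 : rN 1 = 1 :> R by [].
  have d0 : (n * (n + 2) <> 0)%num by clear -n0; nia.
  have := rN_div_ge R (t * (2 * n + 2))%num d0; rewrite !rNM !rND !rNM e2 e1 => hd.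
  apply: le_trans (lerD hlh hd).
  have lr : ln (rN n + 2) - ln (rN n) <= (2 * rN n + 2) / (rN n * (rN n + 2)).
    have np : 0 < rN n + 2 by clear -N0; lra.
    have := @ln_trapezoid R ((rN n + 2) / rN n).
    rewrite {1}ler_pdivlMr// mul1r ln_div ?posrE// => /(_ ltac:(clear; lra)) /le_trans; apply.
    rewrite le_eqVlt; apply/orP; left; apply/eqP; field.
    by apply/andP; split; rewrite gt_eqF.
  have := ler_wpM2l (ltW T0) lr; rewrite mulrBr mulrA; clear; lra.
have Hl' i : (i < size l)%N -> nth false l i = prime (N.to_nat (n + 2)%num + i.*2).
  by move=> il; have := Hl i.+1 il; rewrite n2E /= doubleS addnS addnS => ->.
have on' : odd (N.to_nat (n + 2)%num) by rewrite n2E /= negbK.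
have n2' : (2 < N.to_nat (n + 2)%num)%N by rewrite n2E ltnS ltnW// ltnW.
have bE : b = prime (N.to_nat n) by have := Hl 0%N isT; rewrite addn0.
have szE : (N.to_nat n + (size (b :: l)).*2 = N.to_nat (n + 2)%num + (size l).*2)%N.
  by rewrite n2E /= doubleS !addnS !addSn.
have vn0 : 0 <= rN s * V (N.to_nat n) by apply: mulr_ge0; [exact: ltW|exact: unsieved_ge0].
move=> /=; case: ifPn => hb.
  case: ifP => // /andP[c1 c2] hs.
  have pn : prime (N.to_nat n) by rewrite -bE.
  have gn := check_good s0 t0 n2 hl hh hlh c1 c2.
  have i1 : (rN n)^-1 <= 1 by rewrite invf_le1// ler1n; clear -n2; lia.
  have i0 : 0 <= 1 - (rN n)^-1 by clear -i1; lra.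
  (* Subtraction in [N] is cut off at [0]; this keeps a lower bound valid because [V] is
     nonnegative. *)
  have hl2 : rN (vl - (vl / n + 1))%num <= rN s * V (N.to_nat (n + 2)%num).
    rewrite n2E VE pn mulrA; apply: rN_sub_le; first exact: mulr_ge0.
    have := rN_div_ge R vl n0; rewrite rND [rN 1](_ : _ = 1)// => hd.
    have := ler_wpM2r i0 hl; rewrite mulrBr mulr1; move: hd; clear; lra.
  have hh2 : rN s * V (N.to_nat (n + 2)%num) <= rN (vh - vh / n)%num.
    rewrite n2E VE pn mulrA; apply: le_trans (rN_sub_ge _ _ _).
    have := rN_div_le R vh n0.
    have := ler_wpM2r i0 hh; rewrite [leRHS]mulrBr mulr1; clear; lra.
  have [gl gv] := IH _ _ _ _ n2' on' Hl' hl2 hh2 lhE hs.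
  rewrite szE; split=> // p pp /andP[np pn'].
  have [->//|pne] := eqVneq p (N.to_nat n).
  have [e|pne'] := eqVneq p (N.to_nat n).+1.
    have [|] := even_prime pp; first by rewrite e; clear -n2; lia.
    by rewrite e /= on.
  by apply: gl => //; rewrite pn' n2E andbT; clear -np pne pne'; lia.
have pn : prime (N.to_nat n) = false by rewrite -bE; exact: negbTE.
have hV : V (N.to_nat (n + 2)%num) = V (N.to_nat n) by rewrite n2E VE pn mulr1.
move=> hs; have [gl gv] := IH _ _ _ _ n2' on' Hl' (ltac:(by rewrite hV) : rN vl <= rN s * V (N.to_nat (n + 2)%num))
  (ltac:(by rewrite hV) : rN s * V (N.to_nat (n + 2)%num) <= rN vh) lhE hs.
rewrite szE; split=> // p pp /andP[np pn'].
have [e|pne] := eqVneq p (N.to_nat n); first by rewrite -e pp in pn.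
have [e|pne'] := eqVneq p (N.to_nat n).+1.
  have [|] := even_prime pp; first by rewrite e; clear -n2; lia.
  by rewrite e /= on.
by apply: gl => //; rewrite pn' n2E andbT; clear -np pne pne'; lia.
Qed.

End ScanSound.

Lemma size_strike p c l : size (strike p c l) = size l.
Proof. by elim: l c => //= b l IH [|c] /=; rewrite IH. Qed.

Lemma size_sieve ps l : size (sieve ps l) = size l.
Proof. by elim: ps l => //= p ps IH l; rewrite IH size_strike. Qed.

(** * Consequences for [M] and [epsilon0] *)

Section MertensNumerics.
Variable R : realType.
Local Notation M := (@mertens_product R).
Local Notation V := (@unsieved R).
Local Notation rN := (@rN R).
Local Notation gam := (euler_gamma R).

Lemma scan_range_sound (s t : N) K vl vh : s <> 0%num -> t <> 0%num ->
  (32 < K)%N -> (K.*2.+1 <= 211 * 211)%N -> scan_range s t K = Some (vl, vh) ->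
  (forall p, prime p -> (3 <= p < K.*2.+1)%N -> mertens_good R p) /\ rN s * V K.*2.+1 <= rN vh.
Proof.
move=> s0 t0 K32 KX; rewrite /scan_range.
set l := behead _; have S0 : 0 < rN s by exact: rN_gt0. have T0 : 0 < rN t by exact: rN_gt0.
have szl : size l = K.-1 by rewrite /l size_behead size_sieve size_nseq.
have nl i : (i.+1 < K)%N -> nth false l i = prime (3 + i.*2)%N.
  move=> iK; rewrite /l nth_behead sieve_prime.
  - by congr (prime _); clear; lia.
  - exact: iK.
  - by clear -iK KX; lia.
clearbody l; clear KX.
have sz1 : size (take 31 l) = 31%N by rewrite size_takel// szl; clear -K32; lia.
have sz2 : size (drop 31 l) = (K.-1 - 31)%N by rewrite size_drop szl.
have e2 : rN 2 = 2 by []. have e10 : rN 10 = 10 by []. have e1 : rN 1 = 1 by [].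
have e11 : rN 11 = 11 by [].
have V3 : V 3 = 2^-1 by rewrite /unsieved big_mkcond !big_nat_recr//= big_geq// !mul1r; lra.
have n3 : N.to_nat 3 = 3%N by [].
have n65 : N.to_nat 65 = 65%N by [].
case E1 : (scan s t _ 3 _ _ _) => [[vl1 vh1]|//] E2.
have nl1 i : (i < size (take 31 l))%N -> nth false (take 31 l) i = prime (N.to_nat 3 + i.*2)%N.
  by rewrite sz1 => i31; rewrite nth_take// nl//; clear -i31 K32; lia.
have a1 : rN (s / 2) <= rN s * V (N.to_nat 3) by rewrite n3 V3 -e2; apply: rN_div_le.
have a2 : rN s * V (N.to_nat 3) <= rN (s / 2 + 1) by rewrite n3 V3 -e2 rND e1; apply: rN_div_ge.
have a3 : rN t * ln (rN 3) <= rN (t * 11 / 10 + 1).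
  rewrite rND e1; apply: le_trans (rN_div_ge _ _ _); last by [].
  rewrite rNM e11 e10 -mulrA; apply: ler_wpM2l; first exact: ltW.
  by have /andP[] := ln3_bounds R.
have [g1 /andP[b1 b2]] := @scan_sound R s t _ 3%num _ _ _ _ s0 t0 isT isT nl1 a1 a2 a3 E1.
rewrite sz1 n3 /= in b1 b2 g1.
have nl2 i : (i < size (drop 31 l))%N -> nth false (drop 31 l) i = prime (N.to_nat 65 + i.*2)%N.
  rewrite sz2 => iK; rewrite nth_drop nl; last by clear -iK K32; lia.
  by rewrite n65; congr (prime _); clear; lia.
have a4 : rN t * ln (rN 65) <= rN (t * (4174 * 1000 + 394) / (1000 * 1000) + 1).
  rewrite rND e1; apply: le_trans (rN_div_ge _ _ _); last by [].
  have e3 : rN 1000 = 10 ^+ 3 by rewrite -[1000%num]/(10 * 10 * 10)%num !rNM e10; ring.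
  have e4174 : rN 4174 = 4 * 10 ^+ 3 + 174.
    have e4 : rN 4 = 4 by []. have e174 : rN 174 = 174 by [].
    by rewrite -[4174%num]/(4 * 1000 + 174)%num rND rNM e3 e4 e174.
  have e394 : rN 394 = 394 by [].
  rewrite !rNM rND rNM e3 e4174 e394 -mulrA; apply: ler_wpM2l; first exact: ltW.
  have e65 : rN 65 = 2 ^+ 6 * (65 / 64) :> R by rewrite -[rN 65]/(65%:R); field.
  have p65 : 0 < 65 / 64 :> R by clear; lra.
  rewrite e65 lnM ?posrE ?exprn_gt0// ln_pow2.
  have h1 := @ln_trapezoid R (65 / 64) ltac:(clear; lra).
  have /andP[_ u2] := ln2_bounds R; move: h1 u2; rewrite invf_div; clear; move: (ln _) (ln _) => x y h1 u2; lra.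
have [g2 /andP[_ b4]] := @scan_sound R s t _ 65%num _ _ _ _ s0 t0 isT isT nl2 b1 b2 a4 E2.
have nE : (65 + (size (drop 31 l)).*2 = K.*2.+1)%N by rewrite sz2; clear -K32; lia.
rewrite n65 nE in g2 b4; split=> [p pp /andP[p3 pK]|]; last exact: b4.
by have [p65|p65] := ltnP p 65; [apply: g1; rewrite ?p3|apply: g2; rewrite ?p65].
Qed.

Definition scan_limit X := [/\ (200 * 200 < X)%N,
  forall p, prime p -> (3 <= p < X)%N -> mertens_good R p & V X <= 56 / 10 ^+ 3].

Lemma scan_limit_of_scan (s t : N) K : s <> 0%num -> t <> 0%num ->
  (200 * 200 < K.*2.+1 <= 211 * 211)%N ->
  scan_ok s t K ->
  scan_limit K.*2.+1.
Proof.
move=> s0 t0 /andP[K1 K2]; rewrite /scan_ok; case E : (scan_range _ _ _) => [[vl vh]|//] c.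
have K32 : (32 < K)%N by clear -K1; lia.
have [g b] := scan_range_sound s0 t0 K32 K2 E.
split; [exact: K1|exact: g|].
have := rN_le R c; rewrite !rNM => {}c.
have s1 : 0 < rN s by exact: rN_gt0.
have e10 : rN 10 = 10 by [].
have e3 : rN 1000 = 10 ^+ 3 by rewrite -[1000%num]/(10 * 10 * 10)%num !rNM e10; ring.
have e56 : rN 56 = 56 by [].
rewrite e3 e56 in c; have p3 : 0 < 10 ^+ 3 :> R by exact: exprn_gt0.
rewrite (ler_pdivlMr _ _ p3) -(ler_pM2l s1) mulrA; apply: le_trans c.
by apply: ler_wpM2r b; exact: ltW.
Qed.

Lemma scan_limit_ex : exists X, scan_limit X.
Proof.
have [s [t [K [s0 t0 hK c]]]] := scan_check.
exists K.*2.+1; exact (scan_limit_of_scan s0 t0 hK c).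
Qed.

Lemma odd_prime_ge3 p : prime p -> odd p -> (2 < p)%N.
Proof. by move=> pp op; have := prime_gt1 pp; case: p op {pp} => [|[|[|p]]]. Qed.

(* The factor [3] is available because an odd composite [a] is at least [3] times its largest prime factor. *)
Lemma mertens_product_ln3 p : prime p -> odd p -> 1 <= M p * ln (3 * p%:R).
Proof.
move=> pp op; have p3 := odd_prime_ge3 pp op; have [X [X1 g _]] := scan_limit_ex.
have [pX|Xp] := ltnP p X.
  by have [|_ h] := g p pp; first by rewrite p3.
by apply: mertens_product_ln3_large; apply: leq_trans X1 Xp.
Qed.

Lemma not_mertens_large X p : scan_limit X -> prime p -> odd p -> ~ mertens_prime R p -> (X <= p)%N.
Proof.
move=> [_ g _] pp op nM; rewrite leqNgt; apply/negP => pX; apply: nM; split; first exact: pp.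
have p3 := odd_prime_ge3 pp op; have [|h _] := g p pp; first by rewrite p3.
by rewrite -[leRHS]mul1r ler_pdivlMr// ln_nat_gt0// ltnW.
Qed.

Lemma epsilon0_le X : scan_limit X ->
  (epsilon0 R <= (23 / 20 * (M X ^+ 2 / (2 - X%:R^-1)))%:E)%E.
Proof.
move=> hX; have [X1 _ _] := hX.
have X0 : (1 < X)%N by apply: leq_ltn_trans X1; clear; lia.
pose P q := (X <= q)%N && prime q.
pose b q := (23 / 20 * (M q ^+ 2 / q%:R)).
have b0 q : 0 <= b q.
  by rewrite /b; apply: mulr_ge0; [clear; lra|apply: divr_ge0; [exact: sqr_ge0|exact: ler0n]].
apply: le_trans (_ : _ <= \esum_(p in [set q | P q]) (b p)%:E)%E _.
  rewrite /epsilon0 esum_mkcond [leRHS]esum_mkcond; apply: le_esum => p _.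
  case: ifPn => [/set_mem[pp op nM]|_]; last first.
    by case: ifP => _; rewrite lee_fin.
  have Kp := not_mertens_large hX pp op nM.
  rewrite mem_set; last by rewrite /= /P Kp.
  rewrite lee_fin /b invfM [p%:R^-1 * _]mulrC -mulrBl mulrA; apply: ler_wpM2r; first by rewrite invr_ge0.
  apply: mertens_product_upper; [exact: pp|exact (leq_trans X1 Kp)].
rewrite -nneseries_esum; last by move=> n _; rewrite lee_fin.
apply: lime_le; first by apply: is_cvg_nneseries => n _ _; rewrite lee_fin.
apply: nearW => n; rewrite sumEFin lee_fin.
have m0 : 0 <= 23 / 20 :> R by clear; lra.
rewrite /b -mulr_sumr; apply: ler_wpM2l; first exact: m0.
have [Kn|nK] := leqP X n; last first.
  rewrite big_nat_cond big1; last by move=> i /andP[/andP[_ ik] /andP[ki _]]; exfalso; clear -ik ki nK; lia.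
  apply: divr_ge0; first exact: sqr_ge0.
  rewrite subr_ge0; apply: le_trans (_ : 1 <= 2); last by clear; lra.
  by rewrite invf_le1 ?ltr0n ?ler1n ltnW.
apply: le_trans (mertens_product_sq_sum R X0 Kn).
rewrite (@big_cat_nat _ _ _ X 0 n)//= big_nat_cond big1 ?add0r; last first.
  by move=> i /andP[/andP[_ ik] /andP[ki _]]; exfalso; clear -ik ki; lia.
rewrite big_nat_cond [leRHS]big_nat_cond le_eqVlt; apply/orP; left; apply/eqP.
by apply: eq_bigl => i; rewrite /P; case: (X <= i)%N.
Qed.

(** [e^gamma / 6] is [M 3 / 3]. It differs from [1 / (3 ln 3)] by about [0.0066], while the bound
    for [epsilon0] obtained at the end of the scan is below [0.0059]. *)
Lemma epsilon0_gap : (epsilon0 R + (expR gam / 6)%:E < ((3 * ln 3)^-1)%:E)%E.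
Proof.
have [X hX] := scan_limit_ex; have [X1 _ hV] := hX.
apply: le_lt_trans (_ : _ <= _ + (expR gam / 6)%:E)%E _; first exact: leeD2r (epsilon0_le hX).
rewrite -EFinD lte_fin.
have /andP[_ g2] := exp_gamma_bounds R.
have K1 : X%:R^-1 <= 1 / 200 :> R.
  by rewrite div1r lef_pV2 ?posrE ?ltr0n ?ler_nat; clear -X1; lia.
have hM : M X <= (178 * 100 + 12) / (100 * 100) * (56 / 10 ^+ 3).
  by rewrite mertens_product_unsieved; apply: ler_pM; [exact: expR_ge0|exact: unsieved_ge0|exact: g2|exact: hV].
have M0 := ltW (mertens_product_gt0 R X).
have hM2 : M X ^+ 2 <= ((178 * 100 + 12) / (100 * 100) * (56 / 10 ^+ 3)) ^+ 2.
  rewrite !expr2; apply: ler_pM; [exact: M0|exact: M0|exact: hM|exact: hM].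
have d0 : 0 < 2 - X%:R^-1 :> R by clear -K1; lra.
have h1 : M X ^+ 2 / (2 - X%:R^-1) <= 51 / 10 ^+ 4.
  rewrite ler_pdivrMr; last exact: d0.
  apply: le_trans hM2 _.
  move: K1; move: (X%:R^-1); clear => k K1; lra.
have /andP[a3 b3] := ln3_bounds R.
have h3 : (3 * (11 / 10))^-1 <= (3 * ln 3)^-1 :> R.
  by rewrite lef_pV2 ?posrE; clear -a3 b3; lra.
apply: lt_le_trans h3; move: h1 g2; move: (M _ ^+ 2 / _) (expR _); clear => x y h1 g2; lra.
Qed.

Lemma gamma_third_lt : expR gam / 3 < (2 * ln 2)^-1.
Proof.
have /andP[_ g2] := exp_gamma_bounds R; have /andP[l2 u2] := ln2_bounds R.
apply: le_lt_trans (_ : 6 / 10 < _); first by clear -g2; lra.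
rewrite -[ltLHS]invrK ltf_pV2 ?posrE; clear -l2 u2; lra.
Qed.

End MertensNumerics.

(** * A Kraft inequality for primitive sets *)

Section Kraft.
Variable R : realFieldType.

Definition prime_weight n m : R := \prod_(n <= r < m | prime r) (1 - r%:R^-1).

Lemma prime_factor_bounds r : prime r -> 0 <= (1 - r%:R^-1 : R) <= 1.
Proof.
move=> pr; have r0 := prime_gt0 pr.
by rewrite subr_ge0 gerBl invr_ge0 ler0n andbT invf_le1 ?ltr0n// ler1n.
Qed.

Lemma prime_weight_le1 n m : prime_weight n m <= 1.
Proof. by rewrite /prime_weight; apply: prodr_ile1 => r /prime_factor_bounds. Qed.

Lemma prime_weight_geq n m : (m <= n)%N -> prime_weight n m = 1.
Proof. by move=> mn; rewrite /prime_weight big_geq. Qed.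

Lemma prime_weight_ltn n m : (n < m)%N ->
  prime_weight n m = (if prime n then 1 - n%:R^-1 else 1) * prime_weight n.+1 m.
Proof. by move=> nm; rewrite /prime_weight big_mkcond big_ltn// -big_mkcond. Qed.

Definition min_factor_ge n b := forall p, prime p -> (p %| b)%N -> (n <= p)%N.

Lemma min_factor_max_pdiv n b : (1 < b)%N -> min_factor_ge n b -> (n <= max_pdiv b)%N.
Proof. by move=> b1; apply; [exact: max_pdiv_prime|exact: max_pdiv_dvd]. Qed.

Lemma min_factor_dvd n b d : (d %| b)%N -> min_factor_ge n b -> min_factor_ge n d.
Proof. by move=> db rb p pp pd; apply: rb pp (dvdn_trans pd db). Qed.

Lemma max_pdiv_dvd_leq p b : (0 < b)%N -> prime p -> (p %| b)%N -> (p <= max_pdiv b)%N.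
Proof. by move=> b0 pp pb; apply: max_pdiv_max; rewrite mem_primes pp b0. Qed.

(** The largest prime factors of [n * c] and [c] agree unless [c = 1], and then both products are
    empty. *)
Lemma prime_weight_max_pdivM n c : prime n -> (0 < c)%N -> min_factor_ge n c ->
  prime_weight n (max_pdiv (n * c)) = prime_weight n (max_pdiv c).
Proof.
move=> pn c0 rc; have n1 := prime_gt1 pn; have n0 := ltnW n1.
have nc1 : (1 < n * c)%N by apply: leq_trans n1 _; exact: leq_pmulr.
have nc0 := ltnW nc1.
have pm := max_pdiv_prime nc1; have := max_pdiv_dvd (n * c); rewrite Euclid_dvdM//.
have [->|c1] := eqVneq c 1%N.
  rewrite muln1 dvdn1 => /orP[h|/eqP h]; last by rewrite h [max_pdiv 1]/= in pm *.
  by rewrite !prime_weight_geq//; exact: dvdn_leq.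
have {c1}c1 : (1 < c)%N by rewrite ltn_neqAle eq_sym c1.
move=> h; congr prime_weight; apply/eqP; rewrite eqn_leq; apply/andP; split; last first.
  by apply: max_pdiv_dvd_leq => //; [exact: max_pdiv_prime|apply: dvdn_mull; exact: max_pdiv_dvd].
case/orP: h => h; last exact: max_pdiv_dvd_leq.
by apply: leq_trans (dvdn_leq n0 h) _; exact: min_factor_max_pdiv.
Qed.

Definition primitive_seq (s : seq nat) :=
  uniq s /\ {in s &, forall a b, (a %| b)%N -> a = b}.

Lemma primitive_seq_filter (P : pred nat) s : primitive_seq s -> primitive_seq [seq b <- s | P b].
Proof.
move=> [us ps]; split; first exact: filter_uniq.
by move=> a b; rewrite !mem_filter => /andP[_ sa] /andP[_ sb]; exact: ps.
Qed.

(* Peel off the prime [n]: elements prime to [n] are [n.+1]-rough, the others are [n] times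
   an [n]-rough primitive set, and the two parts have total weights at most [1 - 1/n] and [1/n]. *)
Lemma primitive_rough_sum_le1 n s : primitive_seq s ->
  {in s, forall b, (0 < b)%N /\ min_factor_ge n b} ->
  \sum_(b <- s) b%:R^-1 * prime_weight n (max_pdiv b) <= 1.
Proof.
have [N sN] : exists N, {in s, forall b, (b <= N)%N}.
  by exists (\max_(b <- s) b) => b bs; exact: leq_bigmax_seq.
(* The measure drops in both branches: either [n] grows, or division by [n] lowers the bound [N] on
   the elements. *)
have [k] := ubnP (N + (N - n))%N; elim: k => // k IH in n N s sN *; rewrite ltnS => kN ps hs.
(* [1] divides everything, so in a primitive list it stands alone; otherwise [max_pdiv] is a genuine
   prime factor. *)
have [s1|s1] := boolP (1%N \in s).
  have -> : s = [:: 1%N].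
    have [us ds] := ps; apply: perm_small_eq => //; apply: uniq_perm => // b.
    rewrite inE; apply/idP/eqP => [bs|->//].
    by rewrite (ds 1%N b)// dvd1n.
  by rewrite big_seq1 invr1 mul1r; exact: prime_weight_le1.
have b1 b : b \in s -> (1 < b)%N.
  move=> bs; have [b0 _] := hs b bs; rewrite ltn_neqAle b0 andbT.
  by apply/eqP => e; rewrite e bs in s1.
have [Nn|nN] := ltnP N n.
  rewrite big_seq big1 ?ler01// => b bs; exfalso.
  have [b0 rb] := hs b bs; have := min_factor_max_pdiv (b1 b bs) rb.
  have := max_pdiv_leq b0; have := sN b bs; clear -Nn; lia.
have [pn|npn] := boolP (prime n); last first.
  have rS b : b \in s -> min_factor_ge n.+1 b.
    move=> bs p pp pb; have [_ /(_ p pp pb)] := hs b bs; rewrite leq_eqVlt => /orP[/eqP e|//].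
    by rewrite e pp in npn.
  rewrite big_seq (eq_bigr (fun b => b%:R^-1 * prime_weight n.+1 (max_pdiv b))); last first.
    move=> b bs; have := min_factor_max_pdiv (b1 b bs) (rS b bs).
    by move=> /prime_weight_ltn ->; rewrite (negbTE npn) mul1r.
  (* For [N = n] the truncated difference [N - n] cannot drop any more, but then no element is
     left. *)
  rewrite -big_seq; have [Nn|Nn] := eqVneq N n.
    rewrite big_seq big1 ?ler01// => b bs; exfalso.
    have [b0 _] := hs b bs; have := min_factor_max_pdiv (b1 b bs) (rS b bs).
    have := max_pdiv_leq b0; have := sN b bs; clear -Nn; lia.
  apply: (IH n.+1 N) => //; first by clear -kN Nn nN; lia.
  by move=> b bs; split; [exact: (hs b bs).1|exact: rS].
have n0 := prime_gt0 pn; have n1 := prime_gt1 pn.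
have rn0 : 0 < n%:R :> R by rewrite ltr0n.
rewrite (bigID (fun b => n %| b)%N)/=.
have h1 : \sum_(b <- s | ~~ (n %| b)%N) b%:R^-1 * prime_weight n (max_pdiv b) <= 1 - n%:R^-1.
  have rS b : b \in s -> ~~ (n %| b)%N -> min_factor_ge n.+1 b.
    move=> bs nb p pp pb; have [_ /(_ p pp pb)] := hs b bs; rewrite leq_eqVlt => /orP[/eqP e|//].
    by rewrite e pb in nb.
  rewrite -big_filter.
  rewrite big_seq (eq_bigr (fun b => (1 - n%:R^-1) * (b%:R^-1 * prime_weight n.+1 (max_pdiv b)))); last first.
    move=> b; rewrite mem_filter => /andP[nb bs]; have := min_factor_max_pdiv (b1 b bs) (rS b bs nb).
    by move=> /prime_weight_ltn ->; rewrite pn; ring.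
  rewrite -big_seq -mulr_sumr -[leRHS]mulr1; have /andP[n0' _] := prime_factor_bounds pn.
  apply: ler_wpM2l => //; have [Nn|Nn] := eqVneq N n.
    rewrite big_seq big1 ?ler01// => b; rewrite mem_filter => /andP[nb bs]; exfalso.
    have [b0 _] := hs b bs; have := min_factor_max_pdiv (b1 b bs) (rS b bs nb).
    have := max_pdiv_leq b0; have := sN b bs; clear -Nn; lia.
  apply: (IH n.+1 N).
  - by move=> b; rewrite mem_filter => /andP[_]; exact: sN.
  - by clear -kN Nn nN; lia.
  - exact: primitive_seq_filter.
  - by move=> b; rewrite mem_filter => /andP[nb bs]; split; [exact: (hs b bs).1|exact: rS].
have h2 : \sum_(b <- s | (n %| b)%N) b%:R^-1 * prime_weight n (max_pdiv b) <= n%:R^-1.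
  set s' := [seq b %/ n | b <- s & n %| b]%N.
  have s'E c : c \in s' -> (n * c)%N \in s.
    by move=> /mapP[b]; rewrite mem_filter => /andP[nb bs] ->; rewrite mulnC divnK.
  have c0 c : c \in s' -> (0 < c)%N.
    by move=> /s'E /b1; case: c => //; rewrite muln0.
  have rc c : c \in s' -> min_factor_ge n c.
    move=> cs; have [_] := hs _ (s'E c cs); apply: min_factor_dvd; exact: dvdn_mull.
  have -> : \sum_(b <- s | (n %| b)%N) b%:R^-1 * prime_weight n (max_pdiv b) =
      n%:R^-1 * \sum_(c <- s') c%:R^-1 * prime_weight n (max_pdiv c).
    rewrite -[in LHS]big_filter big_map mulr_sumr [in LHS]big_seq [in RHS]big_seq; apply: eq_bigr => b bs.
    have cs : (b %/ n)%N \in s' by exact: map_f.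
    rewrite -[in LHS](_ : n * (b %/ n) = b)%N; last first.
      by move: bs; rewrite mem_filter => /andP[nb _]; rewrite mulnC divnK.
    rewrite prime_weight_max_pdivM//; [|exact: c0|exact: rc].
    by rewrite natrM invfM mulrA.
  rewrite -[leRHS]mulr1; apply: ler_wpM2l; first by rewrite invr_ge0.
  apply: (IH n N.-1).
  - move=> c cs; have := sN _ (s'E c cs); have := c0 c cs; clear -n1; nia.
  - by clear -kN nN n0; lia.
  - have [us ds] := ps; split.
      rewrite map_inj_in_uniq ?filter_uniq// => a b; rewrite !mem_filter => /andP[na _] /andP[nb _] e.
      by rewrite -(divnK na) e divnK.
    move=> a b /s'E sa /s'E sb ab; apply/eqP; rewrite -(eqn_pmul2l n0); apply/eqP.
    by apply: ds => //; rewrite dvdn_pmul2l.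
  - by move=> c cs; split; [exact: c0|exact: rc].
clear -h1 h2; lra.
Qed.

End Kraft.

(** * Primitive sets of odd numbers *)

Lemma primitiveS (A B : set nat) : B `<=` A -> primitive A -> primitive B.
Proof.
by move=> BA [A1 pA]; split=> [b /BA/A1//|a b /BA Aa /BA]; exact: pA.
Qed.

Lemma odd_dvd d b : (d %| b)%N -> odd b -> odd d.
Proof. by move=> /dvdnP[k ->]; rewrite oddM => /andP[]. Qed.

Section ErdosSum.
Variable R : realType.
Implicit Types (A B C : set nat) (b q : nat).
Local Notation M := (@mertens_product R).
Local Notation f := (@erdos_sum R).
Local Notation gam := (euler_gamma R).
Local Notation t b := ((b%:R * ln b%:R)^-1 : R).

Lemma erdos_term_ge0 b : 0 <= t b.
Proof. by rewrite invr_ge0; apply: mulr_ge0; [exact: ler0n|exact: ln_nat_ge0]. Qed.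

Lemma erdos_sum_ge0 B : (0 <= f B)%E.
Proof. by apply: esum_ge0 => b _; rewrite lee_fin; exact: erdos_term_ge0. Qed.

(** The sum is a supremum over finite subsets, so estimates reduce to duplicate-free lists. *)
Lemma erdos_sum_leP B (c : R) : (f B <= c%:E)%E <->
  forall s : seq nat, uniq s -> (forall b, b \in s -> B b) -> \sum_(b <- s) t b <= c.
Proof.
split=> [h s us sB|h].
  rewrite -lee_fin; apply: le_trans h; apply: esum_ge; exists [set` s].
    by split; [exact: finite_seq|exact: sB].
  by rewrite -fsbig_seq// sumEFin.
apply: ge_ereal_sup => _ [X [finX XB] <-]; rewrite fsbig_finite// sumEFin lee_fin.
by apply: h => [|b]; [exact: finmap.fset_uniq|rewrite in_fset_set// => /set_mem/XB].
Qed.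

Lemma erdos_sumID B C : f C = (f (C `&` B) + f (C `&` ~` B))%E.
Proof. by apply: esumID => b _; rewrite lee_fin; exact: erdos_term_ge0. Qed.

Lemma erdos_sumU B C : B `&` C = set0 -> f (B `|` C) = (f B + f C)%E.
Proof.
move=> BC; rewrite (erdos_sumID B); congr (f _ + f _)%E.
  by apply/seteqP; split=> [b []//|b Bb]; split=> //; left.
apply/seteqP; split=> [b [[]]//|b Cb]; split; first by right.
by move=> Bb; have : (B `&` C) b by []; rewrite BC.
Qed.

Lemma erdos_sumS B C : B `<=` C -> (f B <= f C)%E.
Proof.
by move=> BC; rewrite (erdos_sumID B C) setIidr// leeDl// erdos_sum_ge0.
Qed.

Lemma erdos_sum1 b : f [set b] = (t b)%:E.
Proof. by apply: esum_set1; rewrite lee_fin; exact: erdos_term_ge0. Qed.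

Lemma erdos_sum_fibers (g : nat -> nat) B (D : set nat) : (forall b, B b -> D (g b)) ->
  f B = \esum_(q in D) f (B `&` [set b | g b = q]).
Proof.
move=> BD; rewrite [in LHS](_ : B = \bigcup_(q in D) (B `&` [set b | g b = q])).
  apply: esum_bigcupT; last by move=> b; rewrite lee_fin; exact: erdos_term_ge0.
  by apply/trivIsetP => i j _ _ ij; apply/seteqP; split=> // b [[_ /= gi] [_ /= gj]];
    rewrite -gi -gj eqxx in ij.
by apply/seteqP; split=> [b Bb|b [q _ []//]]; exists (g b) => //; exact: BD.
Qed.

Lemma mertens_product_weight q p : (q <= p)%N -> M p = M q * prime_weight R q p.
Proof.
by move=> qp; rewrite /mertens_product -mulrA; congr (_ * _); rewrite (@big_cat_nat _ _ _ q).
Qed.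

(** With [p = max_pdiv c], [q >= 3] and [c >= p] give [ln (q c) >= ln (3 p) >= 1 / M p], and [M p]
    is [M q] times the weight of [c]. *)
Lemma erdos_term_class_le q c : prime q -> odd q -> (1 < c)%N -> odd c -> min_factor_ge q c ->
  t (q * c) <= M q / q%:R * (c%:R^-1 * prime_weight R q (max_pdiv c)).
Proof.
move=> pq oq c1 oc rc; have q3 := odd_prime_ge3 pq oq.
set p := max_pdiv c; have pp : prime p by exact: max_pdiv_prime.
have pc : (p %| c)%N by exact: max_pdiv_dvd.
have op : odd p := odd_dvd pc oc.
have c0 := ltnW c1; have p0 := prime_gt0 pp; have q0 := prime_gt0 pq.
have -> : M q / q%:R * (c%:R^-1 * prime_weight R q p) = (q * c)%:R^-1 * M p.
  by rewrite (mertens_product_weight (min_factor_max_pdiv c1 rc)) natrM invfM; ring.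
rewrite invfM; apply: ler_wpM2l; first by rewrite invr_ge0.
have hl : @ln R (3 * p%:R) <= ln (q * c)%:R.
  rewrite -natrM; apply: ler_ln_nat; first by rewrite muln_gt0.
  by apply: leq_mul => //; exact: dvdn_leq.
have h3 : 0 < @ln R (3 * p%:R) by rewrite -natrM ln_nat_gt0//; clear -p0; lia.
apply: le_trans (_ : (ln (3 * p%:R))^-1 <= _).
  by rewrite lef_pV2 ?posrE//; exact: lt_le_trans hl.
by rewrite -[leLHS]mul1r ler_pdivrMr//; exact: mertens_product_ln3.
Qed.

(** Dividing by [q] leaves a primitive set without prime factors below [q], to which
    [primitive_rough_sum_le1] applies. Since [q] itself is not in [B], every quotient exceeds
    [1]. *)
Lemma erdos_sum_class_le q B : prime q -> odd q -> primitive B ->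
  (forall b, B b -> [/\ odd b, ~~ prime b & pdiv b = q]) -> (f B <= (M q / q%:R)%:E)%E.
Proof.
move=> pq oq [B1 pB] hB; apply/erdos_sum_leP => s us sB; have q0 := prime_gt0 pq.
have bE b : b \in s -> (q * (b %/ q))%N = b.
  by move=> /sB/hB[_ _ <-]; rewrite mulnC divnK// pdiv_dvd.
have c1 b : b \in s -> (1 < b %/ q)%N.
  move=> bs; have := B1 b (sB b bs); have [_] := hB b (sB b bs); rewrite -(bE b bs).
  case: (b %/ q)%N => [|[|k]]; [by rewrite muln0|by rewrite muln1 pq|by rewrite mulKn].
have rc b : b \in s -> min_factor_ge q (b %/ q)%N.
  move=> bs p pp pb; have [_ _ <-] := hB b (sB b bs).
  by apply: pdiv_min_dvd; [exact: prime_gt1|rewrite -(bE b bs) dvdn_mull].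
have oc b : b \in s -> odd (b %/ q)%N.
  by move=> bs; have [+ _ _] := hB b (sB b bs); rewrite -{1}(bE b bs) oddM => /andP[].
rewrite big_seq; apply: le_trans (_ : \sum_(b <- s | b \in s) M q / q%:R *
    ((b %/ q)%:R^-1 * prime_weight R q (max_pdiv (b %/ q))) <= _).
  apply: ler_sum => b bs; rewrite -{1 2}(bE b bs).
  by apply: erdos_term_class_le => //; [exact: c1|exact: oc|exact: rc].
rewrite -big_seq -mulr_sumr -[leRHS]mulr1; apply: ler_wpM2l.
  by apply: divr_ge0 => //; exact/ltW/mertens_product_gt0.
rewrite -(big_map (fun b => b %/ q)%N xpredT (fun c => c%:R^-1 * prime_weight R q (max_pdiv c))).
apply: primitive_rough_sum_le1.
  split.
    by rewrite map_inj_in_uniq// => a b sa sb e; rewrite -(bE a sa) e bE.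
  move=> _ _ /mapP[a sa ->] /mapP[b sb ->] ab; congr (_ %/ _)%N.
  by apply: pB; [exact: sB|exact: sB|rewrite -(bE a sa) -(bE b sb) dvdn_pmul2l].
by move=> _ /mapP[b bs ->]; split; [exact: ltnW (c1 b bs)|exact: rc].
Qed.

(** The elements are grouped by least prime factor [q]. If [q] is in [B], it is alone in its class
    by primitivity. Otherwise the class has at most [M q / q], which exceeds [1 / (q ln q)] only if
    [q] is not Mertens, and then by a summand of [epsilon0]. *)
Lemma erdos_sum_odd_le B : primitive B -> (forall b, B b -> odd b) ->
  (f B <= f (prime_support B) + epsilon0 R)%E.
Proof.
move=> pB oB; have [B1 dB] := pB.
pose S := [set p | [/\ prime p, odd p & ~ mertens_prime R p]].
pose E q : \bar R := if q \in S then (M q / q%:R - t q)%:E else 0%E.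
have E0 q : (0 <= E q)%E.
  rewrite /E; case: ifPn => // /set_mem[pq oq nM]; rewrite lee_fin subr_ge0 invfM mulrC.
  apply: ler_wpM2r; first by rewrite invr_ge0.
  by rewrite leNgt; apply/negP => h; apply: nM; split=> //; exact: ltW.
have PB q : prime_support B q -> prime q /\ odd q.
  by move=> [pq [b Bb qb]]; split=> //; exact: odd_dvd qb (oB b Bb).
rewrite (@erdos_sum_fibers pdiv B (prime_support B)); last first.
  move=> b Bb; split; first exact: pdiv_prime (B1 b Bb).
  by exists b => //; exact: pdiv_dvd.
apply: le_trans (_ : _ <= \esum_(q in prime_support B) ((t q)%:E + E q))%E _.
  apply: le_esum => q Pq; have [pq oq] := PB q Pq.
  have [Bq|nBq] := pselect (B q).
    rewrite [X in f X](_ : _ = [set q]) ?erdos_sum1 ?leeDl//.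
    apply/seteqP; split=> [b [Bb /= bq]|b ->]; last by split=> //; exact: pdiv_id.
    by apply/esym/dB => //; rewrite -bq pdiv_dvd.
  apply: le_trans (_ : (M q / q%:R)%:E <= _)%E.
    apply: erdos_sum_class_le => //; first by apply: primitiveS pB => b [].
    move=> b [Bb /= bq]; split=> //; first exact: oB.
    by apply/negP => pb; apply: nBq; rewrite -bq pdiv_id.
  rewrite /E; case: ifPn => qS; first by rewrite -EFinD lee_fin addrC subrK.
  rewrite adde0 lee_fin invfM mulrC; apply: ler_wpM2l; first by rewrite invr_ge0.
  by have [[]|nM] := pselect (mertens_prime R q) => //; rewrite mem_set in qS.
rewrite esumD; [|by move=> q _; rewrite lee_fin; exact: erdos_term_ge0|by []].
apply: leeD2l; rewrite /epsilon0 [leRHS]esum_mkcond.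
rewrite -/S [leRHS](esumID (prime_support B)) ?setTI//; last by move=> q _; exact: E0.
by rewrite leeDl//; apply: esum_ge0 => q _; exact: E0.
Qed.

Lemma mertens_product3 : M 3 = expR gam / 2.
Proof. by rewrite /mertens_product big_mkcond !big_nat_recr//= big_geq// !mul1r; congr (_ * _); field. Qed.

Lemma mertens_product5 : M 5 = expR gam / 3.
Proof. by rewrite /mertens_product big_mkcond !big_nat_recr//= big_geq// !mul1r !mulr1; congr (_ * _); field. Qed.

(** [M q / q = M q - M q.+1] at a prime [q]; [maxn n 5] covers the [n] below the start of the
    sum. *)
Lemma mertens_product_telescope n :
  \sum_(0 <= q < n | (4 < q)%N && prime q) M q / q%:R + M (maxn n 5) = M 5.
Proof.
elim: n => [|n IH]; first by rewrite big_nil add0r.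
rewrite big_mkcond big_nat_recr//= -big_mkcond/= -[RHS]IH -addrA; congr (_ + _).
have [n4|n4] := leqP n 4; first by rewrite /= add0r; congr M; clear -n4; lia.
rewrite !(maxn_idPl _)//; last exact: ltnW.
by rewrite andTb mertens_productS; case: ifP => _; [ring|rewrite add0r mulr1].
Qed.

Lemma erdos_sum_rough5_le B : primitive B ->
  (forall b, B b -> [/\ odd b, ~~ prime b & ~~ (3 %| b)%N]) -> (f B <= (expR gam / 3)%:E)%E.
Proof.
move=> pB hB; have [B1 _] := pB.
have ge5 b : B b -> (4 < pdiv b)%N.
  move=> Bb; have [ob _ nb] := hB b Bb; have pp := pdiv_prime (B1 b Bb).
  have op := odd_dvd (pdiv_dvd b) ob; have := odd_prime_ge3 pp op.
  rewrite leq_eqVlt => /orP[/eqP e|]; first by rewrite e pdiv_dvd in nb.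
  by rewrite leq_eqVlt => /orP[/eqP e|//]; rewrite -e in op.
have h0 q : 0 <= M q / q%:R by apply: divr_ge0 => //; exact/ltW/mertens_product_gt0.
rewrite (@erdos_sum_fibers pdiv B [set q | (4 < q)%N && prime q]); last first.
  by move=> b Bb; rewrite /= ge5// pdiv_prime// B1.
apply: le_trans (_ : \esum_(q in [set q | (4 < q)%N && prime q]) (M q / q%:R)%:E <= _)%E.
  apply: le_esum => q /= /andP[q4 pq].
  apply: erdos_sum_class_le => //.
  - by have [e|//] := even_prime pq; rewrite e in q4.
  - by apply: primitiveS pB => b [].
  - by move=> b [Bb /= bq]; have [ob nb _] := hB b Bb.
rewrite -nneseries_esum; last by move=> n _; rewrite lee_fin.
apply: lime_le; first by apply: is_cvg_nneseries => n _ _; rewrite lee_fin.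
apply: nearW => n; rewrite sumEFin lee_fin -mertens_product5 -(mertens_product_telescope n) lerDl.
exact/ltW/mertens_product_gt0.
Qed.

Lemma erdos_sum_dilate_le m B (c : R) : (0 < m)%N -> (forall b, B b -> (1 < b)%N) ->
  (f B <= c%:E)%E -> (f (muln m @` B) <= (m%:R^-1 * c)%:E)%E.
Proof.
move=> m0 B1 /erdos_sum_leP hB; apply/erdos_sum_leP => s us sB.
have sE a : a \in s -> exists2 b, B b & a = (m * b)%N.
  by move=> /sB[b Bb <-]; exists b.
have dE a : a \in s -> (m * (a %/ m))%N = a /\ B (a %/ m)%N.
  by move=> /sE[b Bb ->]; rewrite mulKn.
apply: le_trans (_ : m%:R^-1 * \sum_(b <- [seq a %/ m | a <- s]%N) t b <= _); last first.
  apply: ler_wpM2l; first by rewrite invr_ge0.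
  apply: hB; last by move=> _ /mapP[a sa ->]; have [] := dE a sa.
  by rewrite map_inj_in_uniq// => a b sa sb e; rewrite -(dE a sa).1 e (dE b sb).1.
rewrite big_map mulr_sumr big_seq [leRHS]big_seq; apply: ler_sum => a sa.
have [e Bb] := dE a sa; have b1 := B1 _ Bb; rewrite -{1 2}e natrM -mulrA invfM.
apply: ler_wpM2l; first by rewrite invr_ge0.
have b0 := ltnW b1; rewrite lef_pV2 ?posrE.
- apply: ler_wpM2l => //; rewrite -natrM; apply: ler_ln_nat => //; exact: leq_pmull.
- by apply: mulr_gt0; rewrite ?ltr0n// -natrM ln_nat_gt0//; apply: leq_trans b1 _; exact: leq_pmull.
- by apply: mulr_gt0; rewrite ?ltr0n// ln_nat_gt0.
Qed.

End ErdosSum.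

(** * The even part *)

Section EvenPart.
Variable R : realType.
Implicit Types (A B C : set nat) (a b k : nat).
Local Notation f := (@erdos_sum R).
Local Notation gam := (euler_gamma R).
Local Notation t b := ((b%:R * ln b%:R)^-1 : R).

Definition odd_cofactors A k : set nat := [set b | odd b /\ A (2 ^ k * b)%N].

Definition odd_prime_support A : set nat := [set p | prime_support A p /\ odd p].

Lemma odd_prime_support_sub A B : (forall b, B b -> odd b /\ exists2 a, A a & (b %| a)%N) ->
  prime_support B `<=` odd_prime_support A.
Proof.
move=> BA p [pp [b Bb pb]]; have [ob [a Aa ba]] := BA b Bb.
by split; [split=> //; exists a => //; exact: dvdn_trans ba|exact: odd_dvd pb ob].
Qed.

Lemma odd_part_primitive A : primitive A -> primitive (odd_part A).
Proof. by apply: primitiveS => a []. Qed.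

Lemma odd_cofactors_gt1 A k b : primitive A -> ~ A (2 ^ k)%N -> odd_cofactors A k b -> (1 < b)%N.
Proof.
move=> [A1 _] nA [ob Ab]; case: b => [|[|//]] in ob Ab *; first by [].
by rewrite muln1 in Ab.
Qed.

(* Replacing the multiples in [odd_part A] of odd cofactors by these cofactors keeps a primitive set. *)
Lemma erdos_sum_odd_cofactors_le A k : primitive A -> (0 < k)%N -> ~ A (2 ^ k)%N ->
  (forall a, odd_part A a -> (3 %| a)%N -> prime a) ->
  (f (odd_cofactors A k) + f (odd_part A) <=
   f (odd_prime_support A) + epsilon0 R + (expR gam / 3)%:E)%E.
Proof.
move=> primA k0 nA h3; have [A1 dA] := primA; set B := odd_cofactors A k.
pose D := [set d | exists2 b, B b & (b %| d)%N].
have k2 : (1 < 2 ^ k)%N by rewrite -(expn0 2) ltn_exp2l.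
have even2k b : ~~ odd (2 ^ k * b) by rewrite oddM oddX orbF eqn0Ngt k0.
have primB : primitive B.
  split=> [b|a b [oa Aa] [ob Ab] ab]; first exact: odd_cofactors_gt1.
  have := dA _ _ Aa Ab; rewrite dvdn_pmul2l ?(ltnW k2)// => /(_ ab) /eqP.
  by rewrite eqn_pmul2l ?(ltnW k2)// => /eqP.
pose C := odd_part A `&` ~` D.
have primBC : primitive (B `|` C).
  (* The mixed cases: an element of [B] cannot divide one of [C] by the choice of [D]; an element of
     [C] dividing [b] in [B] divides [2^k b] in [A], hence equals this even number. *)
  split=> [b [Bb|[[Ab _] _]]|a b [Ba|[[Aa oa] Da]] [Bb|[[Ab ob] Db]] ab].
  - exact: (primB.1 b).
  - exact: A1.
  - exact: (primB.2 a b).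
  - by case: Db; exists a.
  - exfalso; have e : a = (2 ^ k * b)%N by apply: dA => //; [exact: Bb.2|exact: dvdn_mull].
    by move: (even2k b); rewrite -e oa.
  - exact: dA.
have BC0 : B `&` C = set0.
  by apply/seteqP; split=> // b [Bb [_ Db]]; apply: Db; exists b.
(* The sum is regrouped as [B] together with [C], estimated as one primitive odd set, plus the
   elements of [D]. *)
rewrite (erdos_sumID _ D (odd_part A)) addeCA addeC.
have -> : (f B + f (odd_part A `&` ~` D) = f (B `|` C))%E by rewrite erdos_sumU.
rewrite -/C; apply: leeD.
  apply: le_trans (@erdos_sum_odd_le R _ primBC _) _; first by move=> b [[]|[[]]].
  apply: leeD2r; apply: erdos_sumS; apply: odd_prime_support_sub => b [[ob Ab]|[[Ab ob] _]].
    by split=> //; exists (2 ^ k * b)%N => //; exact: dvdn_mull.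
  by split=> //; exists b.
apply: erdos_sum_rough5_le; first by apply: primitiveS primA => d [[]].
move=> d [[Ad od] [b Bb bd]].
(* A prime [d] would equal its divisor [b > 1]; then [d] divides [2^k d] in [A], against primitivity
   and parity. *)
have npd : ~~ prime d.
  apply/negP => pd; have b1 := primB.1 b Bb.
  have e : b = d by have [_ /(_ b bd)/orP[/eqP e|/eqP//]] := primeP pd; rewrite e in b1.
  by have := dA d _ Ad Bb.2 _; rewrite e => /(_ (dvdn_mull _ (dvdnn d))) e2; move: (even2k d); rewrite -e2 od.
by split=> //; apply/negP => d3; move/negP: npd; apply; apply: h3.
Qed.

Lemma fiber_odd_cofactors A k : primitive A ->
  A `&` [set a | logn 2 a = k] = muln (2 ^ k)%N @` odd_cofactors A k.
Proof.
move=> [A1 _]; apply/seteqP; split=> [a [Aa /= la]|_ [b [ob Ab] <-]].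
  have a0 := ltnW (A1 a Aa); have [b ob e] := pfactor_coprime (isT : prime 2) a0.
  rewrite la mulnC in e; rewrite coprime2n in ob.
  by exists b => //; split=> //; rewrite -e.
split=> //=; have b0 : (0 < b)%N by case: b ob {Ab}.
rewrite lognM ?expn_gt0// pfactorK// lognE /= b0 dvdn2 ob /= addn0//.
Qed.

(** A budget: the elements with exactly [k] factors [2] use at most [2^-k c]. If [2^k] is in [A], it
    is the only one of them, no element has more factors [2], and what is left of the budget,
    [2^-(k-1) c], covers it because [c >= f {2}]. *)
Lemma erdos_sum_even_part_le A (c : R) : primitive A -> t 2 <= c ->
  (forall k, (0 < k)%N -> ~ A (2 ^ k)%N -> (f (odd_cofactors A k) <= c%:E)%E) ->
  (f (A `&` [set a | ~~ odd a]) <= c%:E)%E.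
Proof.
move=> primA tc hk; have [A1 dA] := primA; set Ae := A `&` _.
have c0 : 0 <= c by apply: le_trans tc; exact: erdos_term_ge0.
have FE k : Ae `&` [set a | (logn 2 a).-1 = k] = A `&` [set a | logn 2 a = k.+1].
  apply/seteqP; split=> a [/= h1 h2].
    have [Aa ea] := h1; split=> //=; have := A1 a Aa => a1.
    have : (0 < logn 2 a)%N by rewrite logn_gt0 mem_primes /= (ltnW a1) dvdn2.
    by rewrite -h2; case: (logn 2 a).
  split; last by rewrite /= h2.
  split=> //=; have : (0 < logn 2 a)%N by rewrite h2.
  by rewrite logn_gt0 mem_primes dvdn2 => /and3P[].
rewrite (@erdos_sum_fibers R (fun a => (logn 2 a).-1) Ae setT)//.
rewrite -nneseries_esumT; last by move=> k; exact: erdos_sum_ge0.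
apply: lime_le; first by apply: is_cvg_nneseries => n _ _; exact: erdos_sum_ge0.
apply: nearW => n.
suff [[_ h]|[_ h]] : ((forall k, (k < n)%N -> ~ A (2 ^ k.+1)%N) /\
     (\sum_(0 <= k < n) f (Ae `&` [set a | (logn 2 a).-1 = k]) <= ((1 - (2 ^ n)%:R^-1) * c)%:E)%E) \/
   ((exists2 k, (k < n)%N & A (2 ^ k.+1)%N) /\
     (\sum_(0 <= k < n) f (Ae `&` [set a | (logn 2 a).-1 = k]) <= c%:E)%E).
- apply: le_trans h _; rewrite lee_fin; by apply: ler_piMl => //; rewrite gerBl.
- exact: h.
have p0 m : 0 < (2 ^ m)%:R :> R by rewrite ltr0n expn_gt0.
elim: n => [|n [[nA IH]|[[k kn Ak] IH]]].
- by left; split=> //; rewrite big_nil expn0 invr1 subrr mul0r.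
- rewrite big_nat_recr//=; have [An|An] := pselect (A (2 ^ n.+1)%N).
    right; split; first by exists n.
    apply: le_trans (leeD IH (_ : _ <= ((2 ^ n)%:R^-1 * c)%:E)%E) _; last first.
      by rewrite -EFinD lee_fin -mulrDl subrK mul1r.
    rewrite FE (_ : _ `&` _ = [set (2 ^ n.+1)%N]).
      rewrite erdos_sum1 lee_fin; apply: le_trans (ler_wpM2l _ tc); last by rewrite invr_ge0 ltW.
      have l2 : 0 < @ln R 2 by rewrite -[2]/(2%:R) ln_nat_gt0.
      rewrite -invfM lef_pV2 ?posrE.
      + rewrite expnS natrM mulrA [2%:R * _]mulrC -[leRHS]mulrA -!mulrA; apply: ler_wpM2l; first exact: ltW.
        apply: ler_wpM2l => //; rewrite ler_ln ?posrE ?mulr_gt0// -[leLHS]mul1r.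
        by apply: ler_wpM2r => //; rewrite ler1n expn_gt0.
      + by apply: mulr_gt0 => //; rewrite ln_nat_gt0// -[1%N](expn0 2) ltn_exp2l.
      + by apply: mulr_gt0 => //; apply: mulr_gt0.
    apply/seteqP; split=> [a [Aa /= la]|a ->]; last by split=> //=; rewrite pfactorK.
    by apply/esym/dA => //; rewrite -la pfactor_dvdnn.
  left; split.
    by move=> k; rewrite ltnS leq_eqVlt => /orP[/eqP->//|]; exact: nA.
  apply: le_trans (leeD IH (_ : _ <= ((2 ^ n.+1)%:R^-1 * c)%:E)%E) _.
    rewrite FE fiber_odd_cofactors//; apply: erdos_sum_dilate_le.
    + by rewrite expn_gt0.
    + by move=> b; exact: odd_cofactors_gt1.
    + exact: hk.
  rewrite -EFinD lee_fin -mulrDl; apply: ler_wpM2r => //.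
  by rewrite expnS natrM invfM; move: (_%:R^-1); clear => i; rewrite [leLHS](_ : _ = 1 - 2^-1 * i)//; field.
- right; split; first by exists k => //; exact: ltnW.
  rewrite big_nat_recr//= FE [X in f X](_ : _ = set0).
    by rewrite [erdos_sum _ set0]esum_set0 adde0.
  apply/seteqP; split=> // a [Aa /= la].
  have ka : (2 ^ k.+1 %| a)%N by rewrite pfactor_dvdn// ?la//; [exact: ltnW|exact: ltnW (A1 a Aa)].
  by have e := dA _ _ Ak Aa ka; move: la; rewrite -e pfactorK// => -[e2]; rewrite e2 ltnn in kn.
Qed.

End EvenPart.

(** * Derivation of the contradiction *)

Lemma ge0_fin_ex (R : realType) (x : \bar R) : (0 <= x)%E -> (x < +oo)%E -> exists r : R, x = r%:E.
Proof. by case: x => [r _ _|//|//]; exists r. Qed.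

Local Open Scope ereal_scope.

Theorem theorem4p5 (R : realType) (A : set nat)
    (primA : primitive A)
    (hA : erdos_sum R (prime_support A) + epsilon0 R < erdos_sum R A) :
  erdos_sum R (odd_part A) < erdos_sum R (prime_support (odd_part A)).
Proof.
rewrite ltNge; apply/negP => h; have [A1 dA] := primA.
pose P3 := prime_support (odd_part A); pose Podd := odd_prime_support A.
have pA3 := odd_part_primitive primA.
have oA3 a : odd_part A a -> odd a by case.
have e0 : 0 <= epsilon0 R.
  apply: esum_ge0 => q [pq oq nM]; rewrite lee_fin subr_ge0 invfM mulrC ler_wpM2r ?invr_ge0//.
  by rewrite leNgt; apply/negP => hq; apply: nM; split=> //; exact: ltW.
have PA0 := erdos_sum_ge0 R (prime_support A).
have fin : erdos_sum R (prime_support A) + epsilon0 R < +oo by apply: lt_le_trans hA _; rewrite leey.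
have [e eE] : exists r : R, epsilon0 R = r%:E.
  by apply: ge0_fin_ex => //; apply: le_lt_trans fin; rewrite leeDr.
have PoddA : Podd `<=` prime_support A by move=> p [].
have P3odd : P3 `<=` Podd.
  by apply: odd_prime_support_sub => b [Ab ob]; split=> //; exists b.
have [x xE] : exists r : R, erdos_sum R Podd = r%:E.
  apply: ge0_fin_ex; first exact: erdos_sum_ge0.
  by apply: le_lt_trans (erdos_sumS R PoddA) _; apply: le_lt_trans fin; rewrite leeDl.
have [y yE] : exists r : R, erdos_sum R P3 = r%:E.
  apply: ge0_fin_ex; first exact: erdos_sum_ge0.
  by apply: le_lt_trans (erdos_sumS R P3odd) _; rewrite xE ltry.
have hU : erdos_sum R (odd_part A) <= y%:E + e%:E.
  by rewrite -yE -eE; exact: erdos_sum_odd_le.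
have [a aE] : exists r : R, erdos_sum R (odd_part A) = r%:E.
  apply: ge0_fin_ex; first exact: erdos_sum_ge0.
  by apply: le_lt_trans hU _; rewrite -EFinD ltry.
have yx : (y <= x)%R by rewrite -lee_fin -yE -xE; exact: erdos_sumS.
have ay : (y <= a)%R by rewrite -lee_fin -yE -aE.
rewrite aE -EFinD lee_fin in hU.
have h3 b : odd_part A b -> (3 %| b)%N -> prime b.
  move=> Ab b3; have [A3|nA3] := pselect (A 3%N).
    by rewrite -(dA 3%N b A3 Ab.1 b3).
  (* The elements prime to [3] are charged to [P(A_3)] without [3], and the multiples of [3], all
     composite here, total at most [M 3 / 3]. Together they stay below [f (P(A_3))]. *)
  exfalso; pose C := [set b : nat | (3 %| b)%N].
  have P33 : P3 3%N by split=> //; exists b.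
  have h1 : erdos_sum R (odd_part A `&` C) <= (expR (euler_gamma R) / 6)%:E.
    rewrite (_ : (_ / 6)%R = (mertens_product R 3 / 3%:R)%R); last by rewrite mertens_product3; field.
    apply: erdos_sum_class_le => //; first by apply: primitiveS pA3 => c [].
    move=> c [[Ac oc] /= c3]; split=> //.
      by apply/negP => pc; apply: nA3; move: c3; rewrite /C /= dvdn_prime2// => /eqP->.
    apply/eqP; rewrite eqn_leq pdiv_min_dvd// odd_prime_ge3//.
      exact: pdiv_prime (A1 c Ac).
    exact: odd_dvd (pdiv_dvd c) oc.
  have [z zE] : exists r : R, erdos_sum R (P3 `&` ~` [set 3%N]) = r%:E.
    apply: ge0_fin_ex; first exact: erdos_sum_ge0.
    by apply: le_lt_trans (@erdos_sumS R _ P3 _) _; [move=> ? []|rewrite yE ltry].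
  have h2 : erdos_sum R (odd_part A `&` ~` C) <= z%:E + e%:E.
    rewrite -zE -eE; apply: le_trans (@erdos_sum_odd_le R _ _ _) _.
    - by apply: primitiveS pA3 => c [].
    - by move=> c [[]].
    apply: leeD2r; apply: erdos_sumS => p [pp [c [Ac nc] pc]]; split.
      by split=> //; exists c.
    by move=> /= p3; apply: nc; rewrite /C /= -p3.
  have aS := erdos_sumID R C (odd_part A); have yS := erdos_sumID R [set 3%N] P3.
  rewrite [P3 `&` [set _]]setIC setIidl in yS; last by move=> _ ->.
  rewrite erdos_sum1 zE yE -EFinD in yS; case: yS => yS.
  have := epsilon0_gap R; rewrite eE -EFinD lte_fin => hg.
  have := leeD h1 h2; rewrite -aS aE -!EFinD lee_fin => hh.
  by move: ay hh hg; rewrite yS; clear; lra.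
have t2 := gamma_third_lt R; set t : R := (2 * ln 2)^-1%R in t2.
have even_le : erdos_sum R (A `&` [set a | ~~ odd a]) <= (x + e + t - a)%:E.
  apply: erdos_sum_even_part_le => //.
    (* [f {2} <= c] because [f A_3 <= f (P(A_3)) + epsilon0] and the primes of [A_3] are among the
       odd primes of [A]. *)
    by rewrite -/t; move: hU yx; clear; lra.
  move=> k k0 nAk; have := erdos_sum_odd_cofactors_le R primA k0 nAk h3.
  rewrite aE xE eE -!EFinD -leeBrDr// -EFinB => /le_trans; apply.
  by rewrite lee_fin; move: t2; clear; lra.
have AS := erdos_sumID R [set a | odd a] A.
have oE : A `&` [set a | odd a] = odd_part A by [].
have eE' : A `&` ~` [set a | odd a] = A `&` [set a | ~~ odd a].
  by congr (_ `&` _); apply/seteqP; split=> b /= /negP.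
rewrite oE eE' aE in AS.
(* An even element puts [2] into [P(A)], which supplies the [f {2}] in the bound for the even part.
   Without one, [A] equals [A_3], and [hU] alone contradicts the hypothesis. *)
have [[b [Ab eb]]|noeven] := pselect (exists b, (A `&` [set a | ~~ odd a]) b).
  have P2 : prime_support A 2%N by split=> //; exists b; rewrite // dvdn2.
  have PS := erdos_sumID R [set 2%N] (prime_support A).
  rewrite [_ `&` [set _]]setIC setIidl in PS; last by move=> _ ->.
  rewrite (_ : prime_support A `&` _ = Podd) in PS; last first.
    apply/seteqP; split=> p [Pp].
      by move=> p2; split=> //; have [e2|//] := even_prime Pp.1; case: p2.
    by move=> op; split=> // /= p2; rewrite p2 in op.
  rewrite erdos_sum1 xE -/t in PS.
  move: hA; rewrite AS PS eE -!EFinD => /lt_le_trans/(_ (leeD2l _ even_le)).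
  by rewrite -EFinD lte_fin; clear; lra.
move: hA; rewrite AS (_ : A `&` _ = set0); last first.
  by apply/seteqP; split=> // b hb; apply: noeven; exists b.
rewrite [erdos_sum _ set0]esum_set0 adde0 => hA.
have := le_lt_trans (leeD2r (epsilon0 R) (erdos_sumS R PoddA)) hA.
by rewrite xE eE -EFinD lte_fin; move: hU yx; clear; lra.
Qed.
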